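(* Let $d\in\mathbb{N}$. If $(x_n)_{n=1}^\infty\subseteq[0,1]^d$ is such that $$\sum_{h=1}^\infty \overline{D}\big((x_{n+h}-x_n)_{n=1}^\infty\big)^2<\infty,$$ where differences are taken coordinatewise modulo $1$, then $(x_n)_{n=1}^\infty$ is a sL-sequence.
   Context: Notation: $\mathbb{N}=\{1,2,3,\dots\}$; $m$ is Lebesgue measure on $[0,1]$ and $m^d$ is Lebesgue measure on $[0,1]^d$. Differences of elements of $[0,1]^d$ are taken coordinatewise modulo $1$. Discrepancy: for $(z_n)_{n=1}^N\subseteq[0,1]^d$, $D_N((z_n)_{n=1}^N)=\sup_{B\in\mathcal{R}}\left|\frac1N|\{1\le n\le N: z_n\in B\}|-m^d(B)\right|$, where $\mathcal{R}$ is the collection of all rectangular prisms (axis-parallel boxes) contained in $[0,1]^d$. For an infinite sequence, $\overline{D}((z_n)_{n=1}^\infty)=\limsup_{N\to\infty}D_N((z_n)_{n=1}^N)$. Permissible triple: for a bounded complex sequence $(z_n)_{n=1}^\infty$ and an increasing sequence $(N_q)_{q=1}^\infty\subseteq\mathbb{N}$, the triple $((z_n),(z_n),(N_q))$ is permissible if $\lim_{q\to\infty}\frac1{N_q}\sum_{n=1}^{N_q}z_{n+h}\overline{z_n}$ exists for all integers $h\ge 0$. A bounded complex sequence $(z_n)_{n=1}^\infty$ is spectrally Lebesgue if for every permissible triple $((z_n),(z_n),(N_q))$ there is $f\in L^1([0,1],m)$ with $\lim_{q\to\infty}\frac1{N_q}\sum_{n=1}^{N_q}z_{n+h}\overline{z_n}=\int_0^1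 f(x)e^{2\pi i hx}\,dx$ for all integers $h\ge0$. A sequence $(x_n)_{n=1}^\infty\subseteq[0,1]^d$ is a sL-sequence if for every (complex-valued) $f\in C([0,1]^d)$ with $\int_{[0,1]^d}f\,dm^d=0$ the sequence $(f(x_n))_{n=1}^\infty$ is spectrally Lebesgue. *)

(* Defs.v *)
From HB Require Import structures.
From mathcomp Require Import all_boot all_order all_algebra.
From mathcomp Require Import all_classical all_reals all_analysis.
From mathcomp Require Import complex.

Set Implicit Arguments.
Unset Strict Implicit.
Unset Printing Implicit Defensive.

Import Order.TTheory GRing.Theory Num.Theory.
Import numFieldNormedType.Exports.

Local Open Scope classical_set_scope.
Local Open Scope ring_scope.

(* Sequences (x_n)_{n >= 1} are represented by functions on nat with the index
   shifted by one: [x n] is x_{n+1}.  Thus a sum over 1 <= n <= N of terms in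
   x_n, x_{n+h} becomes a sum over n < N of terms in [x n], [x (n + h)]. *)

Definition measure_rV_display : measure_display.
Proof. exact: default_measure_display. Qed.

(* Product sigma-algebra on row vectors, generated by the coordinates;
   this is the construction that the library uses for tuples. *)
Section measurable_rV.
Context {R : realType}.
Variable n : nat.

Let coors : 'I_n -> 'rV[R]_n -> measurableTypeR R := fun i v => v ord0 i.

Let rV_set0 : g_sigma_preimage coors set0.
Proof. exact: sigma_algebra0. Qed.

Let rV_setC A : g_sigma_preimage coors A -> g_sigma_preimage coors (~` A).
Proof. exact: sigma_algebraC. Qed.

Let rV_bigcup (F : _^nat) : (forall i, g_sigma_preimage coors (F i)) ->
  g_sigma_preimage coors (\bigcup_i (F i)).
Proof. exact: sigma_algebra_bigcup. Qed.

HB.instance Definition _ := @isMeasurable.Build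
  measure_rV_display
  'rV[R]_n (g_sigma_preimage coors) rV_set0 rV_setC rV_bigcup.

End measurable_rV.

Lemma measurable_rVP (R : realType) d (T : measurableType d) n
    (f : T -> 'rV[R]_n) :
  measurable_fun setT f <->
  forall i, measurable_fun setT (fun t => f t ord0 i : measurableTypeR R).
Proof.
pose g i (t : T) : measurableTypeR R := f t ord0 i.
have E : g_sigma_preimage g = preimage_set_system setT f measurable.
  exact: (@g_sigma_preimage_comp _ (measurableTypeR R) n 'rV[R]_n
    (fun i (v : 'rV[R]_n) => v ord0 i)).
have -> : measurable_fun setT f <-> g_sigma_preimage g `<=` measurable.
  rewrite E; split=> [mf _ [C mC <-]|sub _ A mA]; first exact: mf.
  by apply: sub; exists A.
split=> [sub i _ A mA|mf].
- apply: sub; apply: sub_sigma_algebra; rewrite -bigcup_seq/=.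
  by exists i => /=; [rewrite mem_index_enum|exists A].
- apply: smallest_sub; first exact: sigma_algebra_measurable.
  rewrite -bigcup_seq/=; apply: bigcup_sub => i _ _ [A mA <-].
  exact: mf.
Qed.

Section lebesgue_cons.
Context {R : realType}.
Variables (n : nat) (m : {sigma_finite_measure set 'rV[R]_n -> \bar R}).

Definition rV_cons (p : measurableTypeR R * 'rV[R]_n) : 'rV[R]_n.+1 :=
  row_mx (const_mx p.1 : 'rV[R]_1) p.2.

Let rV_uncons (v : 'rV[R]_n.+1) : measurableTypeR R * 'rV[R]_n :=
  (v ord0 ord0, rsubmx (v : 'rV[R]_(1 + n))).

Lemma measurable_rV_cons : measurable_fun setT rV_cons.
Proof.
apply/measurable_rVP => i.
case: (split_ordP (i : 'I_(1 + n))) => j ->.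
- under eq_fun => p do
    rewrite /rV_cons (row_mxEl (const_mx p.1 : 'rV[R]_1)) mxE.
  exact: measurable_fst.
- under eq_fun => p do
    rewrite /rV_cons (row_mxEr (const_mx p.1 : 'rV[R]_1)).
  have /measurable_rVP := @measurable_snd _ _ (measurableTypeR R) 'rV[R]_n.
  exact.
Qed.

Let measurable_rV_uncons : measurable_fun setT rV_uncons.
Proof.
have /measurable_rVP coord := @measurable_id _ 'rV[R]_n.+1 setT.
apply/measurable_fun_pairP; split; first exact: coord.
apply/measurable_rVP => i.
under eq_fun do rewrite /= mxE.
exact: coord.
Qed.

Let rV_consK : cancel rV_cons rV_uncons.
Proof.
move=> [x v]; rewrite /rV_uncons /rV_cons row_mxKr; congr (_, _).
have -> : ord0 = lshift n ord0 :> 'I_(1 + n) by apply: val_inj.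
by rewrite (row_mxEl (const_mx x : 'rV[R]_1)) mxE.
Qed.

Definition lebesgue_cons : set 'rV[R]_n.+1 -> \bar R :=
  pushforward (@lebesgue_measure R \x m)%E rV_cons.

Let mcons := measurable_rV_cons.

Let lebesgue_cons0 : lebesgue_cons set0 = 0%E.
Proof. exact: measure0. Qed.

Let lebesgue_cons_ge0 A : (0 <= lebesgue_cons A)%E.
Proof. exact: measure_ge0. Qed.

Let lebesgue_cons_sigma_additive : semi_sigma_additive lebesgue_cons.
Proof.
move=> F mF tF mUF; rewrite /lebesgue_cons /pushforward preimage_bigcup.
apply: measure_semi_sigma_additive.
- by move=> k; rewrite -[X in measurable X]setTI; exact: mcons.
- apply/trivIsetP => /= i j _ _ ij; rewrite -preimage_setI.
  by move/trivIsetP : tF => /(_ _ _ _ _ ij) ->//; rewrite preimage_set0.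
- by rewrite -preimage_bigcup -[X in measurable X]setTI; exact: mcons.
Qed.

HB.instance Definition _ := isMeasure.Build _ _ _ lebesgue_cons
  lebesgue_cons0 lebesgue_cons_ge0 lebesgue_cons_sigma_additive.

Let sigma_finite_lebesgue_cons : sigma_finite setT lebesgue_cons.
Proof.
have /sigma_finiteP[F [FT ndF Foo]] := sigma_finiteT (@lebesgue_measure R).
have /sigma_finiteP[G [GT ndG Goo]] := sigma_finiteT m.
exists (fun k => rV_uncons @^-1` (F k `*` G k)).
  rewrite predeqE => v; split=> // _.
  have [i _ Fi] : (\bigcup_i F i) (rV_uncons v).1 by rewrite -FT.
  have [j _ Gj] : (\bigcup_i G i) (rV_uncons v).2 by rewrite -GT.
  exists (maxn i j) => //; split.
  - by apply: (subsetPset _ _ (ndF _ _ _)) Fi; exact: leq_maxl.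
  - by apply: (subsetPset _ _ (ndG _ _ _)) Gj; exact: leq_maxr.
move=> k; have [mF Fk] := Foo k; have [mG Gk] := Goo k; split.
  rewrite -[X in measurable X]setTI; apply: measurable_rV_uncons => //.
  exact: measurableX.
rewrite /lebesgue_cons /pushforward -comp_preimage.
rewrite (_ : rV_uncons \o rV_cons = id); last first.
  by apply/funext => p /=; rewrite rV_consK.
by rewrite preimage_id product_measure1E// lte_mul_pinfty// ge0_fin_numE.
Qed.

HB.instance Definition _ := Measure_isSigmaFinite.Build _ _ _ lebesgue_cons
  sigma_finite_lebesgue_cons.

End lebesgue_cons.

(* d-dimensional Lebesgue measure, as the d-fold product of lebesgue_measure *)
Fixpoint lebesgue_rV (R : realType) (d : nat) :
    {sigma_finite_measure set 'rV[R]_d -> \bar R} :=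
  match d with
  | 0 => [the {sigma_finite_measure set _ -> \bar R} of
            @dirac _ 'rV[R]_0 0 R]
  | d'.+1 => [the {sigma_finite_measure set _ -> \bar R} of
            lebesgue_cons (lebesgue_rV R d')]
  end.

(* The topology on complex numbers is that of the regular module (R[i])^o;
   the library does not attach one to R[i] itself. *)
Section spectrally_lebesgue.
Context {R : realType}.
Local Notation C := (R[i])^o.

(* e^{2 pi i t} *)
Definition cexp2pi (t : R) : R[i] :=
  Complex (cos (2 * pi * t)) (sin (2 * pi * t)).

Definition Cintegrable d (T : measurableType d)
    (mu : {measure set T -> \bar R})
    (D : set T) (f : T -> R[i]) :=
  mu.-integrable D (fun x => (complex.Re (f x))%:E) /\
  mu.-integrable D (fun x => (complex.Im (f x))%:E).

Definition Cintegral d (T : measurableType d)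
    (mu : {measure set T -> \bar R})
    (D : set T) (f : T -> R[i]) : R[i] :=
  Complex (\int[mu]_(x in D) complex.Re (f x))
          (\int[mu]_(x in D) complex.Im (f x)).

Definition autocorrelation (z : nat -> C) (h N : nat) : C :=
  N%:R^-1 * \sum_(n < N) z (n + h)%N * conjc (z n).

Definition permissible (z : nat -> C) (Nq : nat -> nat) :=
  [/\ bounded_fun z,
      forall q, (0 < Nq q)%N,
      {homo Nq : p q / (p < q)%N} &
      forall h : nat, cvgn (fun q => autocorrelation z h (Nq q))].

Definition spectrally_Lebesgue (z : nat -> C) :=
  bounded_fun z /\
  forall Nq : nat -> nat, permissible z Nq ->
    exists2 f : R -> R[i],
      Cintegrable (@lebesgue_measure R) `[0, 1] f &
      forall h : nat,
        (autocorrelation z h (Nq q) @[q --> \oo] -->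
           (Cintegral (@lebesgue_measure R) `[0, 1]
             (fun x => f x * cexp2pi (h%:R * x)) : C)).

End spectrally_lebesgue.

Section sL_sequence.
Context {R : realType} {d : nat}.

Definition box (I : 'I_d -> interval R) : set 'rV[R]_d :=
  [set v | forall i, v ord0 i \in I i].

Definition unit_cube : set 'rV[R]_d := box (fun=> `[0, 1]).

(* Faces may or may not belong to a box, each side being an arbitrary interval. *)
Definition unit_boxes : set (set 'rV[R]_d) :=
  [set B | (exists I, B = box I) /\ B `<=` unit_cube].

(* C([0,1]^d) is represented by functions on all of R^d that are continuous on
   the cube; their values outside the cube play no role. *)
Definition sL_sequence (x : nat -> 'rV[R]_d) :=
  forall f : 'rV[R]_d -> (R[i])^o, {within unit_cube, continuous f} ->
    Cintegral (lebesgue_rV R d) unit_cube f = 0 ->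
    spectrally_Lebesgue (f \o x).

Definition discrepancy (z : nat -> 'rV[R]_d) (N : nat) : R :=
  sup [set `| N%:R^-1 * #|[pred n : 'I_N | z n \in B]|%:R
              - fine (lebesgue_rV R d B) | | B in unit_boxes].

Definition upper_discrepancy (z : nat -> 'rV[R]_d) : \bar R :=
  limn_esup (fun N => (discrepancy z N)%:E).

(* Coordinatewise difference modulo 1, with representatives in [0, 1[. *)
Definition sub_mod1 (u v : 'rV[R]_d) : 'rV[R]_d :=
  \row_i ((u - v) ord0 i - (Num.floor ((u - v) ord0 i))%:~R).

End sL_sequence.

(* Main.v *)
Require Import Defs.
From mathcomp Require Import all_boot all_order all_algebra.
From mathcomp Require Import all_classical all_reals all_analysis.
From mathcomp Require Import measurable_realfun complex ring lra.

Set Implicit Arguments.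
Unset Strict Implicit.
Unset Printing Implicit Defensive.

Import Order.TTheory GRing.Theory Num.Theory.
Import numFieldNormedType.Exports.

Local Open Scope classical_set_scope.
Local Open Scope ring_scope.
Local Open Scope complex_scope.
Local Notation "x ^*" := (conjc x) : ring_scope.
#[local] Arguments conjc : simpl never.

(** Write e(t) for exp(2 pi i t). Fix a permissible subsequence of the averages
    of f(x_n) and refine it to an ultrafilter: then all averages of bounded
    sequences converge, and their limits form a positive functional L, invariant
    under shifts (sample_mean). It returns the given limits of correlations
    (corr_sample_mean), so a density for the correlations
    c_h(z) = L(z_{n+h} conj(z_n)) of z_n = f(x_n) has to be found.

    Characters. For an integer vector k <> 0 and z_n = e(k.x_n), the product
    z_{n+h} conj(z_n) is the character k at x_{n+h} - x_n. Its average is bounded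
    by a constant times the discrepancy: on a fine grid, summation by parts turns
    the character into a combination of indicators of boxes, with coefficients
    whose sum is bounded independently of the grid (exp_average_discrepancy).
    Hence the correlations of z are square summable (corr_l2_chi).

    Trigonometric polynomials. The correlations of a sum involve mixed terms
    which the hypothesis does not mention. The Fejer means
    F_N(z)(t) = L |sum_{a < N} z_{n+a} e(-at)|^2 / N avoid them: they are
    nonnegative trigonometric polynomials in t with coefficients
    (1 - h/N) c_h(z), and F_N(z + w) <= 2 F_N(z) + 2 F_N(w). By the
    relations of Parseval and Bessel, square summability of the correlations
    amounts to boundedness of the Fejer means in L^2, which passes to sums
    (corr_l2D). So every trigonometric polynomial without constant term has
    square summable correlations along x.

    Density. If the correlations of w are square summable, the Fejer means of w
    are Cauchy in L^2, hence in L^1. If z is a limit of such w in the seminorm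
    (L |z_n|^2)^(1/2), then the pointwise bound
    |F_N(z) - F_N(w)| <= F_N(z - w) / e + e (F_N(z) + F_N(w)), integrated by means
    of the identity int F_N(z) = L |z_n|^2, shows that F_N(z) is Cauchy in L^1 as
    well (fejer_cauchy1). Its limit is the density, as the coefficients of F_N(z)
    tend to c_h(z) (spectral_density).

    Approximation. It remains to approximate f(x_n) by trigonometric polynomials
    without constant term in the seminorm of L. A continuous function on the
    closed cube need not be periodic, so uniform approximation may fail; but
    square summable correlations force mean zero, by van der Corput's
    argument (cmean_eq0_of_corr_l2), so the characters k <> 0 have mean zero along
    x, and small neighbourhoods of the faces are negligible. This is proved for
    every mean carried by the cube that kills the nontrivial characters: indicators of
    half-spaces are approximable (approximable_halfspace), hence so are indicators of
    cells and continuous functions (approximable_continuous). Applied to the half-sum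
    of the mean along x and of the limit of grid averages, which is the integral
    on continuous functions, this gives one polynomial close to f for both; since
    f has integral zero, its constant term is small and can be dropped
    (approximation_along_sequence). *)

(** * Squared moduli and exponentials *)

Section squared_modulus.
Context {R : realType}.
Local Notation C := R[i].
Implicit Types (z w : C) (t s : R).

(** The modulus of an element of [R[i]] lies in [R[i]]; its square is taken in
    [R], where means are taken. *)
Definition nsq z : R := complex.Re z ^+ 2 + complex.Im z ^+ 2.

Lemma ReE_add z w : complex.Re (z + w) = complex.Re z + complex.Re w.
Proof. by case: z; case: w. Qed.

Lemma ImE_add z w : complex.Im (z + w) = complex.Im z + complex.Im w.
Proof. by case: z; case: w. Qed.

Lemma ReE_mul z w : complex.Re (z * w) =
  complex.Re z * complex.Re w - complex.Im z * complex.Im w.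
Proof. by case: z; case: w. Qed.

Lemma ImE_mul z w : complex.Im (z * w) =
  complex.Re z * complex.Im w + complex.Im z * complex.Re w.
Proof. by case: z => a b; case: w => c d /=. Qed.

Lemma ReZ t z : complex.Re (t%:C * z) = t * complex.Re z.
Proof. by rewrite ReE_mul /= mul0r subr0. Qed.

Lemma complex_ext z w : complex.Re z = complex.Re w ->
  complex.Im z = complex.Im w -> z = w.
Proof. by case: z => a b; case: w => c d /= -> ->. Qed.

Lemma nsq_ge0 z : 0 <= nsq z.
Proof. by rewrite addr_ge0// sqr_ge0. Qed.

Lemma nsqE z : (nsq z)%:C = z * z^*.
Proof. by case: z => a b; apply: complex_ext; rewrite /nsq/=; ring. Qed.

Lemma nsq0 : nsq 0 = 0.
Proof. by rewrite /nsq/=; ring. Qed.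

Lemma nsqM z w : nsq (z * w) = nsq z * nsq w.
Proof. by case: z => a b; case: w => c d; rewrite /nsq/=; ring. Qed.

Lemma nsq_conj z : nsq z^* = nsq z.
Proof. by case: z => a b; rewrite /nsq/= sqrrN. Qed.

Lemma nsqN z : nsq (- z) = nsq z.
Proof. by case: z => a b; rewrite /nsq/= !sqrrN. Qed.

Lemma nsq_real t : nsq t%:C = t ^+ 2.
Proof. by rewrite /nsq/=; ring. Qed.

Lemma nsqD_le z w : nsq (z + w) <= 2 * nsq z + 2 * nsq w.
Proof.
case: z => a b; case: w => c d; rewrite /nsq/=.
have := sqr_ge0 (a - c); have := sqr_ge0 (b - d); nra.
Qed.

(** |z|^2 - |w|^2 is the real part of (z - w) conj(z + w), to which the inequality
    of arithmetic and geometric means with weight [e] applies. *)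
Lemma nsqB_le (e : R) z w : 0 < e ->
  `|nsq z - nsq w| <= e^-1 * nsq (z - w) + e * (nsq z + nsq w).
Proof.
move=> e0.
have amgm x y : x * y <= (e^-1 * x ^+ 2 + e * y ^+ 2) / 2.
  have : 0 <= e^-1 * (x - e * y) ^+ 2.
    by rewrite mulr_ge0 ?sqr_ge0// invr_ge0 ltW.
  have -> : e^-1 * (x - e * y) ^+ 2 = e^-1 * x ^+ 2 + e * y ^+ 2 - 2 * (x * y).
    by field; rewrite gt_eqF.
  lra.
have amgm' x y : - (x * y) <= (e^-1 * x ^+ 2 + e * y ^+ 2) / 2.
  by have := amgm (- x) y; rewrite sqrrN mulNr.
case: z => a b; case: w => c d; rewrite /nsq/=.
have par : (a + c) ^+ 2 + (b + d) ^+ 2 <= 2 * (a ^+ 2 + b ^+ 2 + (c ^+ 2 + d ^+ 2)).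
  by have := sqr_ge0 (a - c); have := sqr_ge0 (b - d); nra.
have {}par := ler_wpM2l (ltW e0) par.
have pos : 0 <= e^-1 * ((a - c) ^+ 2 + (b - d) ^+ 2).
  by rewrite mulr_ge0 ?addr_ge0 ?sqr_ge0// invr_ge0 ltW.
have -> : a ^+ 2 + b ^+ 2 - (c ^+ 2 + d ^+ 2) =
  (a - c) * (a + c) + (b - d) * (b + d) by ring.
have := amgm (a - c) (a + c); have := amgm (b - d) (b + d).
have := amgm' (a - c) (a + c); have := amgm' (b - d) (b + d).
rewrite ler_norml => *; apply/andP; split; lra.
Qed.

Lemma cexp2piD s t : cexp2pi (s + t) = cexp2pi s * cexp2pi t :> C.
Proof.
rewrite /cexp2pi mulrDr; apply: complex_ext => /=.
  by rewrite cosD.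
by rewrite sinD addrC; ring.
Qed.

Lemma cexp2piN t : cexp2pi (- t) = (cexp2pi t)^* :> C.
Proof. by rewrite /cexp2pi mulrN cosN sinN. Qed.

Lemma cexp2pi0 : cexp2pi 0 = 1 :> C.
Proof. by rewrite /cexp2pi mulr0 cos0 sin0. Qed.

Lemma nsq_cexp2pi t : nsq (cexp2pi t) = 1.
Proof. by rewrite /nsq/= cos2Dsin2. Qed.

Lemma cexp2pi_conjK t : cexp2pi t * (cexp2pi t)^* = 1 :> C.
Proof. by rewrite -nsqE nsq_cexp2pi. Qed.

Lemma cexp2piMn n t : cexp2pi (n%:R * t) = cexp2pi t ^+ n :> C.
Proof.
elim: n => [|n IH]; first by rewrite mul0r cexp2pi0 expr0.
by rewrite -natr1 mulrDl mul1r cexp2piD IH exprSr.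
Qed.

Lemma cexp2pi1 : cexp2pi 1 = 1 :> C.
Proof.
rewrite /cexp2pi mulr1 mulr_natl.
by rewrite cos2pi sin2pi.
Qed.

Lemma cexp2pi_nat n : cexp2pi n%:R = 1 :> C.
Proof. by rewrite -(mulr1 n%:R) cexp2piMn cexp2pi1 expr1n. Qed.

Lemma cexp2pi_int (k : int) : cexp2pi k%:~R = 1 :> C.
Proof.
case: k => n; first exact: cexp2pi_nat.
by rewrite NegzE mulrNz cexp2piN cexp2pi_nat conjc1.
Qed.

End squared_modulus.

(** * Means *)

(** A mean is a normalized positive linear functional. It is only required to
    be linear on a subalgebra of functions: the bounded ones for limits of
    averages, the continuous ones for the integral over an interval. *)
Record mean (R : realType) (T : Type) := Mean {
  mdom : (T -> R) -> Prop;
  mval :> (T -> R) -> R;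
  mdom_cst : forall c, mdom (fun=> c);
  mdomD : forall f g, mdom f -> mdom g -> mdom (fun t => f t + g t);
  mdomM : forall f g, mdom f -> mdom g -> mdom (fun t => f t * g t);
  mval_cst : forall c, mval (fun=> c) = c;
  mvalD : forall f g, mdom f -> mdom g ->
    mval (fun t => f t + g t) = mval f + mval g;
  mvalZ : forall c f, mdom f -> mval (fun t => c * f t) = c * mval f;
  mval_ge0 : forall f, mdom f -> (forall t, 0 <= f t) -> 0 <= mval f }.

Section mean_theory.
Context {R : realType} {T : Type}.
Local Notation C := R[i].
Variable M : mean R T.

Lemma mdomZ c f : mdom M f -> mdom M (fun t => c * f t).
Proof. by move=> df; apply: mdomM => //; exact: mdom_cst. Qed.

Lemma mdomN f : mdom M f -> mdom M (fun t => - f t).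
Proof.
move=> /(mdomZ (-1)).
by under eq_fun do rewrite mulN1r.
Qed.

Lemma mdomB f g : mdom M f -> mdom M g -> mdom M (fun t => f t - g t).
Proof. by move=> df dg; apply: mdomD => //; exact: mdomN. Qed.

Lemma mvalB f g : mdom M f -> mdom M g ->
  M (fun t => f t - g t) = M f - M g.
Proof.
move=> df dg; rewrite mvalD//; last exact: mdomN.
rewrite (_ : (fun t => - g t) = (fun t => -1 * g t)); last first.
  by apply/funext => t; rewrite mulN1r.
by rewrite mvalZ// mulN1r.
Qed.

Lemma mval_le f g : mdom M f -> mdom M g -> (forall t, f t <= g t) -> M f <= M g.
Proof.
move=> df dg fg; rewrite -subr_ge0 -mvalB//; apply: mval_ge0; first exact: mdomB.
by move=> t; rewrite subr_ge0.
Qed.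

Definition cdom (f : T -> C) :=
  mdom M (fun t => complex.Re (f t)) /\ mdom M (fun t => complex.Im (f t)).

Definition cmean (f : T -> C) : C :=
  Complex (M (fun t => complex.Re (f t))) (M (fun t => complex.Im (f t))).

Lemma cdom_cst c : cdom (fun=> c).
Proof. by split; exact: mdom_cst. Qed.

Lemma cdomD f g : cdom f -> cdom g -> cdom (fun t => f t + g t).
Proof.
move=> [rf jf] [rg jg]; split.
  by under eq_fun do rewrite ReE_add; exact: mdomD.
by under eq_fun do rewrite ImE_add; exact: mdomD.
Qed.

Lemma cdomM f g : cdom f -> cdom g -> cdom (fun t => f t * g t).
Proof.
move=> [rf jf] [rg jg]; split.
  by under eq_fun do rewrite ReE_mul; apply: mdomB; exact: mdomM.
by under eq_fun do rewrite ImE_mul; apply: mdomD; exact: mdomM.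
Qed.

Lemma cdom_conj f : cdom f -> cdom (fun t => (f t)^*).
Proof.
move=> [rf jf]; split.
  by rewrite (_ : (fun t => _) = (fun t => complex.Re (f t)))//;
    apply/funext => t; case: (f t).
rewrite (_ : (fun t => _) = (fun t => - complex.Im (f t))); first exact: mdomN.
by apply/funext => t; case: (f t).
Qed.

Lemma cdomZ c f : cdom f -> cdom (fun t => c * f t).
Proof. by move=> df; apply: cdomM => //; exact: cdom_cst. Qed.

Lemma cdomB f g : cdom f -> cdom g -> cdom (fun t => f t - g t).
Proof.
move=> df /(cdomZ (-1)) dg; under eq_fun do rewrite -mulN1r.
exact: cdomD.
Qed.

Lemma cdom_sum (I : Type) (r : seq I) (F : I -> T -> C) :
  (forall i, cdom (F i)) -> cdom (fun t => \sum_(i <- r) F i t).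
Proof.
move=> dF; elim: r => [|i r IH].
  by under eq_fun do rewrite big_nil; exact: cdom_cst.
by under eq_fun do rewrite big_cons; exact: cdomD.
Qed.

Lemma mdom_nsq f : cdom f -> mdom M (fun t => nsq (f t)).
Proof. by move=> [rf jf]; apply: mdomD; under eq_fun do rewrite expr2; exact: mdomM. Qed.

Lemma cmean_cst c : cmean (fun=> c) = c.
Proof. by rewrite /cmean !mval_cst; case: c. Qed.

Lemma cmeanD f g : cdom f -> cdom g ->
  cmean (fun t => f t + g t) = cmean f + cmean g.
Proof.
move=> [rf jf] [rg jg]; apply: complex_ext => /=.
  by under eq_fun do rewrite ReE_add; rewrite mvalD.
by under eq_fun do rewrite ImE_add; rewrite mvalD.
Qed.

Lemma cmeanZ c f : cdom f -> cmean (fun t => c * f t) = c * cmean f.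
Proof.
move=> [rf jf]; apply: complex_ext => /=.
  under eq_fun do rewrite ReE_mul; rewrite mvalB ?mvalZ ?ReE_mul//; exact: mdomZ.
under eq_fun do rewrite ImE_mul; rewrite mvalD ?mvalZ ?ImE_mul//; exact: mdomZ.
Qed.

Lemma cmeanB f g : cdom f -> cdom g ->
  cmean (fun t => f t - g t) = cmean f - cmean g.
Proof.
move=> df dg; under eq_fun do rewrite -mulN1r.
by rewrite cmeanD ?cmeanZ ?mulN1r//; exact: cdomZ.
Qed.

Lemma cmean_conj f : cdom f -> cmean (fun t => (f t)^*) = (cmean f)^*.
Proof.
move=> [rf jf]; apply: complex_ext => /=.
  by congr (M _); apply/funext => t; case: (f t).
rewrite (_ : (fun t => _) = (fun t => -1 * complex.Im (f t))).
  by rewrite mvalZ// mulN1r.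
by apply/funext => t; case: (f t) => a b /=; rewrite mulN1r.
Qed.

Lemma cmean_sum (I : Type) (r : seq I) (F : I -> T -> C) :
  (forall i, cdom (F i)) ->
  cmean (fun t => \sum_(i <- r) F i t) = \sum_(i <- r) cmean (F i).
Proof.
move=> dF; elim: r => [|i r IH].
  by under eq_fun do rewrite big_nil; rewrite big_nil cmean_cst.
under eq_fun do rewrite big_cons; rewrite big_cons cmeanD ?IH//.
exact: cdom_sum.
Qed.

Lemma cmean_real f : cmean (fun t => (f t)%:C) = (M f)%:C.
Proof. by apply: complex_ext => //=; rewrite mval_cst. Qed.

Lemma mean_nsqE f : (M (fun t => nsq (f t)))%:C = cmean (fun t => f t * (f t)^*).
Proof. by rewrite -cmean_real; congr cmean; apply/funext => t; rewrite nsqE. Qed.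

Lemma mean_nsq_ge0 f : cdom f -> 0 <= M (fun t => nsq (f t)).
Proof. by move=> df; apply: mval_ge0 => [|t]; [exact: mdom_nsq|exact: nsq_ge0]. Qed.

Lemma mean_nsqD f g : cdom f -> cdom g ->
  M (fun t => nsq (f t + g t)) <=
  2 * M (fun t => nsq (f t)) + 2 * M (fun t => nsq (g t)).
Proof.
move=> df dg; rewrite -!mvalZ -?mvalD; try exact: mdom_nsq.
- apply: mval_le => [||t]; last exact: nsqD_le.
    by apply: mdom_nsq; exact: cdomD.
  by apply: mdomD; apply: mdomZ; exact: mdom_nsq.
- by apply: mdomZ; exact: mdom_nsq.
- by apply: mdomZ; exact: mdom_nsq.
Qed.

Lemma mean_nsqZ c f : cdom f ->
  M (fun t => nsq (c * f t)) = nsq c * M (fun t => nsq (f t)).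
Proof.
move=> df; under eq_fun do rewrite nsqM.
by rewrite mvalZ//; exact: mdom_nsq.
Qed.

Section orthonormal.
Variables (n : nat) (phi : 'I_n -> T -> C).
Hypothesis dphi : forall i, cdom (phi i).
Hypothesis ophi : forall i j, cmean (fun t => phi i t * (phi j t)^*) = (i == j)%:R.

Lemma mean_parseval (c : 'I_n -> C) :
  M (fun t => nsq (\sum_i c i * phi i t)) = \sum_i nsq (c i).
Proof.
apply: complexI; rewrite mean_nsqE rmorph_sum/=.
under eq_fun do rewrite [X in _ * X]rmorph_sum mulr_suml.
rewrite cmean_sum; last first.
  move=> i; apply: cdomM; first exact: cdomZ.
  apply: cdom_sum => j.
  by under eq_fun do rewrite rmorphM/=; apply: cdomZ; exact: cdom_conj.
apply: eq_bigr => i _.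
under eq_fun do rewrite mulr_sumr.
rewrite cmean_sum; last first.
  move=> j; apply: cdomM; first exact: cdomZ.
  by under eq_fun do rewrite rmorphM/=; apply: cdomZ; exact: cdom_conj.
rewrite (bigD1 i)//= big1 => [|j ji]; last first.
  under eq_fun do rewrite rmorphM/= mulrACA.
  rewrite cmeanZ ?ophi ?[i == j]eq_sym ?(negbTE ji) ?mulr0//.
  by apply: cdomM => //; exact: cdom_conj.
under eq_fun do rewrite rmorphM/= mulrACA.
rewrite cmeanZ ?ophi ?eqxx ?mulr1 ?addr0 ?nsqE//.
by apply: cdomM => //; exact: cdom_conj.
Qed.

(** The difference of the two sides is the mean of the squared distance from [f] to
    its orthogonal projection. *)
Lemma mean_bessel f : cdom f ->
  \sum_i nsq (cmean (fun t => f t * (phi i t)^*)) <= M (fun t => nsq (f t)).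
Proof.
move=> df; set c := fun i => cmean (fun t => f t * (phi i t)^*).
have dp : cdom (fun t => \sum_i c i * phi i t).
  by apply: cdom_sum => i; exact: cdomZ.
rewrite -subr_ge0.
have : 0 <= M (fun t => nsq (f t - \sum_i c i * phi i t)).
  by apply: mean_nsq_ge0; exact: cdomB.
suff -> : M (fun t => nsq (f t - \sum_i c i * phi i t)) =
  M (fun t => nsq (f t)) - \sum_i nsq (c i) by [].
have cross : cmean (fun t => f t * (\sum_i c i * phi i t)^*) = (\sum_i nsq (c i))%:C.
  under eq_fun do rewrite rmorph_sum mulr_sumr.
  rewrite cmean_sum; last first.
    move=> i; apply: cdomM => //.
    by apply: cdom_conj; exact: cdomZ.
  rewrite rmorph_sum; apply: eq_bigr => i _ /=.
  under eq_fun do rewrite rmorphM mulrCA.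
  rewrite cmeanZ; last by apply: cdomM => //; exact: cdom_conj.
  by rewrite nsqE mulrC.
have cross' : cmean (fun t => (\sum_i c i * phi i t) * (f t)^*) =
    (\sum_i nsq (c i))%:C.
  rewrite -[RHS]conjc_real -cross -cmean_conj; last first.
    by apply: cdomM => //; exact: cdom_conj.
  by congr cmean; apply/funext => t; rewrite rmorphM/= conjcK mulrC.
apply: complexI; rewrite mean_nsqE rmorphB/=.
have -> : (fun t => (f t - \sum_i c i * phi i t) * (f t - \sum_i c i * phi i t)^*) =
  (fun t => (f t * (f t)^* - f t * (\sum_i c i * phi i t)^*) -
    ((\sum_i c i * phi i t) * (f t)^* -
    (\sum_i c i * phi i t) * (\sum_i c i * phi i t)^*)).
  by apply/funext => t; rewrite rmorphB/=; ring.
rewrite cmeanB ?cmeanB; try (by do ?[apply: cdomB]; do ?[apply: cdomM]; do ?[apply: cdom_conj]).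
by rewrite -!mean_nsqE mean_parseval cross cross' subrr subr0.
Qed.

End orthonormal.

(** Bessel's inequality for the constant function 1. *)
Lemma cmean_nsq_le f : cdom f -> nsq (cmean f) <= M (fun t => nsq (f t)).
Proof.
move=> df; have := @mean_bessel 1 (fun _ _ => 1) (fun=> cdom_cst 1) _ f df.
rewrite big_ord_recl big_ord0 addr0.
rewrite (_ : (fun t => f t * _) = f); last first.
  by apply/funext => t; rewrite [X in _ * X]conjc1 mulr1.
apply => i j; rewrite !ord1 -[RHS](cmean_cst 1).
by congr cmean; apply/funext => t; rewrite [X in _ * X]conjc1 mulr1.
Qed.

End mean_theory.

(** * Limits of averages along an ultrafilter *)

Lemma fmap_ultra (S T : Type) (U : set_system S) (UU : UltraFilter U) (a : S -> T) :
  UltraFilter (a @ U).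
Proof.
split=> [|G GG aG]; first exact: fmap_proper_filter.
rewrite eqEsubset; split=> A; last exact: aG.
move=> GA; have [//|UcA] := in_ultra_setVsetC (a @^-1` A) UU.
have : G (A `&` ~` A) by apply: filterI => //; exact: aG.
by rewrite setICr => /filter_not_empty.
Qed.

Section ultralimit.
Context {R : realType}.
Variable U : set_system nat.
Hypothesis UU : UltraFilter U.

Definition ulim (a : nat -> R) : R := lim (a @ U).

(** Compactness of a segment: along an ultrafilter all bounded sequences converge
    simultaneously, without extraction of subsequences. *)
Lemma ulim_cvg (a : nat -> R) : (exists B, forall n, `|a n| <= B) ->
  a n @[n --> U] --> ulim a.
Proof.
move=> [B aB].
have /= := @segment_compact R (- B) B; rewrite compact_ultra.
move=> /(_ (a @ U) (fmap_ultra UU a)) [|l [_ al]]; last by apply/cvg_ex; exists l.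
by apply: nearW => n; rewrite /= in_itv/= -ler_norml.
Qed.

Hypothesis Uoo : \oo `<=` U.

Lemma ulim_eq (a : nat -> R) l : a n @[n --> \oo] --> l -> ulim a = l.
Proof.
move=> al; apply: cvg_lim => //.
by move=> A /al; exact: Uoo.
Qed.

End ultralimit.

Section average.
Context {R : realType} {T : Type}.
Implicit Types (s : seq T) (f g : T -> R).

Definition bounded_real f := exists B, forall t, `|f t| <= B.

Definition average s f : R := (size s)%:R^-1 * \sum_(t <- s) f t.

Lemma average_cst s c : (0 < size s)%N -> average s (fun=> c) = c.
Proof.
move=> s0; rewrite /average big_const_seq count_predT iter_addr_0 -(mulr_natl c).
by rewrite mulKf// pnatr_eq0 -lt0n.
Qed.

Lemma averageD s f g :
  average s (fun t => f t + g t) = average s f + average s g.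
Proof. by rewrite /average big_split mulrDr. Qed.

Lemma averageZ s c f : average s (fun t => c * f t) = c * average s f.
Proof. by rewrite /average -mulr_sumr mulrCA. Qed.

Lemma average_ge0 s f : (forall t, 0 <= f t) -> 0 <= average s f.
Proof. by move=> f0; rewrite mulr_ge0 ?invr_ge0// sumr_ge0. Qed.

Lemma average_bounded s f B : (0 < size s)%N -> (forall t, `|f t| <= B) ->
  `|average s f| <= B.
Proof.
move=> s0 fB; rewrite /average normrM.
rewrite ger0_norm ?invr_ge0// mulrC ler_pdivrMr ?ltr0n//.
apply: le_trans (ler_norm_sum _ _ _) _.
apply: le_trans (ler_sum _ (fun t _ => fB t)) _.
by rewrite big_const_seq count_predT iter_addr_0 mulr_natr.
Qed.

Lemma bounded_realD f g : bounded_real f -> bounded_real g ->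
  bounded_real (fun t => f t + g t).
Proof.
move=> [B fB] [D gD]; exists (B + D) => t.
by rewrite (le_trans (ler_normD _ _))// lerD.
Qed.

Lemma bounded_realM f g : bounded_real f -> bounded_real g ->
  bounded_real (fun t => f t * g t).
Proof.
by move=> [B fB] [D gD]; exists (B * D) => t; rewrite normrM ler_pM.
Qed.

End average.

Section ultramean.
Context {R : realType} {T : Type}.
Variables (U : set_system nat) (UU : UltraFilter U).
Variables (A : nat -> seq T) (A0 : forall q, (0 < size (A q))%N).
Implicit Types f g : T -> R.

Definition ultramean_val f := ulim U (fun q => average (A q) f).

Lemma ultramean_cvg f : bounded_real f ->
  average (A q) f @[q --> U] --> ultramean_val f.
Proof.
move=> [B fB]; apply: ulim_cvg => //.
by exists B => q; exact: average_bounded.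
Qed.

Let val_cst c : ultramean_val (fun=> c) = c.
Proof.
rewrite /ultramean_val; under eq_fun do rewrite average_cst//.
exact: (@lim_cst _ _ _ U).
Qed.

Let valD f g : bounded_real f -> bounded_real g ->
  ultramean_val (fun t => f t + g t) = ultramean_val f + ultramean_val g.
Proof.
move=> bf bg; apply: cvg_lim => //.
under eq_fun do rewrite averageD.
by apply: cvgD; exact: ultramean_cvg.
Qed.

Let valZ c f : bounded_real f ->
  ultramean_val (fun t => c * f t) = c * ultramean_val f.
Proof.
move=> bf; apply: cvg_lim => //.
under eq_fun do rewrite averageZ.
by apply: cvgMr => //; exact: ultramean_cvg.
Qed.

Let val_ge0 f : bounded_real f -> (forall t, 0 <= f t) -> 0 <= ultramean_val f.
Proof.
move=> bf f0; apply: limr_ge.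
  by apply/cvg_ex; exists (ultramean_val f); exact: ultramean_cvg.
by apply: nearW => q; exact: average_ge0.
Qed.

(** Both the averages along a sequence and the averages over finer and finer grids
    of the cube give means of this form. *)
Definition ultramean : mean R T :=
  Mean (fun c => ex_intro (fun B => forall t : T, `|c| <= B) `|c| (fun=> lexx _))
    (@bounded_realD _ T) (@bounded_realM _ T)
    val_cst valD valZ val_ge0.

End ultramean.

Section mean_constructions.
Context {R : realType} {T : Type}.

Definition pullback_mean (S : Type) (phi : S -> T) (M : mean R S) : mean R T :=
  @Mean R T (fun f => mdom M (f \o phi)) (fun f => M (f \o phi))
    (fun c => mdom_cst M c)
    (fun f g => @mdomD _ _ M (f \o phi) (g \o phi))
    (fun f g => @mdomM _ _ M (f \o phi) (g \o phi))
    (fun c => mval_cst M c)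
    (fun f g => @mvalD _ _ M (f \o phi) (g \o phi))
    (fun c f => @mvalZ _ _ M c (f \o phi))
    (fun f df f0 => @mval_ge0 _ _ M (f \o phi) df (fun t => f0 (phi t))).

Variables M1 M2 : mean R T.

Let hdom (f : T -> R) := mdom M1 f /\ mdom M2 f.
Let hval (f : T -> R) := (M1 f + M2 f) / 2.

Let hdom_cst c : hdom (fun=> c). Proof. by split; exact: mdom_cst. Qed.
Let hdomD f g : hdom f -> hdom g -> hdom (fun t => f t + g t).
Proof. by move=> [? ?] [? ?]; split; exact: mdomD. Qed.
Let hdomM f g : hdom f -> hdom g -> hdom (fun t => f t * g t).
Proof. by move=> [? ?] [? ?]; split; exact: mdomM. Qed.
Let hval_cst c : hval (fun=> c) = c.
Proof. by rewrite /hval !mval_cst; field. Qed.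
Let hvalD f g : hdom f -> hdom g ->
  hval (fun t => f t + g t) = hval f + hval g.
Proof. by move=> [? ?] [? ?]; rewrite /hval !mvalD//; field. Qed.
Let hvalZ c f : hdom f -> hval (fun t => c * f t) = c * hval f.
Proof. by move=> [? ?]; rewrite /hval !mvalZ//; field. Qed.
Let hval_ge0 f : hdom f -> (forall t, 0 <= f t) -> 0 <= hval f.
Proof. by move=> [? ?] f0; rewrite /hval divr_ge0// addr_ge0// mval_ge0. Qed.

(** A function small in the quadratic mean of the half-sum is small for both means;
    this gives one approximant for two means. *)
Definition half_mean : mean R T :=
  Mean hdom_cst hdomD hdomM hval_cst hvalD hvalZ hval_ge0.

End mean_constructions.

Section bounded_complex.
Context {R : realType} {T : Type}.
Local Notation C := R[i].
Implicit Types f g : T -> C.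

(** Squared moduli keep the bound in [R]. *)
Definition bounded_complex f := exists B : R, forall t, nsq (f t) <= B.

Lemma bounded_complex_cst c : bounded_complex (fun=> c).
Proof. by exists (nsq c). Qed.

Lemma bounded_complexD f g : bounded_complex f -> bounded_complex g ->
  bounded_complex (fun t => f t + g t).
Proof.
move=> [B fB] [D gD]; exists (2 * B + 2 * D) => t.
by rewrite (le_trans (nsqD_le _ _))// lerD// ler_wpM2l.
Qed.

Lemma bounded_complexM f g : bounded_complex f -> bounded_complex g ->
  bounded_complex (fun t => f t * g t).
Proof.
by move=> [B fB] [D gD]; exists (B * D) => t; rewrite nsqM ler_pM ?nsq_ge0.
Qed.

Lemma bounded_complexB f g : bounded_complex f -> bounded_complex g ->
  bounded_complex (fun t => f t - g t).
Proof.
move=> bf [D gD]; apply: bounded_complexD => //.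
by exists D => t; rewrite nsqN.
Qed.

Lemma bounded_complex_conj f : bounded_complex f ->
  bounded_complex (fun t => (f t)^*).
Proof. by move=> [B fB]; exists B => t; rewrite nsq_conj. Qed.

Lemma bounded_complex_sum (I : Type) (r : seq I) (F : I -> T -> C) :
  (forall i, bounded_complex (F i)) ->
  bounded_complex (fun t => \sum_(i <- r) F i t).
Proof.
move=> bF; elim: r => [|i r IH].
  by under eq_fun do rewrite big_nil; exact: bounded_complex_cst.
by under eq_fun do rewrite big_cons; exact: bounded_complexD.
Qed.

Lemma bounded_nsq f : bounded_complex f -> bounded_real (fun t => nsq (f t)).
Proof. by move=> [B fB]; exists B => t; rewrite ger0_norm ?nsq_ge0. Qed.

Lemma bounded_complex_parts f : bounded_complex f ->
  bounded_real (fun t => complex.Re (f t)) /\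
  bounded_real (fun t => complex.Im (f t)).
Proof.
move=> [B fB].
have le (x y : R) : x ^+ 2 <= y -> `|x| <= 1 + y.
  move=> xy; have := sqr_ge0 (x + 2^-1); have := sqr_ge0 (x - 2^-1).
  by rewrite ler_norml => *; apply/andP; split; nra.
split; exists (1 + B) => t; apply: le; rewrite (le_trans _ (fB t))//.
  by rewrite lerDl sqr_ge0.
by rewrite lerDr sqr_ge0.
Qed.

Lemma bounded_complex_cdom (M : mean R T) f :
  (forall h : T -> R, bounded_real h -> mdom M h) -> bounded_complex f -> cdom M f.
Proof. by move=> bM /bounded_complex_parts[? ?]; split; exact: bM. Qed.

End bounded_complex.

Lemma bounded_complex_comp (R : realType) (S T : Type) (f : T -> R[i]) (g : S -> T) :
  bounded_complex f -> bounded_complex (f \o g).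
Proof. by move=> [B fB]; exists B => t /=. Qed.

(** * Volumes of boxes and discrepancy *)

Section boxes.
Context {R : realType}.

Lemma rV_cons_ord0 d t (v : 'rV[R]_d) : rV_cons (t, v) ord0 ord0 = t.
Proof.
rewrite /rV_cons (_ : ord0 = lshift d ord0 :> 'I_(1 + d)); last exact: val_inj.
by rewrite (row_mxEl (const_mx t : 'rV[R]_1)) mxE.
Qed.

Lemma rV_cons_lift d t (v : 'rV[R]_d) j :
  rV_cons (t, v) ord0 (lift ord0 j) = v ord0 j.
Proof.
rewrite /rV_cons (_ : lift ord0 j = rshift 1 j :> 'I_(1 + d)); last exact: val_inj.
by rewrite (row_mxEr (const_mx t : 'rV[R]_1)).
Qed.

Lemma rV_cons_box d (I : 'I_d.+1 -> interval R) :
  @rV_cons R d @^-1` box I =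
  [set` I ord0] `*` box (fun i => I (lift ord0 i)).
Proof.
apply/seteqP; split=> [[t v] H|[t v] [/= It Iv] i].
  split=> [|i] /=; first by have := H ord0; rewrite rV_cons_ord0.
  by have := H (lift ord0 i); rewrite rV_cons_lift.
case: (unliftP ord0 i) => [j ->|->]; first by rewrite rV_cons_lift; exact: Iv.
by rewrite rV_cons_ord0.
Qed.

Lemma measurable_box d (I : 'I_d -> interval R) : measurable (box I).
Proof.
rewrite (_ : box I = \bigcap_(i in [set: 'I_d]) [set v : 'rV[R]_d | v ord0 i \in I i]); last first.
  by apply/seteqP; split=> v vI i => [_|]; [exact: vI|exact: (vI i)].
apply: fin_bigcap_measurable => // i _.
have /measurable_rVP/(_ i) := @measurable_id _ 'rV[R]_d setT.
move=> /(_ measurableT [set` I i]); rewrite setTI; apply.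
exact: measurable_itv.
Qed.

(** Induction on the dimension: a box in dimension [d.+1] is a product of an
    interval and of a box in dimension [d]. *)
Lemma lebesgue_rV_box d (I : 'I_d -> interval R) (r : 'I_d -> R) :
  (forall i, @lebesgue_measure R [set` I i] = (r i)%:E) ->
  lebesgue_rV R d (box I) = (\prod_i r i)%:E.
Proof.
elim: d I r => [|d IH] I r Ir.
  by rewrite big_ord0 /= diracE mem_set// => -[].
rewrite big_ord_recl /= /lebesgue_cons /pushforward rV_cons_box.
rewrite product_measure1E//; last exact: measurable_box.
rewrite EFinM; congr mule; first exact: Ir.
exact: IH.
Qed.

Lemma unit_box_volume d (B : set 'rV[R]_d) : unit_boxes B ->
  0 <= fine (lebesgue_rV R d B) <= 1.
Proof.
move=> [[I ->] sub]; rewrite fine_ge0 ?measure_ge0//=.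
have cube1 : lebesgue_rV R d unit_cube = 1%E.
  rewrite (@lebesgue_rV_box _ _ (fun=> 1)) ?big1// => i.
  by rewrite lebesgue_measure_itv/= lte_fin ltr01 oppr0 adde0.
have le1 : (lebesgue_rV R d (box I) <= 1)%E.
  by rewrite -cube1; apply: le_measure => //; rewrite inE; exact: measurable_box.
by rewrite -lee_fin fineK// ge0_fin_numE ?measure_ge0// (le_lt_trans le1) ?ltry.
Qed.

Section discrepancy_bounds.
Variables (d : nat) (z : nat -> 'rV[R]_d) (N : nat).

Let dev (B : set 'rV[R]_d) :=
  `| N%:R^-1 * #|[pred n : 'I_N | z n \in B]|%:R - fine (lebesgue_rV R d B) |.

Let dev_le1 B : unit_boxes B -> dev B <= 1.
Proof.
move=> /unit_box_volume /andP[v0 v1].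
have : 0 <= N%:R^-1 * #|[pred n : 'I_N | z n \in B]|%:R :> R by rewrite mulr_ge0 ?invr_ge0.
have : N%:R^-1 * #|[pred n : 'I_N | z n \in B]|%:R <= 1 :> R.
  have [->|N0] := posnP N; first by rewrite invr0 mul0r ler01.
  rewrite mulrC ler_pdivrMr ?ltr0n// mul1r ler_nat.
  by rewrite (leq_trans (max_card _)) ?card_ord.
by rewrite /dev ler_norml => *; apply/andP; split; lra.
Qed.

Lemma le_discrepancy B : unit_boxes B ->
  `| N%:R^-1 * #|[pred n : 'I_N | z n \in B]|%:R - fine (lebesgue_rV R d B) | <=
  discrepancy z N.
Proof.
move=> uB; apply: ub_le_sup; last by exists B.
by exists 1 => _ [D uD <-]; exact: dev_le1.
Qed.

Let unit_cubeP : unit_boxes (@unit_cube R d).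
Proof. by split=> //; exists (fun=> `[0, 1]). Qed.

Lemma discrepancy_le1 : discrepancy z N <= 1.
Proof.
apply: ge_sup => [|_ [D uD <-]]; last exact: dev_le1.
by exists (dev unit_cube), unit_cube.
Qed.

Lemma discrepancy_ge0 : 0 <= discrepancy z N.
Proof. by apply: le_trans (le_discrepancy unit_cubeP); exact: normr_ge0. Qed.

End discrepancy_bounds.

End boxes.

(** * Exponential sums and discrepancy *)

Section exponential_estimates.
Context {R : realType}.
Local Notation C := R[i].

Lemma sin_sqr_le (x : R) : sin x ^+ 2 <= x ^+ 2.
Proof.
wlog x0 : x / 0 <= x => [H|].
  have [|x0] := leP 0 x; first exact: H.
  by rewrite -(sqrrN x) -(sqrrN (sin x)) -sinN H// oppr_ge0 ltW.
have [c _] := @MVT_segment R sin cos 0 x x0 (fun y _ => is_derive_sin y)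
  (continuous_subspaceT (@continuous_sin R)).
rewrite sin0 !subr0 => ->; rewrite exprMn ler_piMl ?sqr_ge0//.
Qed.

(** The chord subtended by the angle 2 pi s has length 2 |sin(pi s)|. *)
Lemma nsq_cexp2pi_sub1 (s : R) : nsq (cexp2pi s - 1) = 4 * sin (pi * s) ^+ 2.
Proof.
have -> : cexp2pi s = Complex (cos (pi * s *+ 2)) (sin (pi * s *+ 2)).
  by rewrite -mulr_natl mulrA.
rewrite /nsq/= sin_mulr2n cos_mulr2n oppr0 addr0 !mulr2n.
have := cos2Dsin2 (pi * s); set c := cos _; set t := sin _ => h.
have -> : (c ^+ 2 + c ^+ 2 - 1 - 1) ^+ 2 + (c * t + c * t) ^+ 2 =
  4 * ((1 - c ^+ 2) ^+ 2 + c ^+ 2 * t ^+ 2) by ring.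
have -> : t ^+ 2 = 1 - c ^+ 2 by lra.
by ring.
Qed.

Lemma cexp2pi_neq1 (s : R) : 0 < `|s| < 1 -> cexp2pi s != 1.
Proof.
move=> /andP[s0 s1]; apply/eqP => es.
have := nsq_cexp2pi_sub1 s; rewrite es subrr nsq0.
suff : 0 < sin (pi * `|s|) ^+ 2.
  rewrite (_ : sin (pi * `|s|) ^+ 2 = sin (pi * s) ^+ 2); first lra.
  by case: (ger0P s) => // _; rewrite mulrN sinN sqrrN.
rewrite exprn_gt0// sin_gt0_pi// mulr_gt0 ?pi_gt0//=.
by rewrite gtr_pMr// pi_gt0.
Qed.

(** A geometric sum: e(k/M) is a root of unity of order dividing M, and differs
    from 1 because 0 < |k| < M. *)
Lemma sum_cexp2pi_grid (k : int) (M : nat) : k != 0 -> (`|k| < M)%N ->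
  \sum_(j < M) cexp2pi (k%:~R * (j%:R / M%:R)) = 0 :> C.
Proof.
move=> k0 kM; have M0 : (0 < M)%N by rewrite (leq_ltn_trans _ kM).
have M0' : M%:R != 0 :> R by rewrite pnatr_eq0 -lt0n.
set w : C := cexp2pi (k%:~R / M%:R).
have w1 : w != 1.
  rewrite cexp2pi_neq1// normf_div normr_nat divr_gt0 ?normr_gt0 ?intr_eq0 ?ltr0n//=.
  by rewrite ltr_pdivrMr ?ltr0n// mul1r -intr_norm -abszE -pmulrn ltr_nat.
apply: (mulfI (_ : w - 1 != 0)); first by rewrite subr_eq0.
rewrite mulr0 (eq_bigr (fun j : 'I_M => w ^+ j)) => [|j _]; last first.
  by rewrite -cexp2piMn; congr cexp2pi; ring.
rewrite -subrX1 -cexp2piMn mulrC divfK// cexp2pi_int subrr.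
by [].
Qed.

Local Notation nc := (@ComplexField.Normc.normc R).

Lemma nc_nsq z : nc z = Num.sqrt (nsq z).
Proof. by case: z. Qed.

Lemma sqr_nc z : nc z ^+ 2 = nsq z.
Proof. by rewrite nc_nsq sqr_sqrtr// nsq_ge0. Qed.

Lemma nc_cexp2piB (s t : R) : nc (cexp2pi s - cexp2pi t) <= 2 * pi * `|s - t|.
Proof.
have -> : cexp2pi s - cexp2pi t = cexp2pi t * (cexp2pi (s - t) - 1).
  by rewrite mulrBr mulr1 -cexp2piD (addrC t) subrK.
rewrite nc_nsq nsqM nsq_cexp2pi mul1r nsq_cexp2pi_sub1.
have -> : 2 * pi * `|s - t| = Num.sqrt (4 * (pi * (s - t)) ^+ 2).
  rewrite (_ : 4 * _ = (2 * pi * (s - t)) ^+ 2); last by ring.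
  by rewrite sqrtr_sqr !normrM normr_nat (ger0_norm (pi_ge0 R)).
by apply: ler_wsqrtr; apply: ler_wpM2l => //; exact: sin_sqr_le.
Qed.

Lemma nc_sum (I : Type) (r : seq I) (F : I -> C) :
  nc (\sum_(i <- r) F i) <= \sum_(i <- r) nc (F i).
Proof.
elim: r => [|i r IH]; first by rewrite !big_nil ComplexField.Normc.normc0.
by rewrite !big_cons (le_trans (le_normcD _ _))// lerD2l.
Qed.
End exponential_estimates.

Section summation_by_parts.
Context {R : comNzRingType}.
Variables (e : nat -> R) (M : nat).

(** Coefficient of the indicator of {0, ..., j} in the expansion of the restriction
    of [e] to {0, ..., M-1}. The differences e j - e (j+1) alone would telescope to
    e j - e M; the term e M, carried by the last indicator, which is constant,
    corrects this. *)
Definition abel_coef j : R := e j - e j.+1 + (j.+1 == M)%:R * e M.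

Lemma sum_abel_coef j0 : (j0 < M)%N ->
  \sum_(j < M) abel_coef j * (j0 <= j)%:R = e j0.
Proof.
move=> j0M; rewrite /abel_coef.
under eq_bigr do rewrite mulrDl.
rewrite big_split/=.
have -> : \sum_(j < M) (j.+1 == M)%:R * e M * (j0 <= j)%:R = e M.
  case: M j0M => // m j0m; rewrite big_ord_recr/= big1 => [|j _].
    by rewrite eqxx mul1r add0r -ltnS j0m mulr1.
  by rewrite eqSS ltn_eqF// !mul0r.
suff -> : \sum_(j < M) (e j - e j.+1) * (j0 <= j)%:R = e j0 - e M by rewrite subrK.
elim: M j0M => // m IH; rewrite ltnS leq_eqVlt big_ord_recr/= => /predU1P[->|jm].
  rewrite big1 ?add0r ?leqnn ?mulr1// => j _.
  by rewrite leqNgt ltn_ord mulr0.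
by rewrite IH// (ltnW jm) mulr1; ring.
Qed.

(** The expansion of sum_abel_coef, summed over its argument. *)
Lemma sum_abel_coef_succ :
  \sum_(j < M) abel_coef j * j.+1%:R = \sum_(j < M) e j.
Proof.
transitivity (\sum_(j < M) \sum_(j0 < M) abel_coef j * (j0 <= j)%:R).
  apply: eq_bigr => j _; rewrite -mulr_sumr; congr (_ * _).
  rewrite -natr_sum; congr (_%:R).
  rewrite -(big_mkord xpredT (fun j0 => (j0 <= j)%N : nat)).
  rewrite (big_cat_nat _ (n := j.+1))//= big_nat (eq_bigr (fun=> 1%N)) => [|a]; last first.
    by rewrite ltnS => /= ->.
  rewrite -big_nat sum_nat_const_nat subn0 muln1 big_nat big1 ?addn0// => a /andP[ja _].
  by rewrite leqNgt ja.
rewrite exchange_big/=; apply: eq_bigr => j0 _.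
by rewrite sum_abel_coef.
Qed.

End summation_by_parts.

Section characters.
Context {R : realType} {d : nat}.
Local Notation C := R[i].
Local Notation nc := (@ComplexField.Normc.normc R).
Implicit Types (k : {ffun 'I_d -> int}) (v y : 'rV[R]_d).

Definition chi k v : C := cexp2pi (\sum_i (k i)%:~R * v ord0 i).

Lemma chi0 v : chi 0 v = 1.
Proof. by rewrite /chi big1 ?cexp2pi0// => i _; rewrite ffunE mul0r. Qed.

Lemma chiD k l v : chi (k + l) v = chi k v * chi l v.
Proof.
rewrite /chi -cexp2piD -big_split/=; congr cexp2pi; apply: eq_bigr => i _.
by rewrite ffunE intrD mulrDl.
Qed.

Lemma chiN k v : chi (- k) v = (chi k v)^*.
Proof.
rewrite /chi -cexp2piN -sumrN; congr cexp2pi; apply: eq_bigr => i _.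
by rewrite ffunE mulrNz mulNr.
Qed.

Lemma nsq_chi k v : nsq (chi k v) = 1.
Proof. exact: nsq_cexp2pi. Qed.

(** A character does not see the integer parts. *)
Lemma chi_sub_mod1 k u v : chi k (sub_mod1 u v) = chi k u * (chi k v)^*.
Proof.
rewrite /chi -cexp2piN -cexp2piD.
pose m : int := \sum_i k i * Num.floor ((u - v) ord0 i).
rewrite -[RHS]mulr1 -[X in _ * X](cexp2pi_int (- m)) -cexp2piD; congr cexp2pi.
rewrite mulrNz /m (big_morph _ (@intrD R) (erefl _)) -!sumrN -!big_split/=.
by apply: eq_bigr => i _; rewrite /sub_mod1 !mxE intrM; ring.
Qed.

Section koksma.
Variables (k : {ffun 'I_d -> int}) (M : nat).
Hypotheses (k0 : k != 0) (kM : forall i, (`|k i| < M)%N) (M0 : (0 < M)%N).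

Let g i j : C := cexp2pi ((k i)%:~R * (j%:R / M%:R)).
Let c i := abel_coef (g i) M.
Let C_ : R := \prod_i (1 + 2 * pi * `|(k i)%:~R|).
Let MR0 : M%:R != 0 :> R. Proof. by rewrite pnatr_eq0 -lt0n. Qed.

Let corner (J : {ffun 'I_d -> 'I_M}) : set 'rV[R]_d :=
  box (fun i => `[0, (J i).+1%:R / M%:R[).

Let corner_unit J : unit_boxes (corner J).
Proof.
split; first by exists (fun i => `[0, (J i).+1%:R / M%:R[).
move=> v Jv i; have := Jv i; rewrite !in_itv/= => /andP[-> /ltW /le_trans]; apply.
by rewrite ler_pdivrMr ?ltr0n// mul1r ler_nat.
Qed.

Let corner_vol J :
  fine (lebesgue_rV R d (corner J)) = \prod_i ((J i).+1%:R / M%:R).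
Proof.
rewrite (@lebesgue_rV_box _ _ _ (fun i => (J i).+1%:R / M%:R))// => i.
by rewrite lebesgue_measure_itv/= lte_fin divr_gt0 ?ltr0n// oppr0 adde0.
Qed.

(** The combination of indicators of corners that approximates the character has
    integral equal to the average of the character over the grid, that is 0. *)
Let sum_coef_vol :
  \sum_(J : {ffun 'I_d -> 'I_M}) (\prod_i c i (J i)) *
    (fine (lebesgue_rV R d (corner J)))%:C = 0.
Proof.
under eq_bigr do rewrite corner_vol rmorph_prod -big_split/=.
rewrite -(bigA_distr_bigA (fun i (j : 'I_M) => c i j * (j.+1%:R / M%:R)%:C)).
have [i ki0] : exists i, k i != 0.
  apply/existsP; rewrite -negb_forall; apply: contra k0 => /forallP H.
  by apply/eqP/ffunP => i; rewrite ffunE; apply/eqP.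
rewrite (bigD1 i)//= (_ : \sum_(j < M) _ = 0) ?mul0r//.
rewrite (eq_bigr (fun j : 'I_M => M%:R^-1 * (c i j * j.+1%:R))) => [|j _]; last first.
  by rewrite rmorphM/= fmorphV !rmorph_nat mulrA mulrC.
by rewrite -mulr_sumr sum_abel_coef_succ sum_cexp2pi_grid ?mulr0.
Qed.

(** In each coordinate there are M increments of length at most 2 pi |k i| / M, and
    one closing term of modulus 1: the bound does not depend on M. *)
Let sum_coef_le : \sum_(J : {ffun 'I_d -> 'I_M}) nc (\prod_i c i (J i)) <= C_.
Proof.
under eq_bigr do rewrite (big_morph _ (@ComplexField.Normc.normcM R) (ComplexField.Normc.normc1 R)).
rewrite -(bigA_distr_bigA (fun i (j : 'I_M) => nc (c i j))).
apply: ler_prod => i _; rewrite sumr_ge0 => [|j _]; last by rewrite nc_nsq sqrtr_ge0.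
rewrite /= /c /abel_coef.
apply: (@le_trans _ _ (\sum_(j < M) (2 * pi * `|(k i)%:~R| / M%:R + (j.+1 == M)%:R))).
  apply: ler_sum => j _; rewrite (le_trans (le_normcD _ _))// lerD//.
    rewrite (le_trans (nc_cexp2piB _ _))// -mulrBr normrM -!mulrA ler_wpM2l//.
    rewrite ler_wpM2l ?pi_ge0// ler_wpM2l// distrC -mulrBl -natrB// subSnn.
    by rewrite mul1r normfV normr_nat.
  rewrite nc_nsq nsqM nsq_cexp2pi mulr1.
  by case: (_ == _); rewrite /= ?nsq0 ?sqrtr0//; rewrite -[1]/(1%:C) nsq_real expr1n sqrtr1.
rewrite big_split/= sumr_const card_ord -(mulr_natr (_ / _)) divfK// addrC lerD2r.
case: M M0 => // m _; rewrite big_ord_recr/= big1 ?eqxx ?add0r// => j _.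
by rewrite eqSS ltn_eqF.
Qed.

Section point.
Variable y : 'rV[R]_d.
Hypothesis y01 : forall i, 0 <= y ord0 i < 1.

Let cell i := Num.truncn (M%:R * y ord0 i).

Let cell_lt i : (cell i < M)%N.
Proof.
have /andP[y0 y1] := y01 i.
by rewrite truncn_lt_nat ?mulr_ge0// gtr_pMr ?ltr0n.
Qed.

(** By sum_abel_coef in each coordinate, the combination of indicators takes at [y]
    the value of the character at the grid point below [y]. *)
Lemma chi_grid_approx :
  nc (chi k y - \sum_(J : {ffun 'I_d -> 'I_M}) (\prod_i c i (J i)) * (y \in corner J)%:R) <=
  2 * pi * (\sum_i `|(k i)%:~R|) / M%:R.
Proof.
have -> : \sum_(J : {ffun 'I_d -> 'I_M}) (\prod_i c i (J i)) * (y \in corner J)%:R =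
    cexp2pi (\sum_i (k i)%:~R * ((cell i)%:R / M%:R)).
  rewrite (big_morph _ (@cexp2piD R) (@cexp2pi0 R)).
  under [RHS]eq_bigr => i _ do rewrite -/(g i (cell i)) -(@sum_abel_coef _ (g i) M)//.
  rewrite bigA_distr_bigA/=; apply: eq_bigr => J _; rewrite big_split/=; congr (_ * _).
  have [yJ|yJ] := boolP (y \in corner J).
    rewrite big1// => i _; move: yJ; rewrite inE => /(_ i).
    rewrite in_itv/= => /andP[_ yJ]; rewrite truncn_le_nat.
    by rewrite mulrC -ltr_pdivlMr ?ltr0n// yJ.
  have [i iJ] : exists i, ~~ (cell i <= J i)%N.
    apply/existsP; rewrite -negb_forall; apply: contra yJ => /forallP H.
    rewrite inE => i; rewrite in_itv/=; have /andP[-> _] := y01 i.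
    by have := H i; rewrite truncn_le_nat /= mulrC -ltr_pdivlMr ?ltr0n.
  by rewrite (bigD1 i)//= (negbTE iJ) mul0r.
rewrite (le_trans (nc_cexp2piB _ _))// -[X in _ <= X]mulrA ler_wpM2l ?mulr_ge0 ?pi_ge0//.
rewrite -sumrB mulr_suml (le_trans (ler_norm_sum _ _ _))// ler_sum// => i _.
rewrite -mulrBr normrM ler_wpM2l//.
have /andP[y0 y1] := y01 i.
have /andP[a b] := truncn_itv (mulr_ge0 (ler0n R M) y0).
rewrite -[X in _ <= X]mulr1 ler_pdivlMl ?ltr0n//.
have -> : M%:R * `|y ord0 i - (cell i)%:R / M%:R| = `|M%:R * y ord0 i - (cell i)%:R|.
  by rewrite -[X in X * _]normr_nat -normrM; congr (`|_|); field.
rewrite ger0_norm ?subr_ge0// lerBlDl natr1; exact: ltW.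
Qed.
End point.

(** The average of the combination of indicators differs from its integral 0 by at
    most the discrepancy times the sum of the moduli of the coefficients. *)
Lemma exp_average_grid (y : nat -> 'rV[R]_d) N : (0 < N)%N ->
  (forall n i, 0 <= y n ord0 i < 1) ->
  nc ((N%:R^-1)%:C * \sum_(n < N) chi k (y n)) <=
  C_ * discrepancy y N + 2 * pi * (\sum_i `|(k i)%:~R|) / M%:R.
Proof.
move=> N0 y01.
pose G v : C := \sum_(J : {ffun 'I_d -> 'I_M}) (\prod_i c i (J i)) * (v \in corner J)%:R.
have -> : (N%:R^-1)%:C * \sum_(n < N) chi k (y n) =
  (N%:R^-1)%:C * \sum_(n < N) G (y n) +
  (N%:R^-1)%:C * \sum_(n < N) (chi k (y n) - G (y n)).
  by rewrite -mulrDr -big_split/=; congr (_ * _); apply: eq_bigr => n _; rewrite addrC subrK.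
rewrite (le_trans (le_normcD _ _))// lerD//; last first.
  rewrite ComplexField.Normc.normcM nc_nsq nsq_real sqrtr_sqr normfV normr_nat.
  rewrite ler_pdivrMl ?ltr0n// (le_trans (nc_sum _ _))//.
  apply: (le_trans (ler_sum _ (fun (n : ('I_N)) _ => chi_grid_approx (y01 n)))).
  by rewrite sumr_const card_ord (mulr_natl _ N).
have -> : (N%:R^-1)%:C * \sum_(n < N) G (y n) =
  \sum_(J : {ffun 'I_d -> 'I_M}) (\prod_i c i (J i)) *
    (N%:R^-1 * #|[pred n : 'I_N | y n \in corner J]|%:R
              - fine (lebesgue_rV R d (corner J)))%:C.
  under [RHS]eq_bigr do rewrite rmorphB mulrBr.
  rewrite sumrB sum_coef_vol subr0 /G exchange_big/= mulr_sumr.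
  apply: eq_bigr => J _; rewrite -mulr_sumr mulrCA rmorphM/=; congr (_ * (_ * _)).
  rewrite rmorph_nat -natr_sum -sum1_card; congr (_%:R).
  by rewrite [RHS]big_mkcond; apply: eq_bigr => n _; rewrite inE; case: (_ \in _).
rewrite (le_trans (nc_sum _ _))//.
apply: (@le_trans _ _ (\sum_(J : {ffun 'I_d -> 'I_M}) nc (\prod_i c i (J i)) * discrepancy y N)).
  apply: ler_sum => J _; rewrite ComplexField.Normc.normcM ler_wpM2l//.
    by rewrite nc_nsq sqrtr_ge0.
  by rewrite nc_nsq nsq_real sqrtr_sqr; exact: le_discrepancy.
by rewrite -mulr_suml ler_wpM2r// discrepancy_ge0.
Qed.

End koksma.

Definition koksma_const k : R := \prod_i (1 + 2 * pi * `|(k i)%:~R|).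

(** A Koksma inequality for characters. The constant of exp_average_grid does not
    depend on the grid, so the error of discretization disappears as the grid is
    refined. *)
Lemma exp_average_discrepancy k (y : nat -> 'rV[R]_d) N : k != 0 -> (0 < N)%N ->
  (forall n i, 0 <= y n ord0 i < 1) ->
  nc ((N%:R^-1)%:C * \sum_(n < N) chi k (y n)) <=
  koksma_const k * discrepancy y N.
Proof.
move=> k0 N0 y01; apply/ler_addgt0Pr => e e0.
set K : R := 2 * pi * (\sum_i `|(k i)%:~R|).
pose M := maxn (\max_i `|k i|%N).+1 (Num.truncn (K / e)).+1.
have kM i : (`|k i| < M)%N.
  by rewrite leq_max ltnS (leq_bigmax i).
have M0 : (0 < M)%N by rewrite leq_max.
rewrite (le_trans (exp_average_grid k0 kM M0 N0 y01))// lerD2l -/K.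
rewrite ler_pdivrMr ?ltr0n// mulrC -ler_pdivrMr//.
rewrite (le_trans (ltW (truncnS_gt _)))// ler_nat leq_maxr.
by [].
Qed.

End characters.

(** * Integrals of exponentials over the unit interval *)

Section interval_mean.
Context {R : realType}.
Local Notation C := R[i].
Local Notation mu := (@lebesgue_measure R).

Lemma continuous_integrable01 (f : R -> R) : continuous f ->
  mu.-integrable `[0, 1] (EFin \o f).
Proof.
move=> cf; apply: continuous_compact_integrable; first exact: segment_compact.
exact: continuous_subspaceT.
Qed.

Let ival (f : R -> R) := \int[mu]_(x in `[0, 1]) f x.

Let ival_cst c : ival (fun=> c) = c.
Proof.
rewrite /ival Rintegral_cst//= lebesgue_measure_itv/= lte_fin ltr01 oppr0 adde0.
by rewrite mulr1.
Qed.

Let ivalD (f g : R -> R) : continuous f -> continuous g ->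
  ival (fun t => f t + g t) = ival f + ival g.
Proof.
by move=> cf cg; rewrite /ival RintegralD//; exact: continuous_integrable01.
Qed.

Let ivalZ c (f : R -> R) : continuous f ->
  ival (fun t => c * f t) = c * ival f.
Proof.
by move=> cf; rewrite /ival RintegralZl//; exact: continuous_integrable01.
Qed.

Let ival_ge0 (f : R -> R) : continuous f -> (forall t, 0 <= f t) -> 0 <= ival f.
Proof. by move=> cf f0; apply: Rintegral_ge0 => x _; exact: f0. Qed.

(** The domain consists of continuous functions, whose integrability is automatic. *)
Definition interval_mean : mean R R :=
  @Mean R R (fun f => continuous f) ival
    (fun c => fun x => cvg_cst c)
    (fun f g cf cg x => cvgD (cf x) (cg x))
    (fun f g cf cg x => cvgM (cf x) (cg x))
    ival_cst
    ivalD ivalZ ival_ge0.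

Lemma mdom_norm (f : R -> R) : mdom interval_mean f ->
  mdom interval_mean (fun t => `|f t|).
Proof.
move=> cf; suff : continuous (fun t => `|f t|) by [].
move=> t; apply: (@continuous_comp _ _ _ f Num.norm); first exact: cf.
exact: norm_continuous.
Qed.

Lemma continuous_scale (g : R -> R) (w : R) : continuous g ->
  continuous (fun x => g (w * x)).
Proof.
move=> cg x; apply: (@continuous_comp _ _ _ (fun x => w * x) g); last exact: cg.
by apply: mulrl_continuous.
Qed.

Lemma cdom_cexp2pi (w : R) : cdom interval_mean (fun t => cexp2pi (w * t)).
Proof.
have E t : 2 * pi * (w * t) = (2 * pi * w) * t by ring.
split=> /=; under eq_fun do rewrite E.
  exact/continuous_scale/continuous_cos.
exact/continuous_scale/continuous_sin.
Qed.

Let int_scale_periodic (F f : R -> R) (w : R) : w != 0 ->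
  (forall x : R, is_derive x 1 F (f x)) -> continuous f -> F w = F 0 ->
  ival (fun x => f (w * x)) = 0.
Proof.
move=> w0 dF cf Fw.
have dG (x : R) : is_derive x 1 (fun x => w^-1 * F (w * x)) (f (w * x)).
  have -> : (fun x => w^-1 * F (w * x)) = w^-1 \*: (F \o (fun x => w * x)) by [].
  have h : is_derive x 1 (F \o (fun x => w * x)) (f (w * x) * w).
    apply: is_derive1_comp.
    by apply: is_derive_eq; rewrite scaler1.
  by apply: is_derive_eq; rewrite [LHS]mulrC mulfK.
have cG : continuous (fun x => w^-1 * F (w * x)).
  by move=> x; apply: differentiable_continuous; apply/derivable1_diffP.
rewrite /ival /Rintegral.
rewrite (@continuous_FTC2 _ _ (fun x => w^-1 * F (w * x))) ?ltr01//.
- by rewrite mulr1 mulr0 Fw subee.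
- exact/continuous_subspaceT/continuous_scale.
- split; first by move=> x _; exact: ex_derive.
  + exact/cvg_at_right_filter/cG.
  + exact/cvg_at_left_filter/cG.
- by move=> x _; rewrite derive1E derive_val.
Qed.

Lemma cmean_cexp2pi (k : int) :
  cmean interval_mean (fun t => cexp2pi (k%:~R * t)) = (k == 0)%:R.
Proof.
have [->|k0] := eqVneq k 0.
  rewrite -(cmean_cst interval_mean 1); congr cmean; apply/funext => t.
  by rewrite mul0r cexp2pi0.
have w0 : 2 * pi * k%:~R != 0 :> R by rewrite !mulf_neq0 ?intr_eq0// gt_eqF// pi_gt0.
have E t : 2 * pi * (k%:~R * t) = (2 * pi * k%:~R) * t :> R by ring.
have := @cexp2pi_int R k; rewrite /cexp2pi => -[ck sk].
apply: complex_ext => /=; under eq_fun do rewrite E.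
  apply: (@int_scale_periodic sin cos) => //; last by rewrite sin0.
  exact: continuous_cos.
apply: (@int_scale_periodic (- cos) sin) => //.
- by move=> x; apply: is_derive_eq; rewrite opprK.
- exact: continuous_sin.
- by rewrite /= !fctE ck cos0.
Qed.

End interval_mean.

(** * Trigonometric sums in one variable *)

Section trigonometric_sums.
Context {R : realType}.
Local Notation C := R[i].
Local Notation I := (@interval_mean R).

(** With this sign, the coefficient of a density against the conjugate of [expi h]
    is its integral against e(ht), as in the correlation at shift [h]. *)
Definition expi (h : nat) (t : R) : C := cexp2pi ((- h%:Z)%:~R * t).

Lemma expi0 t : expi 0 t = 1.
Proof. by rewrite /expi oppr0 mul0r cexp2pi0. Qed.

Lemma cdom_expi h : cdom I (expi h).
Proof. exact: cdom_cexp2pi. Qed.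

Lemma expi_conjM h k t :
  expi h t * (expi k t)^* = cexp2pi ((k%:Z - h%:Z)%:~R * t).
Proof.
by rewrite /expi -cexp2piN -cexp2piD -mulNr -mulrDl -intrN opprK addrC -intrD.
Qed.

Lemma expi_ortho h k : cmean I (fun t => expi h t * (expi k t)^*) = (h == k)%:R.
Proof.
under eq_fun do rewrite expi_conjM.
by rewrite cmean_cexp2pi subr_eq0 eqz_nat eq_sym.
Qed.

Lemma expiM h k t : expi h t * expi k t = expi (h + k) t.
Proof. by rewrite /expi -cexp2piD -mulrDl -intrD -opprD. Qed.

Definition trig_sum (c : nat -> C) N t : C := \sum_(h < N) c h * expi h t.

Lemma cdom_trig_sum c N : cdom I (trig_sum c N).
Proof. by apply: cdom_sum => h; apply: cdomZ; exact: cdom_expi. Qed.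

Lemma mean_trig_sum c N :
  I (fun t => nsq (trig_sum c N t)) = \sum_(h < N) nsq (c h).
Proof.
apply: (@mean_parseval _ _ I N (fun h => expi h)) => [h|h k].
  exact: cdom_expi.
by rewrite expi_ortho.
Qed.

Lemma Re_sqr_le_nsq (z : C) : complex.Re z ^+ 2 <= nsq z.
Proof. by rewrite /nsq lerDl sqr_ge0. Qed.

Lemma mdom_Re_trig_sum c N : mdom I (fun t => complex.Re (trig_sum c N t)).
Proof. by have [] := cdom_trig_sum c N. Qed.

Lemma mean_sqr_Re_trig_sum c N :
  I (fun t => complex.Re (trig_sum c N t) ^+ 2) <= \sum_(h < N) nsq (c h).
Proof.
rewrite -mean_trig_sum; apply: mval_le => [||t]; last exact: Re_sqr_le_nsq.
  by apply: mdomM; exact: mdom_Re_trig_sum.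
by apply: mdom_nsq; exact: cdom_trig_sum.
Qed.

Lemma coef_trig_sum c N k : (k < N)%N ->
  cmean I (fun t => trig_sum c N t * (expi k t)^*) = c k.
Proof.
move=> kN; under eq_fun do rewrite /trig_sum mulr_suml.
rewrite cmean_sum => [|h]; last first.
  by apply: cdomM; [apply: cdomZ|apply: cdom_conj]; exact: cdom_expi.
rewrite (bigD1 (Ordinal kN))//= big1 => [|h hk].
  under eq_fun do rewrite -mulrA.
  rewrite cmeanZ ?expi_ortho ?eqxx ?mulr1 ?addr0//.
  by apply: cdomM; [|apply: cdom_conj]; exact: cdom_expi.
under eq_fun do rewrite -mulrA.
rewrite cmeanZ ?expi_ortho; last first.
  by apply: cdomM; [|apply: cdom_conj]; exact: cdom_expi.
rewrite (_ : (_ == _) = false) ?mulr0//.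
by apply: contraNF hk => /eqP hk; apply/eqP/val_inj.
Qed.

Lemma coef_conj_trig_sum c N k : (0 < N)%N ->
  cmean I (fun t => (trig_sum c N t)^* * (expi k t)^*) = (k == 0)%N%:R * (c 0%N)^*.
Proof.
move=> N0; under eq_fun do rewrite -rmorphM.
rewrite cmean_conj; last first.
  by apply: cdomM; [exact: cdom_trig_sum|exact: cdom_expi].
rewrite -[X in _ = X * _]conjc_nat -rmorphM; congr conjc.
under eq_fun do rewrite /trig_sum mulr_suml.
rewrite cmean_sum => [|h]; last first.
  by apply: cdomM; [apply: cdomZ|]; exact: cdom_expi.
have E h : cmean I (fun t => c h * expi h t * expi k t) = (h + k == 0)%N%:R * c h.
  under eq_fun do rewrite -mulrA expiM.
  rewrite cmeanZ; last exact: cdom_expi.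
  by rewrite /expi cmean_cexp2pi oppr_eq0 mulrC.
under eq_bigr do rewrite E.
case: N N0 => // N _; rewrite big_ord_recl/= big1 => [|h _]; last by rewrite mul0r.
by rewrite addr0 add0n.
Qed.

(** The real part is the half-sum of the trigonometric sum and of its conjugate.
    Their only common frequency is 0, so the coefficient at 0 is kept and the
    others are halved. *)
Lemma coef_Re_trig_sum c N k : complex.Im (c 0%N) = 0 -> (k < N)%N ->
  cmean I (fun t => (complex.Re (trig_sum c N t))%:C * (expi k t)^*) =
  (if k == 0%N then c k else c k / 2).
Proof.
move=> c0 kN.
have -> : (fun t => (complex.Re (trig_sum c N t))%:C * (expi k t)^*) =
   (fun t => 2^-1 * (trig_sum c N t * (expi k t)^* + (trig_sum c N t)^* * (expi k t)^*)).
  by apply/funext => t; rewrite ReJ_add -mulrDl mulrAC mulrC.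
have d1 : cdom I (fun t => trig_sum c N t * (expi k t)^*).
  by apply: cdomM; [exact: cdom_trig_sum|apply: cdom_conj; exact: cdom_expi].
have d2 : cdom I (fun t => (trig_sum c N t)^* * (expi k t)^*).
  by apply: cdomM; apply: cdom_conj; [exact: cdom_trig_sum|exact: cdom_expi].
rewrite cmeanZ ?cmeanD ?coef_trig_sum ?coef_conj_trig_sum//; last 2 first.
- exact: leq_ltn_trans kN.
- exact: cdomD.
have [->|k0] := eqVneq k 0%N; last by rewrite mul0r addr0 mulrC.
rewrite mul1r (_ : (c 0%N)^* = c 0%N); last first.
  by move: c0; case: (c 0%N) => a b /= ->; rewrite /conjc oppr0.
by field.
Qed.

End trigonometric_sums.

(** * Fejer means of a correlation sequence *)

Section fejer.
Context {R : realType}.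
Local Notation C := R[i].
Local Notation I := (@interval_mean R).
Variable L : mean R nat.
Hypothesis Lb : forall f : nat -> R, bounded_real f -> mdom L f.
Hypothesis Lshift : forall f : nat -> R, bounded_real f -> L (fun n => f n.+1) = L f.
Implicit Types z w : nat -> C.

Definition corr z h : C := cmean L (fun n => z (n + h)%N * (z n)^*).

Definition window z N t n : C := \sum_(a < N) z (n + a)%N * expi a t.

(** The Fejer mean of the series of correlations of [z], defined as an average of
    squares: this makes it nonnegative, and makes estimates for moduli of complex
    numbers available for it (fejerD_le, fejerB_le). *)
Definition fejer z N t : R := N%:R^-1 * L (fun n => nsq (window z N t n)).

Let cdomL z : bounded_complex z -> cdom L z.
Proof. exact: bounded_complex_cdom. Qed.

Let bounded_corr z h : bounded_complex z ->
  bounded_complex (fun n => z (n + h)%N * (z n)^*).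
Proof.
move=> bz; apply: bounded_complexM; last exact: bounded_complex_conj.
exact: (bounded_complex_comp (addn^~ h) bz).
Qed.

Let bounded_window z N t : bounded_complex z -> bounded_complex (window z N t).
Proof.
move=> bz; apply: bounded_complex_sum => a; apply: bounded_complexM.
  exact: (bounded_complex_comp (addn^~ a) bz).
exact: bounded_complex_cst.
Qed.

Lemma Re_corr0 z : complex.Re (corr z 0) = L (fun n => nsq (z n)).
Proof.
have -> : corr z 0 = (L (fun n => nsq (z n)))%:C; last by [].
by rewrite mean_nsqE /corr; congr cmean; apply/funext => n; rewrite addn0.
Qed.

Lemma Im_corr0 z : complex.Im (corr z 0) = 0.
Proof.
have -> : corr z 0 = (L (fun n => nsq (z n)))%:C; last by [].
by rewrite mean_nsqE /corr; congr cmean; apply/funext => n; rewrite addn0.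
Qed.

(** When [corr z] is extended to negative shifts by conjugation, the sum of
    corr z h e(-ht) over all integers h is the real part of the sum of
    corr2 z h e(-ht) over h >= 0. *)
Definition corr2 z h : C := if h == 0%N then corr z h else 2 * corr z h.

Lemma nsq_corr2 z h : nsq (corr2 z h) <= 4 * nsq (corr z h).
Proof.
rewrite /corr2; case: ifP => _.
  by rewrite ler_peMl ?nsq_ge0// ler1n.
by rewrite nsqM -[2](rmorph_nat (real_complex R)) nsq_real -natrX.
Qed.

Definition triangle N h : R := (N - h)%:R / N%:R.

(** The window of length N+1 at n is z n plus e(-t) times the window of length N at
    n+1. Invariance under shifts removes the translation, and the product of the
    two parts produces the correlations. *)
Lemma window_energyS z N t : bounded_complex z ->
  L (fun n => nsq (window z N.+1 t n)) =
  L (fun n => nsq (window z N t n)) + complex.Re (trig_sum (corr2 z) N.+1 t).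
Proof.
move=> bz.
have wS n : window z N.+1 t n = z n + expi 1 t * window z N t n.+1.
  rewrite /window big_ord_recl/= addn0 expi0 mulr1; congr (_ + _).
  rewrite mulr_sumr; apply: eq_bigr => a _ /=.
  by rewrite mulrCA expiM addSnnS.
have e n : nsq (window z N.+1 t n) = (nsq (z n) + nsq (window z N t n.+1)) +
    2 * complex.Re (expi 1 t * (window z N t n.+1 * (z n)^*)).
  rewrite wS; have := nsq_cexp2pi ((- 1%:Z)%:~R * t); rewrite -/(expi 1 t).
  set E := expi 1 t; case: E => a b; case: (z n) => p q.
  by case: (window z N t n.+1) => r s; rewrite /nsq/= /conjc/= => h; nra.
under eq_fun do rewrite e.
have bw := bounded_window N t bz.
have bw1 : bounded_complex (fun n => window z N t n.+1).
  exact: (bounded_complex_comp S bw).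
have bx : bounded_complex (fun n => expi 1 t * (window z N t n.+1 * (z n)^*)).
  apply: bounded_complexM; first exact: bounded_complex_cst.
  by apply: bounded_complexM => //; exact: bounded_complex_conj.
have [rx _] := cdomL bx.
rewrite mvalD; last 2 first.
- by apply: mdomD; apply: mdom_nsq; exact: cdomL.
- exact: mdomZ.
rewrite mvalD; last 2 first.
- by apply: mdom_nsq; exact: cdomL.
- by apply: mdom_nsq; exact: cdomL.
rewrite mvalZ// (Lshift (bounded_nsq bw)) addrAC addrC; congr (_ + _).
rewrite -Re_corr0 /trig_sum big_ord_recl/= expi0 mulr1 ReE_add.
congr (_ + _).
rewrite -[L _]/(complex.Re (cmean L (fun n => expi 1 t * (window z N t n.+1 * (z n)^*)))).
have -> : cmean L (fun n => expi 1 t * (window z N t n.+1 * (z n)^*)) =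
    \sum_(a < N) corr z a.+1 * expi a.+1 t.
  under eq_fun do rewrite /window mulr_suml mulr_sumr.
  rewrite cmean_sum => [|a].
    apply: eq_bigr => a _; rewrite mulrC /corr -cmeanZ; last exact/cdomL/bounded_corr.
    congr cmean; apply/funext => n.
    by rewrite -[a.+1]add1n -expiM addnA addn1; ring.
  apply: cdomL; apply: bounded_complexM; first exact: bounded_complex_cst.
  apply: bounded_complexM; last exact: bounded_complex_conj.
  apply: bounded_complexM; last exact: bounded_complex_cst.
  exact: (bounded_complex_comp (fun n => n.+1 + a)%N bz).
rewrite -ReZ rmorph_nat mulr_sumr; congr complex.Re.
by apply: eq_bigr => a _; rewrite /corr2/= mulrA.
Qed.

(** Summing the increments of window_energyS counts the correlation at shift h once
    for each length above h, that is N - h times. *)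
Lemma fejerE z N t : bounded_complex z -> (0 < N)%N ->
  fejer z N t = complex.Re (trig_sum (fun h => (triangle N h)%:C * corr2 z h) N t).
Proof.
move=> bz N0; rewrite /fejer.
have -> : L (fun n => nsq (window z N t n)) =
    complex.Re (trig_sum (fun h => (N - h)%:R%:C * corr2 z h) N t).
  elim: N {N0} => [|N IH].
    rewrite /trig_sum big_ord0/= -[RHS](mval_cst L); congr (L _).
    by apply/funext => n; rewrite /window big_ord0 nsq0.
  rewrite window_energyS// IH -ReE_add; congr complex.Re.
  rewrite /trig_sum !big_ord_recr/= subSnn rmorph1 mul1r addrA; congr (_ + _).
  rewrite -big_split/=; apply: eq_bigr => h _.
  by rewrite subSn ?(ltnW (ltn_ord h))// -natr1 rmorphD/=; ring.
rewrite /trig_sum -ReZ mulr_sumr; congr complex.Re; apply: eq_bigr => h _.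
by rewrite /triangle rmorphM/=; ring.
Qed.

Lemma triangle_ge N h : (N <= h)%N -> triangle N h = 0.
Proof. by rewrite /triangle -subn_eq0 => /eqP ->; rewrite mul0r. Qed.

Lemma triangle01 N h : 0 <= triangle N h <= 1.
Proof.
rewrite /triangle divr_ge0//=; have [->|N0] := posnP N; first by rewrite invr0 mulr0.
by rewrite ler_pdivrMr ?ltr0n// mul1r ler_nat leq_subr.
Qed.

Lemma triangle_near1 N h : (0 < N)%N -> 1 - h%:R / N%:R <= triangle N h.
Proof.
move=> N0; rewrite /triangle.
have N0' : N%:R != 0 :> R by rewrite pnatr_eq0 -lt0n.
have -> : 1 - h%:R / N%:R = (N%:R - h%:R) / N%:R :> R by field.
rewrite ler_wpM2r ?invr_ge0//.
have [hN|Nh] := leqP h N; first by rewrite natrB.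
by rewrite (@le_trans _ _ 0)// subr_le0 ler_nat ltnW.
Qed.

Lemma fejer_widen z N K t : bounded_complex z -> (0 < N)%N -> (N <= K)%N ->
  fejer z N t = complex.Re (trig_sum (fun h => (triangle N h)%:C * corr2 z h) K t).
Proof.
move=> bz N0 NK; rewrite fejerE//; congr complex.Re; rewrite /trig_sum.
rewrite -(big_mkord xpredT (fun h => (triangle N h)%:C * corr2 z h * expi h t)).
rewrite -(big_mkord xpredT (fun h => (triangle N h)%:C * corr2 z h * expi h t)).
rewrite [RHS](big_cat_nat _ (n := N))//= [X in _ = _ + X]big_nat.
rewrite [X in _ = _ + X]big1 ?addr0// => h /andP[Nh _].
by rewrite triangle_ge// !mul0r.
Qed.

Lemma continuous_fejer z N : bounded_complex z -> (0 < N)%N ->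
  continuous (fejer z N).
Proof.
move=> bz N0; have -> : fejer z N = fun t =>
    complex.Re (trig_sum (fun h => (triangle N h)%:C * corr2 z h) N t).
  by apply/funext => t; exact: fejerE.
exact: mdom_Re_trig_sum.
Qed.

Lemma fejer_ge0 z N t : bounded_complex z -> 0 <= fejer z N t.
Proof.
move=> bz; rewrite mulr_ge0 ?invr_ge0// mean_nsq_ge0//.
exact/cdomL/bounded_window.
Qed.

Lemma windowD z w N t n :
  window (fun n => z n + w n) N t n = window z N t n + window w N t n.
Proof. by rewrite /window -big_split; apply: eq_bigr => a _; rewrite mulrDl. Qed.

Lemma windowB z w N t n :
  window (fun n => z n - w n) N t n = window z N t n - window w N t n.
Proof. by rewrite /window -sumrB; apply: eq_bigr => a _; rewrite mulrBl. Qed.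

Lemma fejerD_le z w N t : bounded_complex z -> bounded_complex w ->
  fejer (fun n => z n + w n) N t <= 2 * fejer z N t + 2 * fejer w N t.
Proof.
move=> bz bw; rewrite /fejer mulrCA [X in _ <= _ + X]mulrCA -mulrDr.
rewrite ler_wpM2l ?invr_ge0//; under eq_fun do rewrite windowD.
by apply: mean_nsqD; exact/cdomL/bounded_window.
Qed.

Lemma fejerB_le (e : R) z w N t : 0 < e -> bounded_complex z -> bounded_complex w ->
  `|fejer z N t - fejer w N t| <=
  e^-1 * fejer (fun n => z n - w n) N t + e * (fejer z N t + fejer w N t).
Proof.
move=> e0 bz bw; rewrite /fejer -mulrBr normrM ger0_norm ?invr_ge0//.
rewrite -mulrDr mulrCA [e * _]mulrCA -mulrDr ler_wpM2l ?invr_ge0//.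
have bzw := bounded_complexB bz bw.
have dz := mdom_nsq (cdomL (bounded_window N t bz)).
have dw := mdom_nsq (cdomL (bounded_window N t bw)).
have dzw := mdom_nsq (cdomL (bounded_window N t bzw)).
rewrite -mvalB// -mvalD// -!mvalZ//; last exact: mdomD.
rewrite -mvalD; [|exact: mdomZ|by apply/mdomZ/mdomD].
have dR : mdom L (fun n => e^-1 * nsq (window (fun n => z n - w n) N t n) +
    e * (nsq (window z N t n) + nsq (window w N t n))).
  by apply: mdomD; [exact: mdomZ|by apply/mdomZ/mdomD].
have key n := nsqB_le (window z N t n) (window w N t n) e0.
rewrite ler_norml; apply/andP; split.
  rewrite lerNl -mulN1r -mvalZ; last exact: mdomB.
  apply: mval_le => [||n]//; first by apply/mdomZ/mdomB.
  rewrite windowB; apply: le_trans (key n).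
  by rewrite mulN1r -normrN ler_norm.
apply: mval_le => [||n]//; first exact: mdomB.
by rewrite windowB; apply: le_trans (key n); exact: ler_norm.
Qed.

End fejer.

(** * Square summable correlations *)

Section square_summable.
Context {R : realType}.
Local Notation C := R[i].
Local Notation I := (@interval_mean R).
Variable L : mean R nat.
Hypothesis Lb : forall f : nat -> R, bounded_real f -> mdom L f.
Hypothesis Lshift : forall f : nat -> R, bounded_real f -> L (fun n => f n.+1) = L f.
Implicit Types z w : nat -> C.
Local Notation corr := (corr L).
Local Notation fejer := (fejer L).

Definition corr_l2 z := exists B : R, forall N, \sum_(h < N) nsq (corr z h) <= B.

Let coefs z N h : C := (@triangle R N h)%:C * corr2 L z h.

Let coefs_real0 z N : complex.Im (coefs z N 0%N) = 0.
Proof. by rewrite /coefs ImE_mul /corr2 eqxx Im_corr0 mulr0 mul0r addr0. Qed.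

Let nsq_coefs z N h : nsq (coefs z N h) <= 4 * nsq (corr z h).
Proof.
rewrite /coefs nsqM nsq_real (le_trans _ (nsq_corr2 L z h))//.
have /andP[t0 t1] := @triangle01 R N h.
by rewrite ler_piMl ?nsq_ge0// expr_le1.
Qed.

Lemma coef_fejer z N h : bounded_complex z -> (h < N)%N ->
  cmean I (fun t => (fejer z N t)%:C * (expi h t)^*) = (@triangle R N h)%:C * corr z h.
Proof.
move=> bz hN; have N0 : (0 < N)%N by exact: leq_ltn_trans hN.
under eq_fun do rewrite (fejerE Lb Lshift)//.
rewrite coef_Re_trig_sum//; last exact: coefs_real0.
by rewrite /corr2; case: eqP => // _; rewrite mulrCA mulrC mulKf// pnatr_eq0.
Qed.

Lemma mean_fejer z N : bounded_complex z -> (0 < N)%N ->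
  I (fejer z N) = L (fun n => nsq (z n)).
Proof.
move=> bz N0; have := coef_fejer bz N0.
under eq_fun do rewrite expi0 conjc1 mulr1.
rewrite cmean_real => /(congr1 (@complex.Re R)).
by rewrite ReZ Re_corr0 /triangle subn0 divff ?mul1r// pnatr_eq0 -lt0n.
Qed.

Lemma mean_sqr_fejer_le z N : bounded_complex z -> (0 < N)%N ->
  I (fun t => fejer z N t ^+ 2) <= 4 * \sum_(h < N) nsq (corr z h).
Proof.
move=> bz N0.
under eq_fun do rewrite (fejerE Lb Lshift)//.
rewrite (le_trans (mean_sqr_Re_trig_sum _ _))// mulr_sumr ler_sum// => h _.
exact: nsq_coefs.
Qed.

Let mdom_fejer z N : bounded_complex z -> (0 < N)%N -> mdom I (fejer z N).
Proof. exact: continuous_fejer. Qed.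

(** Bessel's inequality for the Fejer mean of length 2H, whose weights are at least
    1/2 at the shifts below H. *)
Lemma corr_sum_le z H : bounded_complex z -> (0 < H)%N ->
  \sum_(h < H) nsq (corr z h) <= 4 * I (fun t => fejer z H.*2 t ^+ 2).
Proof.
move=> bz H0; have H2 : (0 < H.*2)%N by rewrite double_gt0.
have df : cdom I (fun t => (fejer z H.*2 t)%:C).
  by split; [exact: mdom_fejer|exact: mdom_cst].
have := @mean_bessel _ _ I H.*2 (fun h => expi h) (fun h => cdom_expi h)
  (fun h k => expi_ortho h k) _ df.
under [X in _ <= mval _ X -> _]eq_fun do rewrite nsq_real.
move/(ler_wpM2l (ler0n R 4)); apply: le_trans.
rewrite mulr_sumr -(big_mkord xpredT (fun h => 4 * nsq (cmean I (fun t => (fejer z H.*2 t)%:C * (expi h t)^*)))).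
rewrite (big_cat_nat _ (n := H))//=; last by rewrite -addnn leq_addr.
rewrite -[X in X <= _]addr0 lerD//; last first.
  by rewrite sumr_ge0// => h _; rewrite mulr_ge0 ?nsq_ge0.
rewrite big_mkord ler_sum// => h _.
have hH : (h < H.*2)%N by rewrite (leq_trans (ltn_ord h))// -addnn leq_addr.
rewrite coef_fejer// nsqM nsq_real mulrA ler_peMl ?nsq_ge0//.
have half : 1 / 2 <= @triangle R H.*2 h.
  apply: le_trans (triangle_near1 h H2).
  suff : h%:R / H.*2%:R <= 1 / 2 :> R by lra.
  rewrite ler_pdivrMr ?ltr0n// mul1r -muln2 natrM mulrCA mulVf ?pnatr_eq0// mulr1.
  by rewrite ler_nat ltnW.
by nra.
Qed.

(** The correlations of a sum contain mixed terms between [z] and [w]. The Fejer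
    means bypass them, and square summability of the correlations is boundedness of
    the Fejer means in quadratic mean. *)
Lemma corr_l2D z w : bounded_complex z -> bounded_complex w ->
  corr_l2 z -> corr_l2 w -> corr_l2 (fun n => z n + w n).
Proof.
move=> bz bw [B zB] [D wD]; exists (4 * (32 * B + 32 * D)) => N.
have bzw := bounded_complexD bz bw.
have [->|N0] := posnP N.
  have := zB 0%N; have := wD 0%N; rewrite !big_ord0 => D0 B0.
  by rewrite mulr_ge0// addr_ge0// mulr_ge0.
rewrite (le_trans (corr_sum_le bzw N0))// ler_wpM2l//.
have H2 : (0 < N.*2)%N by rewrite double_gt0.
apply: (@le_trans _ _ (8 * I (fun t => fejer z N.*2 t ^+ 2) + 8 * I (fun t => fejer w N.*2 t ^+ 2))).
  have sq u : bounded_complex u -> mdom I (fun t => fejer u N.*2 t ^+ 2).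
    by move=> bu; apply: mdomM; exact: mdom_fejer.
  rewrite -!mvalZ -?mvalD; try exact: sq; try (apply: mdomZ; exact: sq).
  apply: mval_le => [||t]; first exact: sq.
    by apply: mdomD; apply: mdomZ; exact: sq.
  have := fejerD_le Lb N.*2 t bz bw; have := fejer_ge0 Lb N.*2 t bzw.
  set u := fejer (fun n => _) _ _; set x := fejer z _ _; set y := fejer w _ _.
  move=> u0 uxy; apply: (@le_trans _ _ ((2 * x + 2 * y) ^+ 2)).
    by rewrite ler_sqr ?nnegrE//; apply: le_trans uxy.
  by have := sqr_ge0 (x - y); lra.
have := mean_sqr_fejer_le bz H2; have := mean_sqr_fejer_le bw H2.
by have := zB N.*2; have := wD N.*2; lra.
Qed.

Lemma corr_l2Z c z : bounded_complex z -> corr_l2 z -> corr_l2 (fun n => c * z n).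
Proof.
move=> bz [B zB]; exists (nsq c ^+ 2 * B) => N.
rewrite (eq_bigr (fun h : 'I_N => nsq c ^+ 2 * nsq (corr z h))).
  by rewrite -mulr_sumr ler_wpM2l ?sqr_ge0 ?zB.
move=> h _; have -> : corr (fun n => c * z n) h = (c * c^*) * corr z h.
  rewrite /corr -cmeanZ; last first.
    apply: bounded_complex_cdom => //; apply: bounded_complexM.
      exact: (bounded_complex_comp (addn^~ h) bz).
    exact: bounded_complex_conj.
  by congr cmean; apply/funext => n; rewrite rmorphM mulrACA.
by rewrite !nsqM nsq_conj expr2.
Qed.

(** The coefficients of a Fejer mean are those of the series with weights in [0, 1]
    that tend to 1, so the tail of the series controls the differences. *)
Lemma fejer_cauchy2 z : bounded_complex z -> corr_l2 z -> forall e : R, 0 < e ->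
  exists N0, forall N M, (N0 <= N)%N -> (N0 <= M)%N -> (0 < N)%N -> (0 < M)%N ->
    I (fun t => (fejer z N t - fejer z M t) ^+ 2) <= e.
Proof.
move=> bz [B zB] e e0.
pose S N : R := \sum_(h < N) nsq (corr z h).
have B0 : 0 <= B by have := zB 0%N; rewrite big_ord0.
have ndS : {homo S : n m / (n <= m)%N >-> n <= m}.
  move=> n m nm; rewrite /S -!(big_mkord xpredT (fun h => nsq (corr z h))).
  rewrite [X in _ <= X](big_cat_nat _ (n := n))//= lerDl sumr_ge0// => h _.
  exact: nsq_ge0.
have [H HS] : exists H, forall N, S N <= S H + e / 8.
  have ub : has_ubound (range S) by exists B => _ [n _ <-]; exact: zB.
  have hs : has_sup (range S) by split => //; exists (S 0%N), 0%N.
  have e8 : 0 < e / 8 by rewrite divr_gt0.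
  have [_ [H _ <-] lt] := sup_adherent e8 hs.
  exists H => N; have : S N <= sup (range S) by apply: ub_le_sup => //; exists N.
  lra.
pose N0 := (Num.truncn (H%:R * (8 * B) / e)).+1.
exists N0 => N M N0N N0M N1 M1.
have small P h : (N0 <= P)%N -> (h < H)%N -> 1 - H%:R / N0%:R <= @triangle R P h <= 1.
  move=> NP hH; have /andP[_ ->] := @triangle01 R P h; rewrite andbT.
  have P0 : (0 < P)%N by exact: leq_trans NP.
  apply: le_trans (triangle_near1 h P0); rewrite lerD2l lerN2.
  by rewrite ler_pM ?invr_ge0// ?ler_nat ?(ltnW hH)// lef_pV2 ?posrE ?ltr0n// ler_nat.
have HN0 : H%:R / N0%:R * (8 * B) <= e.
  rewrite mulrAC ler_pdivrMr ?ltr0n// [X in _ <= X]mulrC -ler_pdivrMr//.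
  exact/ltW/truncnS_gt.
pose K := maxn (maxn N M) H.
have NK : (N <= K)%N by rewrite /K -maxnA leq_maxl.
have MK : (M <= K)%N by rewrite /K maxnAC leq_maxr.
have HK : (H <= K)%N by rewrite leq_maxr.
pose c h : C := coefs z N h - coefs z M h.
have -> : (fun t => (fejer z N t - fejer z M t) ^+ 2) =
    (fun t => complex.Re (trig_sum c K t) ^+ 2).
  apply/funext => t; rewrite (fejer_widen Lb Lshift t bz N1 NK).
  rewrite (fejer_widen Lb Lshift t bz M1 MK); congr (_ ^+ 2).
  have -> : trig_sum c K t = trig_sum (coefs z N) K t - trig_sum (coefs z M) K t.
    by rewrite /trig_sum -sumrB; apply: eq_bigr => h _; rewrite mulrBl.
  by rewrite ReE_add; congr (_ + _); case: (trig_sum _ _ _).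
rewrite (le_trans (mean_sqr_Re_trig_sum _ _))//.
have cE h : nsq (c h) = (@triangle R N h - @triangle R M h) ^+ 2 * nsq (corr2 L z h).
  by rewrite /c /coefs -mulrBl -rmorphB nsqM nsq_real.
rewrite -(big_mkord xpredT (fun h => nsq (c h))) (big_cat_nat _ (n := H))//=.
have -> : e = e / 2 + e / 2 by field.
apply: lerD.
  rewrite big_mkord.
  apply: (@le_trans _ _ (\sum_(h < H) (H%:R / N0%:R * 4) * nsq (corr z h))).
    apply: ler_sum => h _; rewrite cE -mulrA ler_pM ?sqr_ge0 ?nsq_ge0//; last first.
      exact: nsq_corr2.
    have /andP[a1 a2] := small N h N0N (ltn_ord h).
    have /andP[b1 b2] := small M h N0M (ltn_ord h).
    have /andP[a3 _] := @triangle01 R N h; have /andP[b3 _] := @triangle01 R M h.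
    set x := @triangle R N h in a1 a2 a3 *; set y := @triangle R M h in b1 b2 b3 *.
    have xy1 : `|x - y| <= 1 by rewrite ler_norml; apply/andP; split; lra.
    have xy2 : `|x - y| <= H%:R / N0%:R by rewrite ler_norml; apply/andP; split; lra.
    by rewrite -real_normK ?num_real//; have := normr_ge0 (x - y); nra.
  rewrite -mulr_sumr.
  have HN : 0 <= H%:R / N0%:R :> R by rewrite divr_ge0.
  by have := ler_wpM2l HN (zB H); lra.
apply: (@le_trans _ _ (\sum_(H <= h < K) 4 * nsq (corr z h))).
  apply: ler_sum => h _; rewrite cE.
  have /andP[a3 a4] := @triangle01 R N h; have /andP[b3 b4] := @triangle01 R M h.
  rewrite (le_trans _ (nsq_corr2 L z h))// ler_piMl ?nsq_ge0//.
  by nra.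
rewrite -mulr_sumr.
have : S K = S H + \sum_(H <= h < K) nsq (corr z h).
  by rewrite /S -!(big_mkord xpredT (fun h => nsq (corr z h))) -big_cat_nat.
by have := HS K; lra.
Qed.

(** By fejerB_le and mean_fejer, the mean of |F_N(z) - F_N(w)| is at most 1/k times
    the mean of |z - w|^2 plus k times a bounded quantity, for every weight k > 0
    and uniformly in N, while
    the Fejer means of w are Cauchy by fejer_cauchy2. *)
Lemma fejer_cauchy1 z : bounded_complex z ->
  (forall e : R, 0 < e -> exists w, [/\ bounded_complex w, corr_l2 w &
     L (fun n => nsq (z n - w n)) <= e]) ->
  forall e : R, 0 < e ->
  exists N0, forall N M, (N0 <= N)%N -> (N0 <= M)%N -> (0 < N)%N -> (0 < M)%N ->
    I (fun t => `|fejer z N t - fejer z M t|) <= e.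
Proof.
move=> bz happr e e0.
set E : R := L (fun n => nsq (z n)).
have E0 : 0 <= E.
  by apply: mval_ge0 => [|n]; [exact/Lb/bounded_nsq|exact: nsq_ge0].
(* weight in fejerB_le; the energies of z and w add up to at most 3 E + 2 *)
pose k : R := e / (8 * (3 * E + 2 + 1)).
have k0 : 0 < k by rewrite divr_gt0// mulr_gt0//; lra.
have kE : k * (3 * E + 2 + 1) = e / 8 by rewrite /k; field; lra.
pose r : R := Num.min 1 (k * e / 8).
have r0 : 0 < r by rewrite lt_min ltr01 divr_gt0// mulr_gt0.
have [w [bw w2 zw]] := happr r r0.
have bzw := bounded_complexB bz bw.
have r1 : r <= 1 by rewrite ge_min lexx.
have rk : k^-1 * r <= e / 8.
  rewrite ler_pdivrMl//; apply: le_trans (_ : k * e / 8 <= _); last by rewrite mulrA.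
  by rewrite ge_min lexx orbT.
have wE : L (fun n => nsq (w n)) <= 2 * E + 2.
  have -> : (fun n => nsq (w n)) = (fun n => nsq (z n + - (z n - w n))).
    by apply/funext => n; rewrite opprB addrC subrK.
  have d1 : cdom L z by apply: bounded_complex_cdom.
  have d2 : cdom L (fun n => - (z n - w n)).
    apply: bounded_complex_cdom => //.
    by have [B zB] := bzw; exists B => n; rewrite nsqN.
  rewrite (le_trans (mean_nsqD d1 d2))//.
  under [X in _ + _ * mval _ X]eq_fun do rewrite nsqN.
  by rewrite /E in E0 *; lra.
have comp N : (0 < N)%N -> I (fun t => `|fejer z N t - fejer w N t|) <= e / 4.
  move=> N0.
  have dz := mdom_fejer bz N0; have dw := mdom_fejer bw N0.
  have dzw := mdom_fejer bzw N0.
  apply: (@le_trans _ _ (I (fun t => k^-1 * fejer (fun n => z n - w n) N t +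
      k * (fejer z N t + fejer w N t)))).
    apply: mval_le => [||t]; last exact: fejerB_le.
      exact/mdom_norm/mdomB.
    by apply: mdomD; apply: mdomZ => //; exact: mdomD.
  have dzDw := mdomD dz dw.
  rewrite (mvalD (mdomZ _ dzw) (mdomZ _ dzDw)) (mvalZ _ dzw) (mvalZ _ dzDw).
  rewrite (mvalD dz dw) !mean_fejer//.
  have h1 : k^-1 * L (fun n => nsq (z n - w n)) <= e / 8.
    by apply: le_trans rk; rewrite ler_wpM2l// invr_ge0 ltW.
  have h2 : k * (E + L (fun n => nsq (w n))) <= e / 8.
    by rewrite -kE ler_wpM2l ?ltW//; lra.
  by rewrite -/E; lra.
have e4 : 0 < (e / 4) ^+ 2 by rewrite exprn_gt0// divr_gt0.
have [N0 HN0] := fejer_cauchy2 bw w2 e4.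
exists N0 => N M N0N N0M N1 M1.
have dz P : (0 < P)%N -> mdom I (fejer z P) by exact: mdom_fejer.
have dw P : (0 < P)%N -> mdom I (fejer w P) by exact: mdom_fejer.
have dsq f : mdom I f -> mdom I (fun t => f t ^+ 2) by move=> df; exact: mdomM.
have mid : I (fun t => `|fejer w N t - fejer w M t|) <= e / 4.
  pose D t := fejer w N t - fejer w M t.
  have dD : mdom I D by apply: mdomB; exact: dw.
  apply: (@le_trans _ _ (I (fun t => (2 / e) * (D t ^+ 2) + e / 8))).
    apply: mval_le => [||t]; first exact/mdom_norm.
      by apply: mdomD; [exact/mdomZ/dsq|exact: mdom_cst].
    have : 0 <= (2 / e) * (`|D t| - e / 4) ^+ 2.
      by rewrite mulr_ge0 ?sqr_ge0 ?divr_ge0// ltW.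
    have -> : (2 / e) * (`|D t| - e / 4) ^+ 2 = (2 / e) * (D t) ^+ 2 - `|D t| + e / 8.
      by rewrite -(real_normK (num_real (D t))); field; rewrite gt_eqF.
    by rewrite -/(D t); lra.
  rewrite (mvalD (mdomZ _ (dsq _ dD)) (mdom_cst _ _)) (mvalZ _ (dsq _ dD)) mval_cst.
  have h2e : 0 <= 2 / e by rewrite divr_ge0// ltW.
  have := ler_wpM2l h2e (HN0 N M N0N N0M N1 M1).
  have -> : 2 / e * (e / 4) ^+ 2 = e / 8 by field; rewrite gt_eqF.
  by rewrite -/D; lra.
have dB P : (0 < P)%N -> mdom I (fun t => `|fejer z P t - fejer w P t|).
  by move=> P0; apply/mdom_norm/mdomB; [exact: dz|exact: dw].
apply: (@le_trans _ _ (I (fun t => `|fejer z N t - fejer w N t| +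
   (`|fejer w N t - fejer w M t| + `|fejer z M t - fejer w M t|)))).
  apply: mval_le => [||t].
  - by apply/mdom_norm/mdomB; exact: dz.
  - apply: mdomD; first exact: dB.
    by apply: mdomD; [apply/mdom_norm/mdomB; exact: dw|exact: dB].
  - rewrite (distrC (fejer z M t)).
    have -> : fejer z N t - fejer z M t = (fejer z N t - fejer w N t) +
      ((fejer w N t - fejer w M t) + (fejer w M t - fejer z M t)) by ring.
    by rewrite (le_trans (ler_normD _ _))// lerD2l ler_normD.
rewrite mvalD; [|exact: dB|]; last first.
  by apply: mdomD; [apply/mdom_norm/mdomB; exact: dw|exact: dB].
rewrite mvalD; [|by apply/mdom_norm/mdomB; exact: dw|exact: dB].
have := comp N N1; have := comp M M1; lra.
Qed.

End square_summable.

(** * Convergence of Cauchy sequences in mean *)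

Section L1_complete.
Context d (T : measurableType d) (R : realType).
Variables (mu : {measure set T -> \bar R}) (D : set T) (mD : measurable D).
Variable G : nat -> T -> R.
Hypothesis intG : forall n, mu.-integrable D (EFin \o G n).
Hypothesis cauchyG : forall e : R, 0 < e -> exists N0, forall N M,
  (N0 <= N)%N -> (N0 <= M)%N -> \int[mu]_(x in D) `|G N x - G M x| <= e.

(** A fast Cauchy subsequence is dominated by the sum of its increments and
    converges wherever this sum is finite, that is almost everywhere. *)
Lemma L1_cauchy_subseq : exists (s : nat -> nat) (g : T -> R),
  [/\ forall n, (n <= s n)%N, mu.-integrable D (EFin \o g) &
  forall phi : T -> R, measurable_fun D phi -> (forall x, `|phi x| <= 1) ->
    \int[mu]_(x in D) (G (s n) x * phi x) @[n --> \oo] -->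
    \int[mu]_(x in D) (g x * phi x)].
Proof.
have half_gt0 k : 0 < 1 / (2 ^ (k + 1))%:R :> R by rewrite divr_gt0// ltr0n expn_gt0.
have [N0 N0P] := choice (fun k => cauchyG (half_gt0 k)).
pose s k := (k + \sum_(j < k.+1) N0 j)%N.
have s_ge n k : (k <= n)%N -> (N0 k <= s n)%N.
  move=> kn; have kn' : (k < n.+1)%N by [].
  by rewrite /s (bigD1 (Ordinal kn'))//= addnCA leq_addr.
have ns n : (n <= s n)%N.
  exact: leq_addr.
pose U k x : R := G (s k.+1) x - G (s k) x.
have intU k : mu.-integrable D (EFin \o U k) by exact: (integrableB mD (intG (s k.+1)) (intG (s k))).
have mU k : measurable_fun D (U k) by apply/measurable_EFinP/measurable_int/intU.
pose H x := (\sum_(k <oo) `|U k x|%:E)%E.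
have mH : measurable_fun D H.
  apply: ge0_emeasurable_sum => [k x _ _|k _]; first by rewrite lee_fin.
  apply/measurable_EFinP.
  exact: measurableT_comp.
have intH : mu.-integrable D H.
  apply/integrableP; split=> //.
  have H0 x : (0 <= H x)%E by apply: nneseries_ge0 => k _ _; rewrite lee_fin.
  under eq_integral => x _ do rewrite gee0_abs//.
  rewrite integral_nneseries//; last first.
    by move=> k; apply/measurable_EFinP; exact: measurableT_comp.
  have half := @cvg_geometric_eseries_half R 1 0.
  apply: (@le_lt_trans _ _ (\sum_(k <oo) (1 / (2 ^ (k + 1))%:R)%:E)%E).
    apply: lee_nneseries => k _; first by move=> _; apply: integral_ge0 => x _; rewrite lee_fin.
    have int_norm : mu.-integrable D (EFin \o (fun x => `|U k x|)).
      exact: (integrable_norm (intU k)).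
    rewrite -[X in (X <= _)%E]fineK; last exact: integrable_fin_num.
    rewrite lee_fin; apply: N0P; last exact: s_ge.
    exact: s_ge.
  rewrite (_ : limn _ = (1 / 2 ^+ 0)%:E) ?ltry//.
  exact: (cvg_lim (@ereal_hausdorff R) half).
have telG n x : G (s n) x = G (s 0%N) x + \sum_(0 <= k < n) U k x.
  by rewrite telescope_sumr// addrC subrK.
have partial n x : ((\sum_(0 <= k < n) `|U k x|)%:E <= H x)%E.
  rewrite -sumEFin; apply: nneseries_lim_ge => k _ _.
  by rewrite lee_fin.
pose g x := fine (limn_esup (fun n => (G (s n) x)%:E)).
have mG n : measurable_fun D (G n) by apply/measurable_EFinP/measurable_int/intG.
have mg : measurable_fun D g.
  apply: measurableT_comp => //.
  by apply: measurable_fun_limn_esup => n; exact/measurable_EFinP.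
have Gg : {ae mu, forall x, D x -> G (s n) x @[n --> \oo] --> g x}.
  have := integrable_ae mD intH; apply: filterS => x Hx Dx.
  have {}Hx := Hx Dx.
  suff cG : cvgn (fun n => G (s n) x).
    have /cvg_ex[l Gl] := cG; rewrite /g.
    have Gl' : (G (s n) x)%:E @[n --> \oo] --> l%:E by apply: cvg_EFin => //; exact: nearW.
    by rewrite (cvg_limn_einf_sup Gl').2.
  have : cvgn (series (U ^~ x)).
    apply: normed_cvg; apply: nondecreasing_is_cvgn.
      by apply: nondecreasing_series => k _ _; exact: normr_ge0.
    exists (fine (H x)) => _ [n _ <-].
    by rewrite -lee_fin fineK// /series/=; exact: partial.
  move=> /cvg_ex[l Ul]; apply/cvg_ex; exists (G (s 0%N) x + l).
  under eq_fun do rewrite telG.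
  by apply: cvgD => //; exact: cvg_cst.
pose K x := (`|G (s 0%N) x|%:E + H x)%E.
have intK : mu.-integrable D K.
  apply: integrableD => //.
  exact: (integrable_norm (intG _)).
have GK n x : (`|G (s n) x|%:E <= K x)%E.
  rewrite telG /K; apply: le_trans (_ : _ <= `|G (s 0%N) x|%:E + (\sum_(0 <= k < n) `|U k x|)%:E)%E _; last first.
    by rewrite leeD2l// partial.
  rewrite -EFinD lee_fin (le_trans (ler_normD _ _))// lerD2l.
  exact: ler_norm_sum.
have dom (phi : T -> R) : measurable_fun D phi -> (forall x, `|phi x| <= 1) ->
    mu.-integrable D (fun x => (g x * phi x)%:E) /\
    (\int[mu]_(x in D) (G (s n) x * phi x)%:E @[n --> \oo] -->
    \int[mu]_(x in D) (g x * phi x)%:E)%E.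
  move=> mphi phi1.
  have [] := @dominated_convergence _ _ _ mu D mD
    (fun n x => (G (s n) x * phi x)%:E) (fun x => (g x * phi x)%:E) K => //.
  - by move=> n; apply/measurable_EFinP/measurable_funM.
  - exact/measurable_EFinP/measurable_funM.
  - apply: filterS Gg => x Gx Dx; apply: cvg_EFin; first exact: nearW.
    by apply: cvgMl; exact: Gx.
  - apply: aeW => x n Dx; apply: le_trans (GK n x).
    by rewrite lee_fin normrM ler_piMr.
exists s, g; split => //.
  have n1 : forall x : T, `|1 : R| <= 1 by move=> _; rewrite normr1.
  have [h _] := dom (fun=> 1) (measurable_cst _) n1.
  by move: h; under eq_fun do rewrite mulr1.
move=> phi mphi phi1; have [h1 h2] := dom phi mphi phi1.
apply: fine_cvg; rewrite fineK//.
exact: integrable_fin_num.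
Qed.
End L1_complete.

(** * Existence of the spectral density *)

Section spectral_density.
Context {R : realType}.
Local Notation C := R[i].
Local Notation I := (@interval_mean R).
Local Notation mu := (@lebesgue_measure R).
Variable L : mean R nat.
Hypothesis Lb : forall f : nat -> R, bounded_real f -> mdom L f.
Hypothesis Lshift : forall f : nat -> R, bounded_real f -> L (fun n => f n.+1) = L f.

Let cvg_triangle h (s : nat -> nat) : (forall n, (n <= s n)%N) ->
  (triangle (s n).+1 h : R) @[n --> \oo] --> (1 : R).
Proof.
move=> ns; apply/cvgrPdist_le => e e0.
near=> n.
have /andP[t0 t1] := @triangle01 R (s n).+1 h.
have t2 := @triangle_near1 R (s n).+1 h (ltn0Sn _).
rewrite ger0_norm ?subr_ge0//.
apply: (@le_trans _ _ (h%:R / (s n).+1%:R)); first by rewrite lerBlDr addrC -lerBlDr.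
rewrite ler_pdivrMr ?ltr0n// mulrC -ler_pdivrMr//.
apply: (@le_trans _ _ n%:R); last by rewrite ler_nat leqW//; exact: ns.
apply: ltW; near: n; exact: nbhs_infty_gtr.
Unshelve. all: by end_near. Qed.

(** The density is a limit in mean of Fejer means, whose coefficient at the shift
    [h] is the correlation times a weight tending to 1. *)
Lemma spectral_density (z : nat -> C) : bounded_complex z ->
  (forall e : R, 0 < e -> exists w, [/\ bounded_complex w, corr_l2 L w &
     L (fun n => nsq (z n - w n)) <= e]) ->
  exists g : R -> R, mu.-integrable `[0, 1] (EFin \o g) /\
    forall h, Cintegral mu `[0, 1] (fun x => (g x)%:C * cexp2pi (h%:R * x)) =
      corr L z h.
Proof.
move=> bz happr.
pose G n := fejer L z n.+1.
have cG n : continuous (G n) by exact: continuous_fejer.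
have [e e0|s [g [ns ig gP]]] := @L1_cauchy_subseq _ _ R mu `[0, 1] (measurable_itv _) G
    (fun n => continuous_integrable01 (cG n)).
  have [N0 HN0] := fejer_cauchy1 Lb Lshift bz happr e0.
  exists N0 => N M N0N N0M.
  by apply: (HN0 N.+1 M.+1) => //; exact: leqW.
exists g; split=> // h.
have coefE n : (h <= s n)%N -> cmean I (fun t => (G (s n) t)%:C * cexp2pi (h%:R * t)) =
    (triangle (s n).+1 h)%:C * corr L z h.
  move=> hn; rewrite -coef_fejer//; congr cmean; apply/funext => t.
  by rewrite /expi -cexp2piN mulrNz mulNr opprK.
have lim_part (p : C -> R) (phi : R -> R) : (forall (a : R) b, p (a%:C * b) = a * p b) ->
  (forall n, p (cmean I (fun t => (G (s n) t)%:C * cexp2pi (h%:R * t))) =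
    \int[mu]_(x in `[0, 1]) (G (s n) x * phi x)) ->
  continuous phi -> (forall x, `|phi x| <= 1) ->
  \int[mu]_(x in `[0, 1]) (g x * phi x) = p (corr L z h).
  move=> pZ pE cphi phi1.
  have mphi : measurable_fun (`[0, 1]%classic : set (measurableTypeR R)) phi.
    by apply: measurable_funTS; exact: continuous_measurable_fun.
  have := gP phi mphi phi1 => lim1.
  have lim2 : (triangle (s n).+1 h * p (corr L z h)) @[n --> \oo] --> p (corr L z h).
    rewrite -[X in _ --> X]mul1r; apply: cvgMl; exact: cvg_triangle.
  rewrite -(cvg_lim (@Rhausdorff R) lim1); apply: cvg_lim => //; apply: cvg_trans lim2.
  apply: near_eq_cvg; near=> n.
  rewrite -pE coefE ?pZ//; near: n.
  by exists h => // n /= hn; exact: leq_trans (ns n).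
have E t : 2 * pi * (h%:R * t) = (2 * pi * h%:R) * t :> R by ring.
apply: complex_ext => /=.
  transitivity (\int[mu]_(x in `[0, 1]) (g x * cos (2 * pi * (h%:R * x)))).
    by apply: eq_Rintegral => x _; rewrite mul0r subr0.
  apply: (lim_part (@complex.Re R)) => [a b|n||x]; first exact: ReZ.
  - by rewrite /=; apply: eq_Rintegral => x _; rewrite /= mul0r subr0.
  - by under eq_fun do rewrite E; exact/continuous_scale/continuous_cos.
  - exact: cos_max.
transitivity (\int[mu]_(x in `[0, 1]) (g x * sin (2 * pi * (h%:R * x)))).
  by apply: eq_Rintegral => x _; rewrite mul0r addr0.
apply: (lim_part (@complex.Im R)) => [a b|n||x].
- by rewrite ImE_mul /= mul0r addr0.
- by rewrite /=; apply: eq_Rintegral => x _; rewrite /= mul0r addr0.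
- by under eq_fun do rewrite E; exact/continuous_scale/continuous_sin.
- exact: sin_max.
Unshelve. all: by end_near. Qed.

End spectral_density.

(** * Approximation in quadratic mean by trigonometric polynomials *)

Section trig_polynomials.
Context {R : realType} {d : nat}.
Local Notation C := R[i].
Implicit Types (p q : 'rV[R]_d -> C).

(** The predicate [K] restricts the frequencies: [predT] gives all trigonometric
    polynomials, [predC1 0] those without constant term. *)
Inductive trig_poly (K : pred {ffun 'I_d -> int}) : ('rV[R]_d -> C) -> Prop :=
| trig_poly0 : trig_poly K (fun=> 0)
| trig_poly_mono c k : K k -> trig_poly K (fun v => c * chi k v)
| trig_polyD p q : trig_poly K p -> trig_poly K q ->
    trig_poly K (fun v => p v + q v).

Local Notation tpoly := (trig_poly predT).

Lemma trig_poly_cst c : tpoly (fun=> c).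
Proof.
have -> : (fun=> c) = (fun v => c * chi 0 v) :> ('rV[R]_d -> C).
  by apply/funext => v; rewrite chi0 mulr1.
exact: trig_poly_mono.
Qed.

Lemma trig_polyZ K c p : trig_poly K p -> trig_poly K (fun v => c * p v).
Proof.
elim=> [|c' k Kk|p1 p2 _ IH1 _ IH2].
- have -> : (fun=> c * 0) = (fun=> 0) :> ('rV[R]_d -> C) by rewrite mulr0.
  exact: trig_poly0.
- have -> : (fun v => c * (c' * chi k v)) = (fun v => (c * c') * chi k v).
    by apply/funext => v; rewrite mulrA.
  exact: trig_poly_mono.
- have -> : (fun v => c * (p1 v + p2 v)) = (fun v => c * p1 v + c * p2 v).
    by apply/funext => v; rewrite mulrDr.
  exact: trig_polyD.
Qed.

Lemma trig_polyM p q : tpoly p -> tpoly q -> tpoly (fun v => p v * q v).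
Proof.
move=> tp tq; elim: tp => [|c k _|p1 p2 _ IH1 _ IH2].
- have -> : (fun v => 0 * q v) = (fun=> 0) by apply/funext => v; rewrite mul0r.
  exact: trig_poly0.
- elim: tq => [|c' k' _|p1 p2 _ IH1 _ IH2].
  + have -> : (fun v => c * chi k v * 0) = (fun=> 0) by apply/funext => v; rewrite mulr0.
    exact: trig_poly0.
  + have -> : (fun v => c * chi k v * (c' * chi k' v)) =
        (fun v => (c * c') * chi (k + k') v).
      by apply/funext => v; rewrite mulrACA -chiD.
    exact: trig_poly_mono.
  + have -> : (fun v => c * chi k v * (p1 v + p2 v)) =
        (fun v => c * chi k v * p1 v + c * chi k v * p2 v).
      by apply/funext => v; rewrite mulrDr.
    exact: trig_polyD.
- have -> : (fun v => (p1 v + p2 v) * q v) = (fun v => p1 v * q v + p2 v * q v).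
    by apply/funext => v; rewrite mulrDl.
  exact: trig_polyD.
Qed.

Lemma trig_poly_conj p : tpoly p -> tpoly (fun v => (p v)^*).
Proof.
elim=> [|c k _|p1 p2 _ IH1 _ IH2].
- have -> : (fun=> (0 : C)^*) = (fun=> 0) :> ('rV[R]_d -> C) by rewrite conjc0.
  exact: trig_poly0.
- have -> : (fun v => (c * chi k v)^*) = (fun v => c^* * chi (- k) v).
    by apply/funext => v; rewrite rmorphM/= chiN.
  exact: trig_poly_mono.
- have -> : (fun v => (p1 v + p2 v)^*) = (fun v => (p1 v)^* + (p2 v)^*).
    by apply/funext => v; rewrite rmorphD.
  exact: trig_polyD.
Qed.

Lemma trig_polyB p q : tpoly p -> tpoly q -> tpoly (fun v => p v - q v).
Proof.
move=> tp tq; have -> : (fun v => p v - q v) = (fun v => p v + -1 * q v).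
  by apply/funext => v; rewrite mulN1r.
by apply: trig_polyD => //; exact: trig_polyZ.
Qed.

Lemma trig_polyX p n : tpoly p -> tpoly (fun v => p v ^+ n).
Proof.
move=> tp; elim: n => [|n IH].
  have -> : (fun v => p v ^+ 0) = (fun=> 1) by apply/funext => v; rewrite expr0.
  exact: trig_poly_cst.
have -> : (fun v => p v ^+ n.+1) = (fun v => p v * p v ^+ n).
  by apply/funext => v; rewrite exprS.
exact: trig_polyM.
Qed.

Lemma bounded_trig_poly K p : trig_poly K p -> bounded_complex p.
Proof.
elim=> [|c k _|p1 p2 _ b1 _ b2].
- exact: bounded_complex_cst.
- by exists (nsq c) => v; rewrite nsqM nsq_chi mulr1.
- exact: bounded_complexD.
Qed.

Lemma trig_poly_split p : tpoly p -> exists c q,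
  trig_poly (predC1 0) q /\ p = (fun v => c + q v).
Proof.
elim=> [|c k _|p1 p2 _ [c1 [q1 [t1 ->]]] _ [c2 [q2 [t2 ->]]]].
- by exists 0, (fun=> 0); split; [exact: trig_poly0|apply/funext => v; rewrite addr0].
- have [->|k0] := eqVneq k 0.
    exists c, (fun=> 0); split; first exact: trig_poly0.
    by apply/funext => v; rewrite chi0 mulr1 addr0.
  exists 0, (fun v => c * chi k v); split; first exact: trig_poly_mono.
  by apply/funext => v; rewrite add0r.
- exists (c1 + c2), (fun v => q1 v + q2 v); split; first exact: trig_polyD.
  by apply/funext => v; rewrite addrACA.
Qed.

End trig_polynomials.

Section approximation.
Context {R : realType} {d : nat}.
Local Notation C := R[i].
Local Notation tpoly := (trig_poly predT).
Variable M : mean R 'rV[R]_d.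
Hypothesis Mb : forall f : 'rV[R]_d -> R, bounded_real f -> mdom M f.
Hypothesis Mchi : forall k : {ffun 'I_d -> int}, k != 0 -> cmean M (chi k) = 0.
Hypothesis Mcube : forall f g : 'rV[R]_d -> R, (forall v, unit_cube v -> f v = g v) ->
  M f = M g.
Implicit Types (f g : 'rV[R]_d -> C) (p q : 'rV[R]_d -> C).

Let cdomM f : bounded_complex f -> cdom M f.
Proof. exact: bounded_complex_cdom. Qed.

Lemma mean_cube_le (f g : 'rV[R]_d -> R) : bounded_real f -> bounded_real g ->
  (forall v, unit_cube v -> f v <= g v) -> M f <= M g.
Proof.
move=> bf bg fg.
have [B fB] := bf; have [D gD] := bg.
have B0 : 0 <= B by apply: le_trans (fB 0); exact: normr_ge0.
pose h v := if `[< unit_cube v >] then f v else g v.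
have -> : M f = M h.
  by apply: Mcube => v cv; rewrite /h; case: asboolP.
have bh : bounded_real h.
  exists (Num.max B D) => v; rewrite /h; case: asboolP => _; rewrite le_max.
    by rewrite fB.
  by rewrite gD orbT.
apply: mval_le; [exact: Mb|exact: Mb|] => v; rewrite /h.
by case: asboolP => // cv; exact: fg.
Qed.

Definition approximable f := bounded_complex f /\
  forall e : R, 0 < e -> exists p, tpoly p /\ M (fun v => nsq (f v - p v)) <= e.

Lemma approximable_trig p : tpoly p -> approximable p.
Proof.
move=> tp; split; first exact: bounded_trig_poly tp.
move=> e e0; exists p; split=> //.
have -> : (fun v => nsq (p v - p v)) = (fun=> 0).
  by apply/funext => v; rewrite subrr nsq0.
by rewrite mval_cst ltW.
Qed.

Lemma approximableD f g : approximable f -> approximable g ->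
  approximable (fun v => f v + g v).
Proof.
move=> [bf af] [bg ag]; split; first exact: bounded_complexD.
move=> e e0; have e4 : 0 < e / 4 by rewrite divr_gt0.
have [p [tp fp]] := af _ e4; have [q [tq gq]] := ag _ e4.
exists (fun v => p v + q v); split; first exact: trig_polyD.
have bp := bounded_complexB bf (bounded_trig_poly tp).
have bq := bounded_complexB bg (bounded_trig_poly tq).
have -> : (fun v => nsq (f v + g v - (p v + q v))) =
   (fun v => nsq ((f v - p v) + (g v - q v))).
  by apply/funext => v; congr nsq; ring.
have := mean_nsqD (cdomM bp) (cdomM bq); lra.
Qed.

(** f g - p q = f (g - q) + q (f - p). The bound of [q] enters in the choice of [p],
    hence [q] is chosen first. *)
Lemma approximableM f g : approximable f -> approximable g ->
  approximable (fun v => f v * g v).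
Proof.
move=> [bf af] [bg ag]; split; first exact: bounded_complexM.
move=> e e0; have [B fB] := bf.
have B0 : 0 <= B by apply: le_trans (fB 0); exact: nsq_ge0.
have eB : 0 < e / (4 * (B + 1)) by rewrite divr_gt0// mulr_gt0//; lra.
have [q [tq gq]] := ag _ eB.
have [D qD] := bounded_trig_poly tq.
have D0 : 0 <= D by apply: le_trans (qD 0); exact: nsq_ge0.
have eD : 0 < e / (4 * (D + 1)) by rewrite divr_gt0// mulr_gt0//; lra.
have [p [tp fp]] := af _ eD.
exists (fun v => p v * q v); split; first exact: trig_polyM.
have bp := bounded_complexB bf (bounded_trig_poly tp).
have bq := bounded_complexB bg (bounded_trig_poly tq).
have dp := mdom_nsq (cdomM bp); have dq := mdom_nsq (cdomM bq).
apply: (@le_trans _ _ (M (fun v => (2 * B) * nsq (g v - q v) + (2 * D) * nsq (f v - p v)))).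
  apply: mval_le => [||v].
  - apply: mdom_nsq; apply: cdomM; apply: bounded_complexB; apply: bounded_complexM => //.
      exact: bounded_trig_poly tp.
    exact: bounded_trig_poly tq.
  - by apply: mdomD; exact: mdomZ.
  - have -> : f v * g v - p v * q v = f v * (g v - q v) + q v * (f v - p v) by ring.
    rewrite (le_trans (nsqD_le _ _))// !nsqM -!mulrA.
    by apply: lerD; rewrite ler_wpM2l// ler_wpM2r ?nsq_ge0.
rewrite mvalD; [|exact: mdomZ|exact: mdomZ]; rewrite !mvalZ//.
have h1 : B * M (fun v => nsq (g v - q v)) <= e / 4.
  apply: (@le_trans _ _ ((B + 1) * (e / (4 * (B + 1))))).
    by rewrite ler_pM//; [apply: mval_ge0 => // v; exact: nsq_ge0|lra].
  by rewrite le_eqVlt; apply/orP; left; apply/eqP; field; lra.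
have h2 : D * M (fun v => nsq (f v - p v)) <= e / 4.
  apply: (@le_trans _ _ ((D + 1) * (e / (4 * (D + 1))))).
    by rewrite ler_pM//; [apply: mval_ge0 => // v; exact: nsq_ge0|lra].
  by rewrite le_eqVlt; apply/orP; left; apply/eqP; field; lra.
lra.
Qed.

Lemma approximable_cst c : approximable (fun=> c).
Proof. exact/approximable_trig/trig_poly_cst. Qed.

Lemma approximableB f g : approximable f -> approximable g ->
  approximable (fun v => f v - g v).
Proof.
move=> af ag.
have -> : (fun v => f v - g v) = (fun v => f v + -1 * g v).
  by apply/funext => v; rewrite mulN1r.
apply: approximableD => //; apply: approximableM => //; exact: approximable_cst.
Qed.

Lemma approximable_sum (I : Type) (r : seq I) (F : I -> 'rV[R]_d -> C) :
  (forall i, approximable (F i)) -> approximable (fun v => \sum_(i <- r) F i v).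
Proof.
move=> aF; elim: r => [|i r IH].
  have -> : (fun v => \sum_(i <- [::]) F i v) = (fun=> 0).
    by apply/funext => v; rewrite big_nil.
  exact: approximable_cst.
have -> : (fun v => \sum_(j <- i :: r) F j v) = (fun v => F i v + \sum_(j <- r) F j v).
  by apply/funext => v; rewrite big_cons.
exact: approximableD.
Qed.

Lemma approximable_prod (I : Type) (r : seq I) (F : I -> 'rV[R]_d -> C) :
  (forall i, approximable (F i)) -> approximable (fun v => \prod_(i <- r) F i v).
Proof.
move=> aF; elim: r => [|i r IH].
  have -> : (fun v => \prod_(i <- [::]) F i v) = (fun=> 1).
    by apply/funext => v; rewrite big_nil.
  exact: approximable_cst.
have -> : (fun v => \prod_(j <- i :: r) F j v) = (fun v => F i v * \prod_(j <- r) F j v).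
  by apply/funext => v; rewrite big_cons.
exact: approximableM.
Qed.

Lemma approximable_uniform f : bounded_complex f ->
  (forall e : R, 0 < e -> exists g, approximable g /\
    forall v, unit_cube v -> nsq (f v - g v) <= e) -> approximable f.
Proof.
move=> bf H; split=> // e e0; have e4 : 0 < e / 4 by rewrite divr_gt0.
have [g [[bg ag] fg]] := H _ e4; have [p [tp gp]] := ag _ e4.
exists p; split=> //.
have b1 := bounded_complexB bf bg.
have b2 := bounded_complexB bg (bounded_trig_poly tp).
have -> : (fun v => nsq (f v - p v)) = (fun v => nsq ((f v - g v) + (g v - p v))).
  by apply/funext => v; congr nsq; ring.
have := mean_nsqD (cdomM b1) (cdomM b2).
have : M (fun v => nsq (f v - g v)) <= M (fun=> e / 4).
  by apply: mean_cube_le => //; [exact: bounded_nsq|exists `|e / 4|].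
by rewrite mval_cst; lra.
Qed.

End approximation.

(** * Indicators of half-spaces *)

Section real_estimates.
Context {R : realType}.
Implicit Types (x k s t : R).

Lemma bernoulli_ge x n : -1 <= x -> 1 + n%:R * x <= (1 + x) ^+ n.
Proof.
move=> x1; elim: n => [|n IH]; first by rewrite mul0r addr0 expr0.
have x0 : 0 <= 1 + x by lra.
rewrite exprS; apply: le_trans (ler_wpM2l x0 IH).
have : 0 <= n%:R * x ^+ 2 by rewrite mulr_ge0 ?sqr_ge0.
rewrite -natr1; set a := n%:R => h; nra.
Qed.

Lemma expr_bernoulli_le1 x n : 0 <= x <= 1 -> (1 - x) ^+ n * (1 + n%:R * x) <= 1.
Proof.
move=> /andP[x0 x1]; have y0 : 0 <= 1 - x by rewrite subr_ge0.
have xm : -1 <= x by lra.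
apply: le_trans (ler_wpM2l (exprn_ge0 n y0) (bernoulli_ge n xm)) _.
have xx : (1 - x) * (1 + x) = 1 - x ^+ 2 by ring.
have := sqr_ge0 x; have : x ^+ 2 <= 1 by rewrite expr_le1.
by move=> h1 h2; rewrite -exprMn xx exprn_ile1; lra.
Qed.

(** For u in [0, 1] this tends to 1 if u < 1/2 and to 0 if u > 1/2. These are the
    polynomials of Brosowski and Deutsch's proof of the Stone-Weierstrass theorem;
    the rate is given by Bernoulli's inequality. *)
Definition threshold_poly n (u : R) : R := (1 - u ^+ n) ^+ (2 ^ n).

Lemma threshold_poly01 n u : 0 <= u <= 1 -> 0 <= threshold_poly n u <= 1.
Proof.
move=> /andP[u0 u1]; have := exprn_ge0 n u0; have := exprn_ile1 n u0 u1 => h1 h0.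
rewrite /threshold_poly exprn_ge0 ?subr_ge0//=.
by rewrite exprn_ile1 ?subr_ge0// gerBl.
Qed.

Lemma threshold_poly_low n k u : 0 <= k <= 1 -> 0 <= u -> 2 * u <= 1 - k ->
  1 - (1 + n%:R * k)^-1 <= threshold_poly n u.
Proof.
move=> /andP[k0 k1] u0 uk; have u1 : u <= 1 by lra.
have x0 := exprn_ge0 n u0; have x1 := exprn_ile1 n u0 u1.
have xm : -1 <= - u ^+ n by lra.
apply: le_trans (bernoulli_ge (2 ^ n) xm); rewrite lerD2l mulrN lerN2 natrX -exprMn.
have nk : 0 <= n%:R * k by rewrite mulr_ge0.
apply: (@le_trans _ _ ((1 - k) ^+ n)).
  by rewrite lerXn2r ?nnegrE//; [rewrite mulr_ge0|lra].
rewrite -[X in _ <= X]mul1r ler_pdivlMr; last lra.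
by rewrite expr_bernoulli_le1// k0.
Qed.

Lemma threshold_poly_high n k u : 0 <= k -> u <= 1 -> 1 + k <= 2 * u ->
  threshold_poly n u <= (1 + n%:R * k)^-1.
Proof.
move=> k0 u1 uk; have u0 : 0 <= u by lra.
have x0 := exprn_ge0 n u0; have x1 := exprn_ile1 n u0 u1.
have nk : 0 <= n%:R * k by rewrite mulr_ge0.
rewrite -[X in _ <= X]mul1r ler_pdivlMr; last lra.
have x01 : 0 <= u ^+ n <= 1 by rewrite x0.
apply: le_trans (expr_bernoulli_le1 (2 ^ n) x01).
rewrite /threshold_poly ler_wpM2l//; first by rewrite exprn_ge0// subr_ge0.
rewrite natrX -exprMn.
have km : -1 <= k by lra.
apply: le_trans (bernoulli_ge n km) _.
apply: (@le_trans _ _ ((2 * u) ^+ n)); last by rewrite lerDr.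
by rewrite lerXn2r ?nnegrE//; lra.
Qed.

Lemma sqr_boolB_le1 (c : bool) x : 0 <= x <= 1 -> (c%:R - x) ^+ 2 <= 1.
Proof. by move=> /andP[x0 x1]; case: c; rewrite ?mulr1n ?mulr0n; nra. Qed.

Lemma cos_ge_half x : `|x| <= 1 -> 1 / 2 <= cos x.
Proof.
move=> x1; have -> : x = (x / 2) *+ 2 by rewrite -mulr_natr; field.
rewrite cos_mulr2n cos2sin2.
have := sin_sqr_le (x / 2).
have : x ^+ 2 <= 1 by rewrite -real_normK ?num_real// expr_le1.
by rewrite (mulr2n (1 - _)); set y := sin _; lra.
Qed.

Lemma sin_pi_ge s t : 0 <= s -> s <= t -> t <= 1 - s -> sin (pi * s) <= sin (pi * t).
Proof.
move=> s0 st ts; rewrite -!cosBpihalf -(cos_norm (pi * s - _)) -(cos_norm (pi * t - _)).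
have pi0 := pi_gt0 R.
have h1 := ler_wpM2l (ltW pi0) st; have h2 := ler_wpM2l (ltW pi0) ts.
have h0 : 0 <= pi * s by rewrite mulr_ge0// ltW.
have a : `|pi * s - pi / 2| = pi / 2 - pi * s.
  by rewrite ler0_norm ?opprB//; lra.
have b : `|pi * t - pi / 2| <= pi / 2 - pi * s.
  by rewrite ler_norml; apply/andP; split; lra.
rewrite a; have [->//|ne] := eqVneq (`|pi * t - pi / 2|) (pi / 2 - pi * s).
apply/ltW; rewrite ltr_cos ?in_itv/=; last 2 first.
- by rewrite normr_ge0/= (le_trans b)//; lra.
- by apply/andP; split; lra.
by rewrite lt_neqAle ne.
Qed.

End real_estimates.

Section halfspace.
Context {R : realType} {d : nat}.
Local Notation C := R[i].
Local Notation tpoly := (trig_poly predT).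
Variable M : mean R 'rV[R]_d.
Hypothesis Mb : forall f : 'rV[R]_d -> R, bounded_real f -> mdom M f.
Hypothesis Mchi : forall k : {ffun 'I_d -> int}, k != 0 -> cmean M (chi k) = 0.
Hypothesis Mcube : forall f g : 'rV[R]_d -> R, (forall v, unit_cube v -> f v = g v) ->
  M f = M g.

Definition axis_freq (i : 'I_d) (a : int) : {ffun 'I_d -> int} :=
  [ffun j => if j == i then a else 0].

Lemma chi_axis i a (v : 'rV[R]_d) : chi (axis_freq i a) v = cexp2pi (a%:~R * v ord0 i).
Proof.
rewrite /chi (bigD1 i)//= ffunE eqxx big1 ?addr0// => j ji.
by rewrite ffunE (negbTE ji) mul0r.
Qed.

Lemma bounded_chi k : bounded_complex (@chi R d k).
Proof. by exists 1 => v; rewrite nsq_chi. Qed.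

(** On the arc of radius 1 / (2 pi m) around [c] the [m] terms add up to at least
    m / 2 in modulus, while the mean of the squared modulus is [m] because distinct
    characters are orthogonal. So 4 |arc_sum|^2 / m^2 dominates the indicator of
    the arc and has mean 4 / m. *)
Definition arc_sum i (c : R) m (v : 'rV[R]_d) : C :=
  \sum_(a < m) cexp2pi (- (a%:R * c)) * chi (axis_freq i a) v.

Lemma arc_sumE i c m v :
  arc_sum i c m v = \sum_(a < m) cexp2pi (a%:R * (v ord0 i - c)).
Proof.
apply: eq_bigr => a _; rewrite chi_axis -cexp2piD; congr cexp2pi.
by rewrite mulrBr addrC.
Qed.

Lemma mean_arc_sum i c m : M (fun v => nsq (arc_sum i c m v)) = m%:R.
Proof.
rewrite (@mean_parseval _ _ M m (fun a => chi (axis_freq i a))).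
- rewrite (eq_bigr (fun=> 1)) => [|a _]; last exact: nsq_cexp2pi.
  by rewrite sumr_const card_ord.
- by move=> a; apply: bounded_complex_cdom => //; exact: bounded_chi.
move=> a b; have [->|ab] := eqVneq a b.
  rewrite -(cmean_cst M 1); congr cmean; apply/funext => v.
  exact: cexp2pi_conjK.
transitivity (cmean M (chi (axis_freq i (a%:Z - b%:Z)))).
  congr cmean; apply/funext => v; rewrite !chi_axis -cexp2piN -cexp2piD; congr cexp2pi.
  by rewrite intrB mulrBl.
rewrite Mchi//; apply: contraNneq ab => /ffunP/(_ i); rewrite !ffunE eqxx => /eqP.
by rewrite subr_eq0 eqz_nat.
Qed.

Lemma nsq_arc_sum_ge i c m (v : 'rV[R]_d) : (0 < m)%N -> `|v ord0 i - c| <= (2 * pi * m%:R)^-1 ->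
  (m%:R / 2) ^+ 2 <= nsq (arc_sum i c m v).
Proof.
move=> m0 vc; rewrite arc_sumE.
have pm : 0 < 2 * pi * m%:R :> R by rewrite !mulr_gt0 ?pi_gt0 ?ltr0n.
apply: le_trans (Re_sqr_le_nsq _).
have ReS (F : 'I_m -> C) : complex.Re (\sum_a F a) = \sum_a complex.Re (F a).
  by apply: (big_morph _ (@ReE_add R)).
have half : m%:R / 2 <= complex.Re (\sum_(a < m) cexp2pi (a%:R * (v ord0 i - c))).
  rewrite ReS; apply: (@le_trans _ _ (\sum_(a < m) (1 / 2 : R))).
    by rewrite sumr_const card_ord -[X in _ <= X]mulr_natl mulrA mulr1.
  apply: ler_sum => a _ /=; apply: cos_ge_half.
  rewrite !normrM normr_nat (gtr0_norm (pi_gt0 R)) normr_nat.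
  apply: (@le_trans _ _ (2 * pi * m%:R * (2 * pi * m%:R)^-1)); last by rewrite divff// gt_eqF.
  rewrite -[X in _ <= X]mulrA ler_wpM2l ?mulr_ge0 ?pi_ge0// ler_pM//.
  by rewrite ler_nat ltnW.
by rewrite lerXn2r ?nnegrE// ?(le_trans _ half)// divr_ge0.
Qed.

(** In the coordinate t, on [0, 1], this takes the value 1/2 at 0, b and 1 only. Each sine changes sign
    under t |-> t + 1, so the product has period 1 and is a trigonometric
    polynomial of frequencies -1, 0, 1. *)
Let wave i b (v : 'rV[R]_d) : R :=
  (1 + sin (pi * v ord0 i) * sin (pi * (v ord0 i - b))) / 2.

Let trig_wave i b : tpoly (fun v => (wave i b v)%:C).
Proof.
pose E (v : 'rV[R]_d) : C := cexp2pi (- (b / 2)) * chi (axis_freq i 1) v.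
have tE : tpoly E by exact: trig_poly_mono.
have -> : (fun v => (wave i b v)%:C) =
    (fun v => (1 / 2 + cos (pi * b) / 4)%:C - (1 / 8)%:C * (E v + (E v)^*)).
  apply/funext => v; rewrite /E chi_axis -cexp2piD [1%:~R * _]mul1r.
  have -> : cexp2pi (- (b / 2) + v ord0 i) + (cexp2pi (- (b / 2) + v ord0 i))^* =
      (2 * cos (pi * v ord0 i + pi * (v ord0 i - b)))%:C :> C.
    apply: complex_ext; rewrite /cexp2pi/conjc/=; last by rewrite subrr.
    have -> : pi * v ord0 i + pi * (v ord0 i - b) = 2 * pi * (- (b / 2) + v ord0 i).
      by field.
    by set c := cos _; ring.
  apply: complex_ext => /=; last by rewrite !mulr0 mul0r addr0 subr0.
  rewrite /wave mul0r subr0.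
  have -> : cos (pi * b) = cos (pi * v ord0 i - pi * (v ord0 i - b)).
    by congr cos; ring.
  by rewrite cosB cosD; field.
apply: trig_polyB; first exact: trig_poly_cst.
by apply: trig_polyZ; apply: trig_polyD => //; exact: trig_poly_conj.
Qed.

Let wave01 i b v : 0 <= wave i b v <= 1.
Proof.
have : `|sin (pi * v ord0 i) * sin (pi * (v ord0 i - b))| <= 1.
  by rewrite normrM mulr_ile1 ?sin_max.
by rewrite /wave ler_norml => /andP[? ?]; apply/andP; split; lra.
Qed.

(** The approximant is threshold_poly applied to wave. Away from 0, b and 1 the
    wave stays at a positive distance from 1/2, on the right side, and the error
    is uniformly small. Around these points it is at most 1, and three arcs are
    small in mean. The arcs at 0 and 1 are unavoidable, since the half-space is not
    periodic. *)
Lemma approximable_halfspace i (b : R) : 0 < b < 1 ->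
  approximable M (fun v => (v ord0 i < b)%R%:R).
Proof.
move=> /andP[b0 b1]; split.
  by exists 1 => v; case: (_ < _); rewrite ?nsq0// -[1]/(1%:C) nsq_real expr1n.
move=> e e0.
pose m := (Num.truncn (24 / e)).+1.
have m0 : (0 < m)%N by [].
have mR : 0 < m%:R :> R by rewrite ltr0n.
have me : 12 / m%:R <= e / 2.
  rewrite ler_pdivrMr//; have := ltW (truncnS_gt (24 / e)).
  rewrite -/m ler_pdivrMr//; lra.
(* radius of the arcs; A below dominates their indicators, with mean 4 / m *)
pose eta : R := (2 * pi * m%:R)^-1.
have pm : 4 <= 2 * pi * m%:R :> R.
  have := pi_ge2 R; have : 1 <= m%:R :> R by rewrite ler1n.
  by move=> *; nra.
have eta0 : 0 < eta by rewrite invr_gt0; lra.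
have eta4 : eta <= 1 / 4.
  by rewrite mul1r lef_pV2 ?posrE//; lra.
pose k := sin (pi * eta) ^+ 2.
have s0 : 0 < sin (pi * eta).
  rewrite sin_gt0_pi// mulr_gt0 ?pi_gt0//= gtr_pMr ?pi_gt0//; lra.
have k0 : 0 < k by rewrite exprn_gt0.
have k1 : k <= 1 by apply: exprn_ile1; [exact: ltW|exact: sin_le1].
pose n := (Num.truncn (2 / (e * k))).+1.
(* bound of the error away from the arcs, small by the choice of n *)
pose rho : R := (1 + n%:R * k)^-1.
have nk0 : 0 <= n%:R * k by rewrite mulr_ge0// ltW.
have rho0 : 0 <= rho by rewrite invr_ge0; lra.
have rho1 : rho <= 1 by rewrite invf_le1; lra.
have rhoe : rho <= e / 2.
  rewrite -[X in X <= _]mul1r ler_pdivrMr; last lra.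
  have := ltW (truncnS_gt (2 / (e * k))); rewrite -/n ler_pdivrMr ?mulr_gt0//.
  have -> : n%:R * (e * k) = e * (n%:R * k) by ring.
  by move=> h; rewrite mulrDr; lra.
exists (fun v => (1 - (wave i b v)%:C ^+ n) ^+ (2 ^ n)); split.
  apply: trig_polyX; apply: trig_polyB; first exact: trig_poly_cst.
  exact: trig_polyX.
pose A c v := 4 / m%:R ^+ 2 * nsq (arc_sum i c m v).
have A0 c v : 0 <= A c v.
  by rewrite mulr_ge0 ?nsq_ge0// divr_ge0// exprn_ge0.
have Abig c (v : 'rV[R]_d) : `|v ord0 i - c| <= eta -> 1 <= A c v.
  move=> vc; have h := nsq_arc_sum_ge m0 vc.
  have c0 : 0 <= 4 / m%:R ^+ 2 :> R by rewrite divr_ge0// exprn_ge0.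
  apply: le_trans (ler_wpM2l c0 h).
  by rewrite le_eqVlt; apply/orP; left; apply/eqP; field; rewrite gt_eqF.
have bA c : bounded_real (A c).
  have [B hB] : bounded_complex (arc_sum i c m).
    apply: bounded_complex_sum => a; apply: bounded_complexM.
      exact: bounded_complex_cst.
    exact: bounded_chi.
  exists (4 / m%:R ^+ 2 * B) => v; rewrite ger0_norm//.
  by apply: ler_wpM2l; [rewrite divr_ge0// exprn_ge0|exact: hB].
have MA c : M (A c) = 4 / m%:R.
  rewrite mvalZ ?mean_arc_sum; last first.
    apply: mdom_nsq; apply: bounded_complex_cdom => //.
    apply: bounded_complex_sum => a; apply: bounded_complexM.
      exact: bounded_complex_cst.
    exact: bounded_chi.
  by field; rewrite gt_eqF.
have qE v : (1 - (wave i b v)%:C ^+ n) ^+ (2 ^ n) = (threshold_poly n (wave i b v))%:C.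
  by rewrite /threshold_poly rmorphXn rmorphB rmorphXn.
have diffE (v : 'rV[R]_d) : nsq ((v ord0 i < b)%R%:R - (1 - (wave i b v)%:C ^+ n) ^+ (2 ^ n)) =
    ((v ord0 i < b)%R%:R - threshold_poly n (wave i b v)) ^+ 2.
  by rewrite qE -(rmorph_nat (real_complex R)) -rmorphB nsq_real.
have dM : mdom M (fun v => rho + (A 0 v + (A b v + A 1 v))).
  by apply: mdomD; [exact: mdom_cst|do ?[apply: mdomD]; exact: Mb].
apply: (@le_trans _ _ (M (fun v => rho + (A 0 v + (A b v + A 1 v))))); last first.
  rewrite mvalD; [|exact: mdom_cst|by do ?[apply: mdomD]; exact: Mb].
  rewrite mvalD; [|exact: Mb|by apply: mdomD; exact: Mb].
  rewrite mvalD; [|exact: Mb|exact: Mb].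
  by rewrite mval_cst !MA; lra.
apply: (mean_cube_le Mb Mcube).
- exists 1 => v; rewrite diffE ger0_norm ?sqr_ge0//.
  exact/sqr_boolB_le1/threshold_poly01.
- apply: bounded_realD; first by exists `|rho|.
  by apply: bounded_realD => //; exact: bounded_realD.
move=> v cv; have := cv i; rewrite in_itv/= => /andP[t0 t1].
rewrite diffE; have /andP[q0 q1] := threshold_poly01 n (wave01 i b v).
have /andP[u0 u1] := wave01 i b v.
have A00 := A0 0 v; have Ab0 := A0 b v; have A10 := A0 1 v.
have le1 : ((v ord0 i < b)%R%:R - threshold_poly n (wave i b v)) ^+ 2 <= 1.
  exact/sqr_boolB_le1/threshold_poly01.
have [/Abig h|g0] := leP `|v ord0 i - 0| eta; first lra.
have [/Abig h|gb] := leP `|v ord0 i - b| eta; first lra.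
have [/Abig h|g1] := leP `|v ord0 i - 1| eta; first lra.
suff : ((v ord0 i < b)%R%:R - threshold_poly n (wave i b v)) ^+ 2 <= rho by lra.
have rho2 : rho ^+ 2 <= rho by rewrite expr2 ler_piMl.
apply: le_trans rho2.
set t := v ord0 i in t0 t1 g0 gb g1 *.
rewrite subr0 ger0_norm// in g0.
rewrite ler0_norm ?subr_le0// in g1.
have st : sin (pi * eta) <= sin (pi * t) by apply: sin_pi_ge; lra.
have k01 : 0 <= k <= 1 by rewrite ltW.
have [tb|bt] := ltP t b.
  rewrite ltr0_norm ?subr_lt0// in gb.
  have sb : sin (pi * eta) <= sin (pi * (b - t)) by apply: sin_pi_ge; lra.
  have hu : 2 * wave i b v <= 1 - k.
    rewrite /wave -/t -(opprB b t) mulrN sinN /k expr2.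
    have : sin (pi * eta) * sin (pi * eta) <= sin (pi * t) * sin (pi * (b - t)).
      by rewrite ler_pM// ltW.
    lra.
  have := threshold_poly_low n k01 u0 hu; rewrite -/rho => h.
  by rewrite -[true%:R]/(1 : R) ler_sqr ?nnegrE//; lra.
rewrite ger0_norm ?subr_ge0// in gb.
have sb : sin (pi * eta) <= sin (pi * (t - b)) by apply: sin_pi_ge; lra.
have hu : 1 + k <= 2 * wave i b v.
  rewrite /wave -/t /k expr2.
  have : sin (pi * eta) * sin (pi * eta) <= sin (pi * t) * sin (pi * (t - b)).
    by rewrite ler_pM// ltW.
  lra.
have := threshold_poly_high n (ltW k0) u1 hu; rewrite -/rho => h.
by rewrite -[false%:R]/(0 : R) sub0r sqrrN ler_sqr ?nnegrE.
Qed.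

End halfspace.

(** * Uniform continuity and grids on the cube *)

Section continuous_on_cube.
Context {R : realType} {d : nat}.
Local Notation C := R[i].

Lemma compact_cube : compact (@unit_cube R d).
Proof.
rewrite (_ : unit_cube = [set v : 'rV[R]_d | forall i, `[0, 1]%classic (v ord0 i)])//.
by apply: (@rV_compact R d (fun=> `[0, 1]%classic)) => i; exact: segment_compact.
Qed.

Let continuous_cube_ball (f : 'rV[R]_d -> C^o) w (e : R) :
  {within unit_cube, continuous f} -> unit_cube w -> 0 < e ->
  exists2 r : R, 0 < r & forall x, unit_cube x ->
    (forall i, `|w ord0 i - x ord0 i| < r) -> nsq (f w - f x) <= e.
Proof.
move=> /subspace_continuousP cf cw e0.
have se0 : 0 < (Num.sqrt e)%:C :> C by rewrite ltcR sqrtr_gt0.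
have : nbhs w [set x | unit_cube x -> `|f w - f x| < (Num.sqrt e)%:C :> C].
  have := @cvgr_dist_lt _ _ _ _ _ _ _ (cf w cw) _ se0; rewrite near_withinE => h; exact: h.
move=> /nbhs_ballP [r /= r0 wr].
exists r => // x cx wx.
have /wr/(_ cx) : ball w r x.
  by split=> // i j; rewrite (ord1 i); exact: wx.
rewrite normc_def ltcR => h.
have h0 : 0 <= nsq (f w - f x) by exact: nsq_ge0.
rewrite -(sqr_sqrtr h0) -(sqr_sqrtr (ltW e0)) ler_sqr ?nnegrE ?sqrtr_ge0//.
exact: ltW.
Qed.

(** Otherwise there are pairs of points at distance at most 1/m with distant values;
    along an ultrafilter both members of the pair tend to the same point of the
    compact cube, which contradicts continuity there. *)
Lemma cube_uniform_continuous (f : 'rV[R]_d -> C^o) (e : R) :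
  {within unit_cube, continuous f} -> 0 < e ->
  exists m : nat, forall u v, unit_cube u -> unit_cube v ->
    (forall i, `|u ord0 i - v ord0 i| <= m.+1%:R^-1) -> nsq (f u - f v) <= e.
Proof.
move=> cf e0; apply: contrapT => /forallNP H.
have Hm m : exists uv : 'rV[R]_d * 'rV[R]_d, [/\ unit_cube uv.1, unit_cube uv.2,
    (forall i, `|uv.1 ord0 i - uv.2 ord0 i| <= m.+1%:R^-1) & e < nsq (f uv.1 - f uv.2)].
  apply: contrapT => N; apply: (H m) => u v cu cv uv.
  by rewrite leNgt; apply/negP => lt; apply: N; exists (u, v).
have [s sP] := choice Hm.
have [U [UU ooU]] := @ultraFilterLemma nat (\oo : set_system nat) _.
have := compact_cube; rewrite compact_ultra.
move=> /(_ ((fun m => (s m).1) @ U) (fmap_ultra UU _)) [|w [cw sw]].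
  by apply: nearW => m /=; have [] := sP m.
have e5 : 0 < e / 5 by rewrite divr_gt0.
have [r r0 wr] := continuous_cube_ball cf cw e5.
have r2 : 0 < r / 2 by rewrite divr_gt0.
have near1 : U [set m | ball w (r / 2) (s m).1] by apply: sw; exact: nbhsx_ballx.
have near2 : U [set m : nat | m.+1%:R^-1 < r / 2].
  by apply: ooU; exact: near_infty_natSinv_lt (PosNum r2).
have [m [[_ wu] mr]] := filter_ex (filterI near1 near2).
have [cu cv uv euv] := sP m.
have h1 := wr (s m).1 cu; have h2 := wr (s m).2 cv.
have {}wu i : `|w ord0 i - (s m).1 ord0 i| < r / 2 by exact: wu.
have n1 : nsq (f w - f (s m).1) <= e / 5.
  by apply: h1 => i; apply: lt_trans (wu i) _; lra.
have n2 : nsq (f w - f (s m).2) <= e / 5.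
  apply: h2 => i; have := uv i; have := wu i; move: mr => /= mr a b.
  have -> : w ord0 i - (s m).2 ord0 i =
    (w ord0 i - (s m).1 ord0 i) + ((s m).1 ord0 i - (s m).2 ord0 i) by ring.
  rewrite (le_lt_trans (ler_normD _ _))// [X in _ < X](splitr r) ltrD//; exact: le_lt_trans b mr.
have : nsq (f (s m).1 - f (s m).2) <= 2 * (e / 5) + 2 * (e / 5).
  have -> : f (s m).1 - f (s m).2 = - (f w - f (s m).1) + (f w - f (s m).2) by ring.
  apply: le_trans (nsqD_le _ _) _; rewrite nsqN; lra.
lra.
Qed.

End continuous_on_cube.

Section grid.
Context {R : realType} {d : nat}.
Local Notation C := R[i].
Variable m' : nat.
Local Notation m := m'.+1.
Implicit Types (J : {ffun 'I_d -> 'I_m}) (v : 'rV[R]_d).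

Definition corner J : 'rV[R]_d := \row_i ((J i)%:R / m%:R).

(** The last interval is closed, so that the cells partition the closed cube. *)
Definition cell_interval (j : 'I_m) : interval R :=
  if j == ord_max then `[j%:R / m%:R, 1] else `[j%:R / m%:R, j.+1%:R / m%:R[.

Definition cell J : set 'rV[R]_d := box (fun i => cell_interval (J i)).

(** The minimum puts t = 1 into the last interval. *)
Definition cell_of (t : R) : 'I_m := inord (minn (Num.truncn (m%:R * t)) m').

Let mR : 0 < m%:R :> R. Proof. by rewrite ltr0n. Qed.

Lemma mem_cell_interval t (j : 'I_m) : 0 <= t <= 1 ->
  (t \in cell_interval j) = (j == cell_of t).
Proof.
move=> /andP[t0 t1].
have mt0 : 0 <= m%:R * t by rewrite mulr_ge0.
have -> : (j == cell_of t) = (j == minn (Num.truncn (m%:R * t)) m' :> nat).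
  by rewrite -(inj_eq val_inj) /cell_of /= inordK// ltnS geq_minr.
rewrite /cell_interval; case: eqVneq => [->|jm].
  rewrite in_itv/= t1 andbT ler_pdivrMr// mulrC -truncn_ge_nat//.
  by rewrite eq_sym; apply/idP/eqP => [/minn_idPr|/minn_idPr].
have jm' : (j < m')%N.
  by rewrite ltn_neqAle -ltnS ltn_ord andbT; apply: contra_neq jm => h; exact: val_inj.
rewrite in_itv/= ler_pdivrMr// ltr_pdivlMr// [t * _]mulrC -truncn_eq//.
apply/eqP/eqP => [->|jE]; first by rewrite (minn_idPl (ltnW jm')).
move: jm'; rewrite jE gtn_min ltnn orbF => h; by rewrite (minn_idPl (ltnW h)).
Qed.

Lemma cell_of_near t : 0 <= t <= 1 -> `|t - (cell_of t)%:R / m%:R| <= m%:R^-1.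
Proof.
move=> t01; have := mem_cell_interval (cell_of t) t01; rewrite eqxx.
have /andP[t0 t1] := t01.
rewrite /cell_interval; case: eqVneq => [->|_]; rewrite in_itv/= => /andP[a b].
  rewrite ger0_norm ?subr_ge0// lerBlDr (le_trans t1)//.
  by rewrite -[X in X + _]mul1r -mulrDl -natr1 addrC divff// gt_eqF.
rewrite ger0_norm ?subr_ge0// lerBlDr (le_trans (ltW b))//.
by rewrite -[X in X + _]mul1r -mulrDl -natr1 addrC.
Qed.

Lemma corner_cube J : unit_cube (corner J).
Proof.
move=> i; rewrite in_itv/= mxE divr_ge0//= ler_pdivrMr// mul1r ler_nat ltnW//.
Qed.

Definition cell_index v : {ffun 'I_d -> 'I_m} := [ffun i => cell_of (v ord0 i)].

Lemma cell_index_near v : unit_cube v ->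
  forall i, `|v ord0 i - corner (cell_index v) ord0 i| <= m%:R^-1.
Proof.
move=> cv i; rewrite mxE ffunE; apply: cell_of_near.
by have := cv i; rewrite in_itv.
Qed.

Lemma mem_cell v J : unit_cube v -> (v \in cell J) = (J == cell_index v).
Proof.
move=> cv.
have mi i : (v ord0 i \in cell_interval (J i)) = (J i == cell_of (v ord0 i)).
  by apply: mem_cell_interval; have := cv i; rewrite in_itv.
apply/idP/eqP => [|->]; last first.
  by rewrite inE => i; rewrite mem_cell_interval ?ffunE//; have := cv i; rewrite in_itv.
rewrite inE => H; apply/ffunP => i; rewrite ffunE; apply/eqP.
by rewrite -mi; exact: H.
Qed.

Lemma cell_volume J : lebesgue_rV R d (cell J) = (m%:R ^- d)%:E.
Proof.
rewrite (@lebesgue_rV_box _ _ _ (fun=> m%:R^-1)).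
  by rewrite prodr_const card_ord exprVn.
move=> i; rewrite /cell_interval; case: eqVneq => [->|_].
  rewrite lebesgue_measure_itv/= lte_fin ltr_pdivrMr// mul1r ltr_nat ltnSn.
  rewrite -EFinB; congr EFin; rewrite -natr1; field.
  by rewrite natr1 gt_eqF.
rewrite lebesgue_measure_itv/= lte_fin ltr_pM2r ?invr_gt0// ltr_nat ltnSn.
rewrite -EFinB -mulrBl; congr EFin.
by rewrite -natrB// subSnn mul1r.
Qed.

Lemma cell_sub J : cell J `<=` unit_cube.
Proof.
move=> v Jv i; have := Jv i; rewrite /cell_interval in_itv/=.
have j0 : 0 <= (J i)%:R / m%:R :> R by rewrite divr_ge0.
case: eqVneq => _; rewrite in_itv/= => /andP[a b]; rewrite (le_trans j0 a)//=.
rewrite (le_trans (ltW b))// ler_pdivrMr// mul1r ler_nat.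
by [].
Qed.

End grid.

(** * Continuous functions and grid averages *)

Section approximable_continuous.
Context {R : realType} {d : nat}.
Local Notation C := R[i].
Variable M : mean R 'rV[R]_d.
Hypothesis Mb : forall f : 'rV[R]_d -> R, bounded_real f -> mdom M f.
Hypothesis Mchi : forall k : {ffun 'I_d -> int}, k != 0 -> cmean M (chi k) = 0.
Hypothesis Mcube : forall f g : 'rV[R]_d -> R, (forall v, unit_cube v -> f v = g v) ->
  M f = M g.

(** Differences of consecutive functions of this family are indicators of cells, on
    the cube. The extreme ones are constants because half-spaces bounded by the
    faces of the cube are outside the range of approximable_halfspace. *)
Let threshold m' (l : nat) (i : 'I_d) (v : 'rV[R]_d) : C :=
  if l == 0%N then 0 else if l == m'.+1 then 1
  else ((v ord0 i < l%:R / m'.+1%:R)%R)%:R.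

Let cell_indic m' (j : 'I_m'.+1) i v : C := threshold m' j.+1 i v - threshold m' j i v.

Let approximable_threshold m' l i : (l <= m'.+1)%N -> approximable M (threshold m' l i).
Proof.
move=> lm; rewrite /threshold; case: eqVneq => [_|l0]; first exact: approximable_cst.
case: eqVneq => [_|lm']; first exact: approximable_cst.
apply: approximable_halfspace => //.
rewrite divr_gt0 ?ltr0n ?lt0n//= ltr_pdivrMr ?ltr0n// mul1r ltr_nat.
by rewrite ltn_neqAle lm'.
Qed.

Let cell_indicE m' (j : 'I_m'.+1) i v : unit_cube v ->
  cell_indic j i v = (v ord0 i \in cell_interval j)%:R.
Proof.
move=> /(_ i); rewrite in_itv/= => /andP[t0 t1].
have j0 : 0 <= j%:R / m'.+1%:R :> R by rewrite divr_ge0.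
have jj : j%:R / m'.+1%:R < j.+1%:R / m'.+1%:R :> R.
  by rewrite ltr_pM2r ?invr_gt0 ?ltr0n// ltr_nat.
rewrite /cell_indic /threshold /cell_interval /= eqSS (ltn_eqF (ltn_ord j)).
have -> : (j == m' :> nat) = (j == ord_max) by rewrite -(inj_eq val_inj).
have low : (if j == 0%N :> nat then 0 else ((v ord0 i < j%:R / m'.+1%:R)%R)%:R : C) =
    ((v ord0 i < j%:R / m'.+1%:R)%R)%:R.
  by case: eqP => // ->; rewrite mul0r ltNge t0.
rewrite low; case: eqVneq => _; rewrite in_itv/=.
  by rewrite t1 andbT leNgt; case: (_ < _); rewrite ?subr0 ?subrr.
have [tj|jt] := ltP (v ord0 i) (j%:R / m'.+1%:R).
  by rewrite (lt_trans tj jj) subrr.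
by rewrite subr0.
Qed.

Let step m' (f : 'rV[R]_d -> C) v : C :=
  \sum_(J : {ffun 'I_d -> 'I_m'.+1}) f (corner J) * \prod_i cell_indic (J i) i v.

Let stepE m' f v : unit_cube v -> step m' f v = f (corner (cell_index m' v)).
Proof.
move=> cv; rewrite /step (bigD1 (cell_index m' v))//= [X in _ + X]big1 => [|J JI].
  rewrite addr0 big1 ?mulr1// => i _; rewrite cell_indicE//.
  by rewrite mem_cell_interval ?ffunE ?eqxx//; have := cv i; rewrite in_itv.
have [i iJ] : exists i, J i != cell_index m' v i.
  apply/existsP; rewrite -negb_forall; apply: contra JI => /forallP H.
  by apply/eqP/ffunP => i; apply/eqP.
rewrite (bigD1 i)//= cell_indicE// mem_cell_interval; last by have := cv i; rewrite in_itv.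
by move: iJ; rewrite ffunE => /negbTE ->; rewrite mul0r mulr0.
Qed.

(** A function continuous on the cube is arbitrary elsewhere; truncation makes it
    bounded everywhere. *)
Definition cube_restrict (f : 'rV[R]_d -> C) v := if `[< unit_cube v >] then f v else 0.

Lemma cube_restrictE (f : 'rV[R]_d -> C) v :
  unit_cube v -> cube_restrict f v = f v.
Proof. by move=> cv; rewrite /cube_restrict; case: asboolP. Qed.

Lemma bounded_cube_restrict (f : 'rV[R]_d -> C^o) :
  {within unit_cube, continuous f} -> bounded_complex (cube_restrict f).
Proof.
move=> cf; have [m' H] := cube_uniform_continuous cf ltr01.
exists (2 + 2 * \sum_(J : {ffun 'I_d -> 'I_m'.+1}) nsq (f (corner J))) => v.
have S0 : 0 <= \sum_(J : {ffun 'I_d -> 'I_m'.+1}) nsq (f (corner J)).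
  by apply: sumr_ge0 => J _; exact: nsq_ge0.
rewrite /cube_restrict; case: asboolP => cv; last by rewrite nsq0; lra.
have := H v (corner (cell_index m' v)) cv (@corner_cube _ _ _ _) (cell_index_near m' cv).
set c := corner _ => fvc.
have -> : f v = (f v - f c) + f c by rewrite subrK.
apply: le_trans (nsqD_le _ _) _.
suff : nsq (f c) <= \sum_(J : {ffun 'I_d -> 'I_m'.+1}) nsq (f (corner J)) by lra.
by rewrite /c (bigD1 (cell_index m' v))//= lerDl sumr_ge0// => J _; exact: nsq_ge0.
Qed.

(** A continuous function is uniformly close to a step function on cells, whose
    indicators are products of differences of indicators of half-spaces. *)
Lemma approximable_continuous (f : 'rV[R]_d -> C^o) :
  {within unit_cube, continuous f} -> approximable M (cube_restrict f).
Proof.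
move=> cf; apply: approximable_uniform => //; first exact: bounded_cube_restrict.
move=> e e0; have [m' H] := cube_uniform_continuous cf e0.
exists (step m' f); split.
  apply: approximable_sum => // J; apply: approximableM => //; first exact: approximable_cst.
  apply: approximable_prod => // i; apply: approximableB => //.
    exact: approximable_threshold.
  by apply: approximable_threshold; exact: ltnW.
move=> v cv; rewrite stepE// /cube_restrict; case: asboolP => // _.
by apply: H => //; [exact: corner_cube|exact: cell_index_near].
Qed.

End approximable_continuous.

Section grid_average.
Context {R : realType} {d : nat}.
Local Notation C := R[i].
Local Notation mu := (lebesgue_rV R d).

Definition grid m' : seq 'rV[R]_d := [seq corner J | J : {ffun 'I_d -> 'I_m'.+1}].

Lemma size_grid m' : size (grid m') = (m'.+1 ^ d)%N.
Proof. by rewrite size_image card_ffun !card_ord. Qed.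

Lemma grid_gt0 m' : (0 < size (grid m'))%N.
Proof. by rewrite size_grid expn_gt0. Qed.

Lemma average_grid m' (g : 'rV[R]_d -> R) : average (grid m') g =
  m'.+1%:R ^- d * \sum_(J : {ffun 'I_d -> 'I_m'.+1}) g (corner J).
Proof. by rewrite /average size_grid natrX /grid big_image. Qed.

Section riemann.
Local Notation cellR := (@cell R d _).
Variable g : 'rV[R]_d -> R.
Hypothesis unif_g : forall e : R, 0 < e -> exists m : nat, forall u v,
  unit_cube u -> unit_cube v ->
  (forall i, `|u ord0 i - v ord0 i| <= m.+1%:R^-1) -> `|g u - g v| <= e.

Let step m' v : R :=
  \sum_(J : {ffun 'I_d -> 'I_m'.+1}) g (corner J) * \1_(cellR J) v.

Let stepE m' v : unit_cube v -> step m' v = g (corner (cell_index m' v)).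
Proof.
move=> cv; rewrite /step (bigD1 (cell_index m' v))//= [X in _ + X]big1 => [|J JI].
  by rewrite indicE mem_cell// eqxx mulr1 addr0.
by rewrite indicE mem_cell// (negbTE JI) mulr0.
Qed.

Let mcube : measurable (@unit_cube R d).
Proof. exact: measurable_box. Qed.

Let cube1 : mu unit_cube = 1%E.
Proof.
rewrite (@lebesgue_rV_box _ _ _ (fun=> 1)) ?big1// => i.
by rewrite lebesgue_measure_itv/= lte_fin ltr01 oppr0 adde0.
Qed.

Let mcell m' (J : {ffun 'I_d -> 'I_m'.+1}) : measurable (cellR J).
Proof. exact: measurable_box. Qed.

Let int_cst (c : R) : mu.-integrable unit_cube (EFin \o (fun=> c)).
Proof.
apply/integrableP; split; first exact/measurable_EFinP/measurable_cst.
rewrite (integral_cst mu mcube) [X in (_ * X)%E](_ : _ = 1%E) ?mule1 ?ltry//.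
Qed.

Let int_indic m' (J : {ffun 'I_d -> 'I_m'.+1}) :
  mu.-integrable unit_cube (EFin \o \1_(cellR J)).
Proof.
apply: (le_integrable mcube _ _ (int_cst 1)).
  by apply/measurable_EFinP; exact: measurable_indic.
move=> v _; rewrite /= lee_fin normr1 ger0_norm ?indicE//.
by case: (_ \in _).
Qed.

Let int_cell m' (J : {ffun 'I_d -> 'I_m'.+1}) :
  mu.-integrable unit_cube (EFin \o (fun v => g (corner J) * \1_(cellR J) v)).
Proof.
exact: (integrableZl mcube (g (corner J)) (int_indic J)).
Qed.

Let int_step m' : mu.-integrable unit_cube (EFin \o step m').
Proof.
have -> : EFin \o step m' = (fun v => \sum_(J : {ffun 'I_d -> 'I_m'.+1})
    (g (corner J) * \1_(cellR J) v)%:E)%E.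
  by apply/funext => v; rewrite /step /= sumEFin.
by apply: integrable_sum => // J _; exact: int_cell.
Qed.

Let integral_step m' : \int[mu]_(v in unit_cube) step m' v = average (grid m') g.
Proof.
rewrite /Rintegral average_grid.
have -> : (\int[mu]_(v in unit_cube) (step m' v)%:E)%E =
    (\sum_(J : {ffun 'I_d -> 'I_m'.+1}) (g (corner J) * m'.+1%:R ^- d)%:E)%E.
  under eq_integral do rewrite /step -sumEFin.
  rewrite integral_sum//; last by move=> J; exact: int_cell.
  apply: eq_bigr => J _; under eq_integral do rewrite EFinM.
  rewrite integralZl//; last exact: int_indic.
  rewrite integral_indic// setIidl; last exact: cell_sub.
  by rewrite EFinM; congr mule; exact: cell_volume.
rewrite sumEFin /= mulr_sumr; apply: eq_bigr => J _.
by rewrite mulrC.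
Qed.

Let near_step (e : R) : 0 < e -> exists m0, forall m', (m0 <= m')%N ->
  forall v, unit_cube v -> `|g v - step m' v| <= e.
Proof.
move=> e0; have [m0 H] := unif_g e0; exists m0 => m' mm v cv; rewrite stepE//.
apply: H => //; first exact: corner_cube.
move=> i; apply: le_trans (cell_index_near m' cv i) _.
by rewrite lef_pV2 ?posrE ?ltr0n// ler_nat.
Qed.

Lemma measurable_uniform_cube : measurable_fun unit_cube g.
Proof.
apply: (measurable_fun_cvg (h := step)) => [m'|v cv].
  exact/measurable_EFinP/measurable_int/int_step.
apply/cvgrPdist_le => e e0; have [m0 H] := near_step e0.
by exists m0 => // m' /= mm; exact: H.
Qed.

Lemma integrable_uniform_cube : mu.-integrable unit_cube (EFin \o g).
Proof.
have [m0 H] := near_step ltr01.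
have dint : mu.-integrable unit_cube (EFin \o (fun v => g v - step m0 v)).
  apply: (le_integrable mcube _ _ (int_cst 1)).
  - apply/measurable_EFinP/measurable_funB; first exact: measurable_uniform_cube.
    exact/measurable_EFinP/measurable_int/int_step.
  - by move=> v cv; rewrite /= lee_fin normr1; exact: H.
have := integrableD mcube dint (int_step m0).
apply: eq_integrable => // v _.
by rewrite /= -EFinD subrK.
Qed.

(** The average over the grid is the integral of a step function uniformly close to
    [g]. *)
Lemma average_grid_cvg :
  average (grid m') g @[m' --> \oo] --> \int[mu]_(v in unit_cube) g v.
Proof.
apply/cvgrPdist_le => e e0; have [m0 H] := near_step e0.
exists m0 => // m' /= mm; rewrite -integral_step.
rewrite -(RintegralB mcube integrable_uniform_cube (int_step m')).
have dint : mu.-integrable unit_cube (EFin \o (fun v => g v - step m' v)).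
  exact: (integrableB mcube integrable_uniform_cube (int_step m')).
apply: le_trans (le_normr_Rintegral mcube dint) _.
have cint := int_cst e.
have nint : mu.-integrable unit_cube (EFin \o (fun v => `|g v - step m' v|)).
  exact: (integrable_norm dint).
apply: le_trans (le_Rintegral mcube nint cint (H m' mm)) _.
by rewrite Rintegral_cst// [X in fine X](_ : _ = 1%E) ?mulr1.
Qed.

End riemann.

Lemma grid_chi (k : {ffun 'I_d -> int}) m' : k != 0 -> (forall i, (`|k i| < m'.+1)%N) ->
  \sum_(J : {ffun 'I_d -> 'I_m'.+1}) chi k (corner J) = 0 :> C.
Proof.
move=> k0 km.
transitivity (\prod_i \sum_(j < m'.+1) cexp2pi ((k i)%:~R * (j%:R / m'.+1%:R)) : C).
  rewrite bigA_distr_bigA; apply: eq_bigr => J _.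
  rewrite /chi (big_morph _ (@cexp2piD R) (@cexp2pi0 R)).
  by apply: eq_bigr => i _; rewrite mxE.
have [i ki0] : exists i, k i != 0.
  apply/existsP; rewrite -negb_forall; apply: contra k0 => /forallP H.
  by apply/eqP/ffunP => i; rewrite ffunE; apply/eqP.
by rewrite (bigD1 i)//= sum_cexp2pi_grid ?mul0r.
Qed.

End grid_average.

(** * Square summable correlations force mean zero *)

Section van_der_corput.
Context {R : realType}.
Local Notation C := R[i].
Variable L : mean R nat.
Hypothesis Lb : forall f : nat -> R, bounded_real f -> mdom L f.
Hypothesis Lshift : forall f : nat -> R, bounded_real f -> L (fun n => f n.+1) = L f.

Lemma cmean_shift (u : nat -> C) a : bounded_complex u ->
  cmean L (fun n => u (n + a)%N) = cmean L u.
Proof.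
move=> bu; elim: a => [|a IH]; first by congr cmean; apply/funext => n; rewrite addn0.
rewrite -IH; have bua : bounded_complex (fun n => u (n + a)%N).
  exact: (bounded_complex_comp (addn^~ a) bu).
have [r j] := bounded_complex_parts bua.
apply: complex_ext => /=.
  by rewrite -(Lshift r); congr (L _); apply/funext => n; rewrite addnS.
by rewrite -(Lshift j); congr (L _); apply/funext => n; rewrite addnS.
Qed.

(** Van der Corput's argument. By invariance under shifts, [u] may be replaced by
    its average over H consecutive terms, whose quadratic mean is the Fejer mean at
    t = 0 divided by H; this tends to 0 as H grows. *)
Lemma cmean_eq0_of_corr_l2 (u : nat -> C) : bounded_complex u -> corr_l2 L u ->
  cmean L u = 0.
Proof.
move=> bu [B uB].
have B0 : 0 <= B by have := uB 0%N; rewrite big_ord0.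
suff : nsq (cmean L u) <= 0.
  case: (cmean L u) => a b; rewrite /nsq/= => h.
  have a0 : a ^+ 2 = 0 by have := sqr_ge0 a; have := sqr_ge0 b; lra.
  have b0 : b ^+ 2 = 0 by have := sqr_ge0 a; have := sqr_ge0 b; lra.
  by move/eqP: a0; move/eqP: b0; rewrite !sqrf_eq0 => /eqP -> /eqP ->.
apply/ler_addgt0Pr => e e0; rewrite add0r.
pose H := (Num.truncn (4 * B / e ^+ 2)).+1.
have HR : 0 < H%:R :> R by rewrite ltr0n.
have HB : 2 * B / (e * H%:R) <= e / 2.
  rewrite ler_pdivrMr ?mulr_gt0//.
  have := ltW (truncnS_gt (4 * B / e ^+ 2)); rewrite -/H ler_pdivrMr ?exprn_gt0//.
  have -> : e / 2 * (e * H%:R) = (H%:R * e ^+ 2) / 2 by ring.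
  by move=> h; lra.
have bw : bounded_complex (window u H 0).
  apply: bounded_complex_sum => a; apply: bounded_complexM.
    exact: (bounded_complex_comp (addn^~ a) bu).
  exact: bounded_complex_cst.
have cw : cmean L (fun n => (H%:R^-1)%:C * window u H 0 n) = cmean L u.
  rewrite cmeanZ; last exact: bounded_complex_cdom.
  rewrite /window cmean_sum => [|a]; last first.
    apply: bounded_complex_cdom => //; apply: bounded_complexM.
      exact: (bounded_complex_comp (addn^~ a) bu).
    exact: bounded_complex_cst.
  rewrite (eq_bigr (fun=> cmean L u)) => [|a _]; last first.
    rewrite -(cmean_shift a bu); congr cmean; apply/funext => n.
    by rewrite /expi mulr0 cexp2pi0 mulr1.
  rewrite sumr_const card_ord -(mulr_natl (cmean L u)) mulrA fmorphV rmorph_nat mulVf ?mul1r//.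
  by rewrite pnatr_eq0.
rewrite -cw; apply: le_trans (cmean_nsq_le _) _.
  apply: bounded_complex_cdom => //; apply: bounded_complexM => //.
  exact: bounded_complex_cst.
rewrite mean_nsqZ; last exact: bounded_complex_cdom.
rewrite nsq_real expr2 -mulrA -/(fejer L u H 0) (fejerE Lb Lshift)//.
rewrite ler_pdivrMl// /trig_sum.
rewrite (big_morph _ (@ReE_add R) (erefl : complex.Re (0 : C) = 0)).
apply: (@le_trans _ _ (\sum_(h < H) (e / 2 + 2 / e * nsq (corr L u h)))).
  apply: ler_sum => h _; rewrite /expi mulr0 cexp2pi0 mulr1.
  set w := (_ * _ : C).
  have ww : nsq w <= 4 * nsq (corr L u h).
    rewrite /w nsqM nsq_real; apply: le_trans (nsq_corr2 L u h).
    have /andP[t0 t1] := @triangle01 R H h.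
    by rewrite ler_piMl ?nsq_ge0// expr_le1.
  have amgm : complex.Re w <= e / 2 + complex.Re w ^+ 2 / (2 * e).
    have : 0 <= (complex.Re w - e) ^+ 2 / (2 * e).
      by rewrite divr_ge0 ?sqr_ge0// mulr_ge0// ltW.
    have -> : (complex.Re w - e) ^+ 2 / (2 * e) =
      complex.Re w ^+ 2 / (2 * e) - complex.Re w + e / 2 by field; rewrite gt_eqF.
    lra.
  apply: le_trans amgm _; rewrite lerD2l.
  have -> : 2 / e * nsq (corr L u h) = (4 * nsq (corr L u h)) / (2 * e).
    by field; rewrite gt_eqF.
  rewrite ler_pM2r ?invr_gt0 ?mulr_gt0//.
  exact: le_trans (Re_sqr_le_nsq w) ww.
rewrite big_split/= sumr_const card_ord -(mulr_natl (e / 2)) -mulr_sumr.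
have h2e : 0 <= 2 / e by rewrite divr_ge0// ltW.
apply: le_trans (_ : _ <= H%:R * (e / 2) + 2 / e * B) _.
  by rewrite lerD2l ler_wpM2l ?uB.
have := ler_wpM2l (ltW HR) HB.
have -> : H%:R * (2 * B / (e * H%:R)) = 2 / e * B.
  by field; rewrite !gt_eqF.
lra.
Qed.

End van_der_corput.

(** * The mean along a subsequence of averages *)

Section complex_limits.
Context {R : realType}.
Local Notation C := R[i].

Lemma cvg_Re_Im (a : nat -> C^o) (l : C^o) : a n @[n --> \oo] --> l ->
  (complex.Re (a n) @[n --> \oo] --> complex.Re l) /\
  (complex.Im (a n) @[n --> \oo] --> complex.Im l).
Proof.
move=> al.
have key (p : C -> R) : (forall z w, p (z - w) = p z - p w) ->
    (forall z, p z ^+ 2 <= nsq z) -> p (a n) @[n --> \oo] --> p l.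
  move=> pB pn; apply/cvgrPdist_lt => e e0.
  have e0' : 0 < e%:C :> C by rewrite ltcR.
  have [n0 _ H] := @cvgr_dist_lt _ _ nat (\oo : set_system nat) _ a l al _ e0'.
  exists n0 => // n /H; rewrite /= normc_def ltcR => h.
  apply: le_lt_trans h; rewrite -pB -sqrtr_sqr ler_wsqrtr//.
split; apply: key.
- by move=> [? ?] [? ?].
- exact: Re_sqr_le_nsq.
- by move=> [? ?] [? ?].
- by move=> z; rewrite /nsq lerDr sqr_ge0.
Qed.

End complex_limits.

Section sample_mean.
Context {R : realType}.
Local Notation C := R[i].
Variables (U : set_system nat) (UU : UltraFilter U) (Uoo : \oo `<=` U).
Variables (Nq : nat -> nat) (Nq0 : forall q, (0 < Nq q)%N).
Hypothesis Nq_inc : {homo Nq : p q / (p < q)%N}.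

Let samples q := index_iota 0 (Nq q).
Let samples_gt0 q : (0 < size (samples q))%N.
Proof. by rewrite size_iota subn0. Qed.

Definition sample_mean : mean R nat := ultramean UU samples_gt0.

Let averageE q (f : nat -> R) :
  average (samples q) f = (Nq q)%:R^-1 * \sum_(0 <= n < Nq q) f n.
Proof. by rewrite /average size_iota subn0. Qed.

Lemma index_ge q : (q <= Nq q)%N.
Proof.
by elim: q => // q IH; apply: leq_ltn_trans IH _; exact: Nq_inc.
Qed.

Lemma sample_mean_shift (f : nat -> R) : bounded_real f ->
  sample_mean (fun n => f n.+1) = sample_mean f.
Proof.
move=> bf; have [B fB] := bf.
have bf1 : bounded_real (fun n => f n.+1) by exists B.
apply/eqP; rewrite -subr_eq0 -mvalB//; apply/eqP.
apply: ulim_eq => //.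
have B0 : 0 <= B by apply: le_trans (fB 0%N); exact: normr_ge0.
apply/cvgrPdist_le => e e0; near=> q.
rewrite sub0r normrN averageE telescope_sumr// normrM normfV normr_nat.
rewrite ler_pdivrMl ?ltr0n//.
apply: (@le_trans _ _ (B + B)).
  by rewrite (le_trans (ler_normB _ _))// lerD.
rewrite -ler_pdivrMr//; apply: (@le_trans _ _ q%:R).
  by apply: ltW; near: q; exact: nbhs_infty_gtr.
by rewrite ler_nat index_ge.
Unshelve. all: by end_near. Qed.

Let avgC q (w : nat -> C) : C := ((Nq q)%:R^-1)%:C * \sum_(n < Nq q) w n.

Let Re_avgC q w : complex.Re (avgC q w) = average (samples q) (fun n => complex.Re (w n)).
Proof.
rewrite /avgC ReZ averageE big_mkord; congr (_ * _).
exact: (big_morph _ (@ReE_add R) (erefl : complex.Re (0 : C) = 0)).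
Qed.

Let Im_avgC q w : complex.Im (avgC q w) = average (samples q) (fun n => complex.Im (w n)).
Proof.
rewrite /avgC ImE_mul /= mul0r addr0 averageE big_mkord; congr (_ * _).
exact: (big_morph _ (@ImE_add R) (erefl : complex.Im (0 : C) = 0)).
Qed.

(** The ultrafilter refines convergence at infinity, so limits that exist are kept;
    permissibility provides them for the correlations. *)
Lemma corr_sample_mean (z : nat -> C^o) h l :
  (autocorrelation z h (Nq q) : C^o) @[q --> \oo] --> (l : C^o) ->
  corr sample_mean z h = l.
Proof.
move=> zl.
have E q : autocorrelation z h (Nq q) = avgC q (fun n => z (n + h)%N * (z n)^*).
  by rewrite /autocorrelation /avgC fmorphV rmorph_nat.
have [rl il] := cvg_Re_Im zl.
apply: complex_ext.
  apply: ulim_eq => //; move: rl; apply: cvg_trans; apply: near_eq_cvg.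
  by apply: nearW => q; rewrite E Re_avgC.
apply: ulim_eq => //; move: il; apply: cvg_trans; apply: near_eq_cvg.
by apply: nearW => q; rewrite E Im_avgC.
Qed.

Lemma nsq_sample_mean_le (w : nat -> C) (B : R) : bounded_complex w -> 0 <= B ->
  (\forall N \near \oo, ComplexField.Normc.normc
     ((N%:R^-1)%:C * \sum_(n < N) w n) <= B) ->
  nsq (cmean sample_mean w) <= B ^+ 2.
Proof.
move=> bw B0 wB.
have [br bi] := bounded_complex_parts bw.
have cr := ultramean_cvg UU samples_gt0 br.
have ci := ultramean_cvg UU samples_gt0 bi.
have cn : nsq (avgC q w) @[q --> U] --> nsq (cmean sample_mean w).
  rewrite /nsq; under eq_fun do rewrite Re_avgC Im_avgC !expr2.
  by rewrite !expr2; apply: cvgD; apply: cvgM.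
have -> : nsq (cmean sample_mean w) = lim (nsq (avgC q w) @[q --> U]).
  by apply/esym/cvg_lim.
apply: limr_le; first by apply/cvg_ex; eexists; exact: cn.
apply: Uoo; have [n0 _ H] := wB; exists n0 => // q /= nq.
have := H (Nq q) (leq_trans nq (index_ge q)); rewrite -/(avgC q w) => h.
rewrite -sqr_nc ler_sqr ?nnegrE//.
by rewrite nc_nsq sqrtr_ge0.
Qed.

End sample_mean.

(** * Correlations along a sequence with summable squared discrepancies *)

Section discrepancy_correlations.
Context {R : realType} {d : nat}.
Local Notation C := R[i].

Lemma upper_discrepancy_fin (z : nat -> 'rV[R]_d) :
  upper_discrepancy z \is a fin_num /\ 0 <= fine (upper_discrepancy z).
Proof.
have ge0 : (0 <= upper_discrepancy z)%E.
  by apply: limf_esup_ge0 => // N; rewrite lee_fin discrepancy_ge0.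
have le1 : (upper_discrepancy z <= 1)%E.
  apply: le_trans (ereal_inf_lbound _) _; first by exists setT => //; exact: filterT.
  apply: ge_ereal_sup => _ [N _ <-].
  by rewrite lee_fin discrepancy_le1.
split; last by rewrite fine_ge0.
by rewrite ge0_fin_numE// (le_lt_trans le1)// ltry.
Qed.

Lemma near_le_upper_discrepancy (z : nat -> 'rV[R]_d) (e : R) : 0 < e ->
  \forall N \near \oo, discrepancy z N <= fine (upper_discrepancy z) + e.
Proof.
move=> e0; have [Dfin _] := upper_discrepancy_fin z.
have [_ [A Aoo <-] lt] := lb_ereal_inf_adherent e0 Dfin.
apply: filterS Aoo => N AN.
rewrite -lee_fin EFinD fineK//; apply: le_trans (ltW lt).
by apply: ereal_sup_ubound; exists N.
Qed.

End discrepancy_correlations.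

Section sL.
Context {R : realType} {d : nat}.
Local Notation C := R[i].
Variable x : nat -> 'rV[R]_d.
Hypothesis x_cube : forall n, unit_cube (x n).
Hypothesis sum_disc : (\sum_(1 <= h <oo)
  (upper_discrepancy (fun n => sub_mod1 (x (n + h)%N) (x n)) ^+ 2) < +oo)%E.

Let y h n := sub_mod1 (x (n + h)%N) (x n).

Let y01 h n i : 0 <= y h n ord0 i < 1.
Proof.
rewrite /y /sub_mod1 mxE; set t := (_ - _ : 'rV[R]_d) _ _.
by have := floor_itv t; rewrite intrD => /andP[a b]; apply/andP; split; lra.
Qed.

Let delta h := fine (upper_discrepancy (y h)).

Let delta_sum : exists B, forall N, \sum_(1 <= h < N) delta h ^+ 2 <= B.
Proof.
have := sum_disc; set S := (\sum_(1 <= h <oo) _)%E => Sfin.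
have term h : (upper_discrepancy (y h) ^+ 2 = (delta h ^+ 2)%:E)%E.
  by rewrite /delta -[in LHS](fineK (upper_discrepancy_fin (y h)).1) EFin_expe.
have S0 : (0 <= S)%E.
  by apply: nneseries_ge0 => h _ _; rewrite term lee_fin sqr_ge0.
exists (fine S) => N; rewrite -lee_fin fineK; last by rewrite ge0_fin_numE.
rewrite -sumEFin; apply: le_trans (nneseries_lim_ge (P := xpredT) N _); last first.
  by move=> h _ _; rewrite term lee_fin sqr_ge0.
by rewrite le_eqVlt; apply/orP; left; apply/eqP; apply: eq_bigr => h _; rewrite -term.
Qed.

Variables (U : set_system nat) (UU : UltraFilter U) (Uoo : \oo `<=` U).
Variables (Nq : nat -> nat) (Nq0 : forall q, (0 < Nq q)%N).
Hypothesis Nq_inc : {homo Nq : p q / (p < q)%N}.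
Local Notation L := (@sample_mean R U UU Nq Nq0).

Let Lb (f : nat -> R) : bounded_real f -> mdom L f. Proof. by []. Qed.

Let Lshift (f : nat -> R) : bounded_real f -> L (fun n => f n.+1) = L f.
Proof. exact: sample_mean_shift. Qed.

Let bounded_chi_x k : bounded_complex (fun n => chi k (x n)).
Proof. by exists 1 => n; rewrite nsq_chi. Qed.

(** The correlation at shift h is the mean of the character over the differences,
    which exp_average_discrepancy bounds by the upper discrepancy up to a
    constant. *)
Lemma corr_l2_chi (k : {ffun 'I_d -> int}) : k != 0 ->
  corr_l2 L (fun n => chi k (x n)).
Proof.
move=> k0; have [B HB] := delta_sum.
set K : R := koksma_const k.
have K0 : 0 <= K.
  by apply: prodr_ge0 => i _; rewrite addr_ge0// !mulr_ge0// pi_ge0.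
have corr_le h : nsq (corr L (fun n => chi k (x n)) h) <= (K * delta h) ^+ 2.
  have -> : corr L (fun n => chi k (x n)) h = cmean L (fun n => chi k (y h n)).
    by congr cmean; apply/funext => n; rewrite chi_sub_mod1.
  have d0 : 0 <= delta h by have [] := upper_discrepancy_fin (y h).
  have near_bound (e : R) : 0 < e ->
      nsq (cmean L (fun n => chi k (y h n))) <= (K * (delta h + e)) ^+ 2.
    move=> e0; apply: nsq_sample_mean_le => //.
    - by exists 1 => n; rewrite nsq_chi.
    - by rewrite mulr_ge0// addr_ge0// ltW.
    have [n0 _ Hn] := near_le_upper_discrepancy (y h) e0.
    exists n0.+1 => // N /= nN; have N0 : (0 < N)%N by exact: leq_trans nN.
    apply: le_trans (exp_average_discrepancy k0 N0 (y01 h)) _.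
    by rewrite ler_wpM2l//; apply: Hn; exact: ltnW.
  set c := nsq _ in near_bound *.
  have [] := leP c ((K * delta h) ^+ 2) => // lt.
  have lim : (K * (delta h + n.+1%:R^-1)) ^+ 2 @[n --> \oo] --> (K * delta h) ^+ 2.
    rewrite -[X in _ --> (K * X) ^+ 2]addr0 !expr2.
    under eq_fun do rewrite expr2.
    have l1 : K * (delta h + n.+1%:R^-1) @[n --> \oo] --> K * (delta h + 0).
      by apply: cvgMr; apply: cvgD; [exact: cvg_cst|exact: cvg_harmonic].
    exact: (cvgM l1 l1).
  suff : c <= (K * delta h) ^+ 2 by rewrite leNgt lt.
  rewrite -(cvg_lim (@Rhausdorff R) lim); apply: limr_ge.
    by apply/cvg_ex; eexists; exact: lim.
  by apply: nearW => n; apply: near_bound; rewrite invr_gt0 ltr0n.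
have B0 : 0 <= B by have := HB 0%N; rewrite big_geq.
(* the series of the hypothesis starts at the shift 1 *)
exists ((K * delta 0%N) ^+ 2 + K ^+ 2 * B) => -[|N].
  by rewrite big_ord0 addr_ge0 ?sqr_ge0// mulr_ge0 ?sqr_ge0.
apply: le_trans (ler_sum _ (fun (h : 'I_N.+1) _ => corr_le h)) _.
rewrite -(big_mkord xpredT (fun h => (K * delta h) ^+ 2)) big_ltn// lerD2l.
under eq_bigr do rewrite exprMn.
by rewrite -mulr_sumr ler_wpM2l ?sqr_ge0.
Qed.

Lemma corr_l2_trig_poly (q : 'rV[R]_d -> C) : trig_poly (predC1 0) q ->
  corr_l2 L (fun n => q (x n)).
Proof.
elim=> [|c k k0|p1 p2 t1 IH1 t2 IH2].
- exists 0 => N; rewrite big1// => h _; rewrite /corr.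
  rewrite (_ : (fun n : nat => _) = (fun=> 0)) ?cmean_cst ?nsq0//.
  by apply/funext => n; rewrite mul0r.
- by apply: corr_l2Z => //; exact: corr_l2_chi.
- apply: corr_l2D => //.
    exact: (bounded_complex_comp x (bounded_trig_poly t1)).
  exact: (bounded_complex_comp x (bounded_trig_poly t2)).
Qed.

(** This mean agrees with the integral on continuous functions (I0_integral), but is
    defined for all bounded functions, as is the mean along [x]. *)
Let I0 : mean R 'rV[R]_d := ultramean UU (@grid_gt0 R d).

Let I0_chi k : k != 0 -> cmean I0 (chi k) = 0.
Proof.
move=> k0.
have avg0 : \forall q \near \oo,
    average (grid q) (fun v => complex.Re (@chi R d k v)) = 0 /\
    average (grid q) (fun v => complex.Im (@chi R d k v)) = 0.
  exists (\max_i `|k i|)%N => // q /= kq.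
  have := @grid_chi R d k q k0 => gk.
  have {gk} : \sum_(J : {ffun 'I_d -> 'I_q.+1}) chi k (corner J) = 0 :> C.
    by apply: gk => i; rewrite ltnS (leq_trans _ kq)// leq_bigmax.
  rewrite !average_grid => S0; split.
    rewrite (_ : \sum_J _ = complex.Re (\sum_(J : {ffun 'I_d -> 'I_q.+1}) chi k (corner J))).
      by rewrite S0 mulr0.
    by rewrite (big_morph _ (@ReE_add R) (erefl : complex.Re (0 : C) = 0)).
  rewrite (_ : \sum_J _ = complex.Im (\sum_(J : {ffun 'I_d -> 'I_q.+1}) chi k (corner J))).
    by rewrite S0 mulr0.
  by rewrite (big_morph _ (@ImE_add R) (erefl : complex.Im (0 : C) = 0)).
have cvg0 (a : nat -> R) : (\forall q \near \oo, a q = 0) -> a q @[q --> \oo] --> (0 : R).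
  move=> [n0 _ H]; apply/cvgrPdist_le => e e0; exists n0 => // q /= nq.
  by rewrite H// subrr normr0 ltW.
apply: complex_ext; apply: ulim_eq => //; apply: cvg0.
  by apply: filterS avg0 => q [].
by apply: filterS avg0 => q [].
Qed.

Let Mmean := half_mean (pullback_mean x L) I0.

Let Mb (f : 'rV[R]_d -> R) : bounded_real f -> mdom Mmean f.
Proof. by move=> [B fB]; split; exists B => t; exact: fB. Qed.

Let Mchi k : k != 0 -> cmean Mmean (chi k) = 0.
Proof.
move=> k0.
have h1 : cmean L (fun n => chi k (x n)) = 0.
  by apply: (cmean_eq0_of_corr_l2 Lb Lshift) => //; exact: corr_l2_chi.
have h2 := I0_chi k0.
move: h1 h2 => [r1 i1] [r2 i2].
apply: complex_ext; rewrite /= /comp.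
  by rewrite r1 r2 addr0 mul0r.
by rewrite i1 i2 addr0 mul0r.
Qed.

Let I0_cube (f g : 'rV[R]_d -> R) : (forall v, unit_cube v -> f v = g v) -> I0 f = I0 g.
Proof.
move=> fg; congr ulim; apply/funext => q; rewrite !average_grid; congr (_ * _).
by apply: eq_bigr => J _; apply: fg; exact: corner_cube.
Qed.

Let Mcube (f g : 'rV[R]_d -> R) : (forall v, unit_cube v -> f v = g v) ->
  Mmean f = Mmean g.
Proof.
move=> fg; have fgx : f \o x = g \o x by apply/funext => n; exact: fg.
rewrite -[LHS]/((L (f \o x) + I0 f) / 2) -[RHS]/((L (g \o x) + I0 g) / 2).
by rewrite fgx (I0_cube fg).
Qed.

Let I0_integral (f : 'rV[R]_d -> C^o) : {within unit_cube, continuous f} ->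
  cmean I0 (cube_restrict f) = Cintegral (lebesgue_rV R d) unit_cube f.
Proof.
move=> cf.
have key (p : C -> R) : (forall z w, p (z - w) = p z - p w) ->
    (forall z, p z ^+ 2 <= nsq z) ->
    I0 (fun v => p (cube_restrict f v)) = \int[lebesgue_rV R d]_(v in unit_cube) p (f v).
  move=> pB pn.
  have unif (e : R) : 0 < e -> exists m : nat, forall u v,
      unit_cube u -> unit_cube v ->
      (forall i, `|u ord0 i - v ord0 i| <= m.+1%:R^-1) -> `|p (f u) - p (f v)| <= e.
    move=> e0; have e2 : 0 < e ^+ 2 by rewrite exprn_gt0.
    have [m H] := cube_uniform_continuous cf e2; exists m => u v cu cv uv.
    rewrite -ler_sqr ?nnegrE ?(ltW e0)// real_normK ?num_real// -pB.
    exact: le_trans (pn _) (H u v cu cv uv).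
  have -> : I0 (fun v => p (cube_restrict f v)) = I0 (fun v => p (f v)).
    by apply: I0_cube => v cv; rewrite /cube_restrict; case: asboolP.
  by apply: ulim_eq => //; exact: average_grid_cvg.
apply: complex_ext; apply: key.
- by move=> [? ?] [? ?].
- exact: Re_sqr_le_nsq.
- by move=> [? ?] [? ?].
- by move=> z; rewrite /nsq lerDr sqr_ge0.
Qed.

(** Let [p] approximate [f] for the half-sum of the mean along [x] and of the grid
    mean, and let [c] be its constant term. As [f] has integral 0 and nontrivial
    characters have grid mean 0, [c] is the grid mean of p - f, which is small by
    the inequality of Cauchy and Schwarz. So p - c still approximates [f] along
    [x]. *)
Lemma approximation_along_sequence (f : 'rV[R]_d -> C^o) (e : R) :
  {within unit_cube, continuous f} ->
  Cintegral (lebesgue_rV R d) unit_cube f = 0 -> 0 < e ->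
  exists w, [/\ bounded_complex w, corr_l2 L w &
     L (fun n => nsq (f (x n) - w n)) <= e].
Proof.
move=> cf int0 e0; have e8 : 0 < e / 8 by rewrite divr_gt0.
have [bf af] := approximable_continuous Mb Mchi Mcube cf.
have [p [tp fp]] := af _ e8.
have [c [q [tq pE]]] := trig_poly_split tp.
have bq := bounded_trig_poly tq; have bp := bounded_trig_poly tp.
have bfp := bounded_complexB bf bp.
have bI (h : 'rV[R]_d -> R) : bounded_real h -> mdom I0 h by [].
have fxE n : cube_restrict f (x n) = f (x n) := cube_restrictE f (x_cube n).
have l0 : 0 <= L (fun n => nsq (f (x n) - p (x n))).
  apply: mval_ge0 => [|n]; last exact: nsq_ge0.
  have [B HB] := bfp; exists B => n.
  by rewrite ger0_norm ?nsq_ge0// -fxE; exact: HB.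
have i0 : 0 <= I0 (fun v => nsq (cube_restrict f v - p v)).
  by apply: mean_nsq_ge0; exact: bounded_complex_cdom.
have sum_le : L (fun n => nsq (f (x n) - p (x n))) +
    I0 (fun v => nsq (cube_restrict f v - p v)) <= e / 4.
  move: fp => /=; rewrite /comp.
  under [X in ultramean_val _ _ X + _]eq_fun do rewrite fxE.
  by rewrite -[X in X + _]/(L _) -[X in _ + X]/(I0 _); lra.
have cI : cmean I0 (fun v => p v - cube_restrict f v) = c.
  rewrite cmeanB; [|exact: bounded_complex_cdom|exact: bounded_complex_cdom].
  rewrite I0_integral// int0 subr0 pE cmeanD; last 2 first.
  - exact: cdom_cst.
  - exact: bounded_complex_cdom.
  rewrite cmean_cst -[RHS]addr0; congr (_ + _).
  elim: tq {pE bq} => [|a k k0|p1 p2 t1 IH1 t2 IH2].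
  - exact: cmean_cst.
  - rewrite cmeanZ ?I0_chi ?mulr0//; apply: bounded_complex_cdom => //.
    exact: bounded_chi.
  - rewrite cmeanD ?IH1 ?IH2 ?addr0//; apply: bounded_complex_cdom => //.
      exact: bounded_trig_poly t1.
    exact: bounded_trig_poly t2.
have c_le : nsq c <= e / 4.
  have bpf := bounded_complexB bp bf.
  have := cmean_nsq_le (bounded_complex_cdom bI bpf); rewrite cI => h.
  apply: le_trans h _.
  have -> : (fun v => nsq (p v - cube_restrict f v)) =
      (fun v => nsq (cube_restrict f v - p v)).
    by apply/funext => v; rewrite -nsqN opprB.
  lra.
have bqx : bounded_complex (fun n => q (x n)) by exact: (bounded_complex_comp x bq).
exists (fun n => q (x n)); split=> //; first exact: corr_l2_trig_poly.
have bfx : bounded_complex (fun n => f (x n) - p (x n)).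
  by have [B HB] := bfp; exists B => n; rewrite -fxE; exact: HB.
have -> : (fun n => nsq (f (x n) - q (x n))) =
    (fun n => nsq ((f (x n) - p (x n)) + c)).
  by apply/funext => n; rewrite pE; congr nsq; ring.
apply: le_trans (mean_nsqD _ _) _; [exact: bounded_complex_cdom|exact: cdom_cst|].
by rewrite mval_cst; lra.
Qed.

Lemma autocorrelation_density (f : 'rV[R]_d -> C^o) :
  {within unit_cube, continuous f} ->
  Cintegral (lebesgue_rV R d) unit_cube f = 0 ->
  exists g : R -> R, (@lebesgue_measure R).-integrable `[0, 1] (EFin \o g) /\
    forall h, Cintegral (@lebesgue_measure R) `[0, 1]
      (fun t => (g t)%:C * cexp2pi (h%:R * t)) = corr L (f \o x) h.
Proof.
move=> cf int0; apply: spectral_density => //.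
  have [B HB] := bounded_cube_restrict cf; exists B => n /=.
  by rewrite -(cube_restrictE f (x_cube n)).
by move=> e e0; exact: approximation_along_sequence.
Qed.

End sL.

Theorem theorem3p2 (R : realType) (d : nat) (d_gt0 : (0 < d)%N)
    (x : nat -> 'rV[R]_d) (x_cube : forall n, unit_cube (x n))
    (sum_disc : (\sum_(1 <= h <oo)
       (upper_discrepancy (fun n => sub_mod1 (x (n + h)%N) (x n)) ^+ 2) < +oo)%E) :
  sL_sequence x.
Proof.
move=> f cf int0; split.
  have [B HB] := bounded_cube_restrict cf.
  exists (Num.sqrt B)%:C; split; first by rewrite realE ler0c sqrtr_ge0.
  move=> M ltM n _ /=; apply: le_trans (ltW ltM).
  rewrite normc_def lecR ler_wsqrtr//.
  by rewrite -/(nsq _) -(cube_restrictE f (x_cube n)).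
move=> Nq [_ Nq0 Nq_inc cvgNq].
have [U [UU Uoo]] := @ultraFilterLemma nat (\oo : set_system nat) _.
have [g [ig gE]] := autocorrelation_density x_cube sum_disc UU Uoo Nq0 Nq_inc cf int0.
exists (fun t => (g t)%:C).
  split=> //=; exact: (integrable0 _).
move=> h; have lim := cvgNq h.
by rewrite gE (corr_sample_mean UU Uoo Nq0 lim).
Qed.
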